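(* For the bulk domains ($i=1,2$), there is a constant $C$, independent of $h\in(0,h_0]$, such that for all $v\in W_{h,i}$, $$\sum_{k=0}^1h^{2k-1}\|[\nabla^kv]\|_{\mathcal F_{h,i}}^2\le C\Big(\|\nabla v\|_{\mathcal K_{h,i}}^2+h^{-1}\|[v]\|_{\mathcal E_{h,i}}^2+\sum_{M\in\mathcal M_{h,i}}\sum_{k=0}^1h^{2k-1}\|[\nabla^kv]\|_{\mathcal F_{h,i}(M)}^2\Big).$$
   Context: $\Omega\subset\mathbb R^d$, $d\in\{2,3\}$, is a domain with convex polygonal boundary, partitioned into subdomains $\Omega_1,\Omega_2$ by a smooth closed $(d-1)$-dimensional interface $\Omega_0$; $\Omega_2$ is the part inside $\Omega_0$, so $\partial\Omega\subset\partial\Omega_1$. For some $\delta_0>0$ the closest point map onto $\Omega_0$ is well defined on the tubular neighborhood of $\Omega_0$ of thickness $\delta_0$, which is contained in $\Omega$. $\mathcal T_h$, $h\in(0,h_0]$ ($h_0$ small enough), is a quasiuniform partition of $\Omega$ into shape regular simplices. $\mathcal T_{h,i}=\{T\in\mathcal T_h:T\cap\Omega_i\ne\emptyset\}$; $\mathcal F_{h,i}$ is the set of interior faces of $\mathcal T_{h,i}$ (full, uncut faces); $\mathcal K_{h,i}=\{T\cap\Omega_i:T\in\mathcal T_{h,i}\}$, $\mathcal E_{h,i}=\{F\cap\Omega_i:F\in\mathcal F_{h,i}\}$. $V_h$ is the space of discontinuous piecewise linear ($P_1$) functions on $\mathcal T_h$ vanishing on $\partial\Omega$ and $W_{h,i}=V_h|_{\mathcal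 T_{h,i}}$. $[v]=v_1-v_2$ is the jump across a face shared by $T_1,T_2$, $v_l=v|_{T_l}$; $[\nabla^0v]=[v]$, $[\nabla^1v]=[\nabla v]$ (jump of the full gradient). $\|\cdot\|_\omega$ is the $L^2$ norm over $\omega$ (squares summed over the members if $\omega$ is a collection of sets). Macro elements: $T\in\mathcal T_{h,i}$ has a large intersection if $\gamma_i\le|T\cap\Omega_i|/h_T^{d}$ ($i=1,2$), with $\gamma_i>0$ a constant independent of $T$ and $h$. $\mathcal M_{h,i}$ is a macro element partition: each $T\in\mathcal T_{h,i}$ belongs to exactly one set $\mathcal T_{h,i,M}$, $M=\bigcup_{T\in\mathcal T_{h,i,M}}T$, and $\mathcal T_{h,i,M}$ contains an element $T_M$ with a large intersection to which all its elements are connected via a uniformly bounded number of interior faces of $\mathcal T_{h,i,M}$ (the number of elements per macro element is uniformly bounded). $\mathcal F_{h,i}(M)$ is the set of interior faces of $\mathcal T_{h,i,M}$ (full faces). *)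

(* Defs.v *)
From HB Require Import structures.
From mathcomp Require Import all_boot all_order all_algebra.
From mathcomp Require Import all_classical all_reals all_analysis.

Set Implicit Arguments.
Unset Strict Implicit.
Unset Printing Implicit Defensive.

Import Order.TTheory GRing.Theory Num.Theory.
Import numFieldNormedType.Exports.

Local Open Scope classical_set_scope.
Local Open Scope ring_scope.

(* The library has Lebesgue measure on R and binary product measures only:
   Lebesgue measure on R^n is built as an iterated product, on n-tuples. *)

Section cons_measure.
Context (R : realType) (n : nat).
Variable mu :
  {sigma_finite_measure set (n.-tuple (measurableTypeR R)) -> \bar R}.

Definition consT (z : measurableTypeR R * n.-tuple (measurableTypeR R)) :
  n.+1.-tuple (measurableTypeR R) := [tuple of z.1 :: z.2].

Lemma measurable_consT : measurable_fun setT consT.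
Proof. exact: measurable_cons measurable_fst measurable_snd. Qed.

Definition cons_measure : set (n.+1.-tuple (measurableTypeR R)) -> \bar R :=
  pushforward (@lebesgue_measure R \x mu)%E consT.

Let cons_measure0 : cons_measure set0 = 0%E.
Proof. by rewrite /cons_measure /pushforward preimage_set0 measure0. Qed.

Let cons_measure_ge0 A : (0 <= cons_measure A)%E.
Proof. by rewrite /cons_measure /pushforward. Qed.

Let cons_measure_sigma_additive : semi_sigma_additive cons_measure.
Proof.
move=> F mF tF mUF; rewrite /cons_measure /pushforward preimage_bigcup.
apply: measure_semi_sigma_additive.
- by move=> k; rewrite -[X in measurable X]setTI; exact: measurable_consT.
- apply/trivIsetP => /= i j _ _ ij; rewrite -preimage_setI.
  by move/trivIsetP : tF => /(_ _ _ _ _ ij) ->//; rewrite preimage_set0.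
- by rewrite -preimage_bigcup -[X in measurable X]setTI; exact: measurable_consT.
Qed.

HB.instance Definition _ := isMeasure.Build _ _ _ cons_measure
  cons_measure0 cons_measure_ge0 cons_measure_sigma_additive.

Let unconsT (t : n.+1.-tuple (measurableTypeR R)) :
  measurableTypeR R * n.-tuple (measurableTypeR R) :=
  (tnth t ord0, [tuple of behead t]).

Let cons_measure_sigma_finite : sigma_finite setT cons_measure.
Proof.
have /sigma_finiteP[F [TF ndF Foo]] := sigma_finiteT (@lebesgue_measure R).
have /sigma_finiteP[G [TG ndG Goo]] := sigma_finiteT mu.
have measurable_unconsT : measurable_fun setT unconsT.
  by apply/measurable_fun_pairP; split;
    [exact: measurable_tnth | exact: measurable_behead].
have consK : cancel consT unconsT.
  by move=> [x t]; congr pair; apply: val_inj.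
exists (fun k => unconsT @^-1` (F k `*` G k)).
  rewrite -preimage_bigcup (_ : \bigcup_k _ = setT) ?preimage_setT//.
  apply/seteqP; split=> // -[x t] _.
  have [i _ Fix] : (\bigcup_k F k) x by rewrite -TF.
  have [j _ Gjt] : (\bigcup_k G k) t by rewrite -TG.
  exists (maxn i j) => //; split => /=.
    by move: x Fix; exact/subsetPset/ndF/leq_maxl.
  by move: t Gjt; exact/subsetPset/ndG/leq_maxr.
move=> k; have [mF Ffin] := Foo k; have [mG Gfin] := Goo k; split.
  by rewrite -[X in measurable X]setTI; apply: measurable_unconsT => //; exact: measurableX.
rewrite /cons_measure /pushforward -comp_preimage.
rewrite (_ : unconsT \o consT = id); last exact/funext.
by rewrite preimage_id product_measure1E// lte_mul_pinfty// ge0_fin_numE.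
Qed.

HB.instance Definition _ := Measure_isSigmaFinite.Build _ _ _ cons_measure
  cons_measure_sigma_finite.

End cons_measure.

Fixpoint lebesgue_tuple (R : realType) (n : nat) :
    {sigma_finite_measure set (n.-tuple (measurableTypeR R)) -> \bar R} :=
  match n with
  | 0 => @dirac _ (0.-tuple (measurableTypeR R)) [tuple] R
  | m.+1 => cons_measure (lebesgue_tuple R m)
  end.

Definition row_of (R : realType) (n : nat) (t : n.-tuple (measurableTypeR R)) :
  'rV[R]_n := \row_(j < n) tnth t j.

Definition integral_rV (R : realType) (n : nat) (A : set 'rV[R]_n)
    (f : 'rV[R]_n -> R) : R :=
  (\int[lebesgue_tuple R n]_(t in [set t | A (row_of t)]) f (row_of t))%R.

Definition volume (R : realType) (n : nat) (A : set 'rV[R]_n) : R :=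
  fine (lebesgue_tuple R n [set t | A (row_of t)]).

(* The library norm on row vectors is the sup norm. *)
Definition dotv (R : realType) (d : nat) (x y : 'rV[R]_d) : R :=
  \sum_(j < d) x 0 j * y 0 j.

Definition enorm (R : realType) (d : nat) (x : 'rV[R]_d) : R :=
  Num.sqrt (dotv x x).

Definition boundary (R : realType) (d : nat) (A : set 'rV[R]_d) :
  set 'rV[R]_d := closure A `\` interior A.

Definition diameter (R : realType) (d : nat) (A : set 'rV[R]_d) : R :=
  sup [set r | exists x y, [/\ A x, A y & r = enorm (x - y)]].

Section hull.
Context (R : realType) (d N : nat).
Variable p : 'I_N -> 'rV[R]_d.

Definition hull (S : {set 'I_N}) : set 'rV[R]_d :=
  [set x | exists l : 'I_N -> R,
     [/\ forall j, 0 <= l j, forall j, j \notin S -> l j = 0,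
         \sum_j l j = 1 & x = \sum_j l j *: p j]].

Definition affine_indep (S : {set 'I_N}) : Prop :=
  forall l : 'I_N -> R, (forall j, j \notin S -> l j = 0) ->
    \sum_j l j = 0 -> \sum_j l j *: p j = 0 -> forall j, l j = 0.

End hull.

Definition domain (R : realType) (d : nat) (A : set 'rV[R]_d) : Prop :=
  [/\ A !=set0, open A & connected A].

Definition open_convex_polytope (R : realType) (d : nat) (A : set 'rV[R]_d) :
    Prop :=
  A !=set0 /\
  exists (N : nat) (p : 'I_N -> 'rV[R]_d), A = interior (hull p [set: 'I_N]%SET).

Fixpoint Ck (R : realType) (d k : nat) (f : 'rV[R]_d -> R) : Prop :=
  match k with
  | 0 => continuous f
  | m.+1 => [/\ continuous f,
      forall (j : 'I_d) x, derivable f x (delta_mx 0 j) &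
      forall j : 'I_d, Ck m (fun x => 'D_(delta_mx 0 j) f x)]
  end.

Definition smooth (R : realType) (d : nat) (f : 'rV[R]_d -> R) : Prop :=
  forall k, Ck k f.

(* Compact embedded submanifold of codimension 1 without boundary: near each of
   its points it is the graph of a smooth function of all the coordinates but
   the [j]-th ([col' j x] drops the [j]-th coordinate of [x]). *)
Definition smooth_closed_hypersurface (R : realType) (d : nat)
    (G : set 'rV[R]_d) : Prop :=
  compact G /\
  forall x0, G x0 -> exists (U : set 'rV[R]_d) (j : 'I_d)
      (g : 'rV[R]_d.-1 -> R),
    [/\ open U, U x0, smooth g &
        forall x, U x -> (G x <-> x 0 j = g (col' j x))].

Definition tubular_neighborhood (R : realType) (d : nat) (G : set 'rV[R]_d)
    (delta : R) : set 'rV[R]_d :=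
  [set x | exists2 y, G y & enorm (x - y) < delta].

Definition is_closest_point (R : realType) (d : nat) (G : set 'rV[R]_d)
    (x y : 'rV[R]_d) : Prop :=
  G y /\ forall z, G z -> enorm (x - y) <= enorm (x - z).

(* [ig_bd2] and [ig_bd1] say that [Om2] is the part inside [Om0] and that [Om1]
   is the part between [Om0] and the outer boundary. *)
Record interface_geometry (R : realType) (d : nat)
    (Om Om0 Om1 Om2 : set 'rV[R]_d) (delta0 : R) : Prop := {
  ig_polytope : open_convex_polytope Om ;
  ig_interface : smooth_closed_hypersurface Om0 ;
  ig_dom1 : domain Om1 ;
  ig_dom2 : domain Om2 ;
  ig_cover : Om = Om1 `|` Om0 `|` Om2 ;
  ig_disj12 : Om1 `&` Om2 = set0 ;
  ig_disj01 : Om0 `&` Om1 = set0 ;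
  ig_disj02 : Om0 `&` Om2 = set0 ;
  ig_bd2 : boundary Om2 = Om0 ;
  ig_bd1 : boundary Om1 = boundary Om `|` Om0 ;
  ig_delta0 : 0 < delta0 ;
  ig_tube : tubular_neighborhood Om0 delta0 `<=` Om ;
  ig_closest : forall x, tubular_neighborhood Om0 delta0 x ->
    exists! y, is_closest_point Om0 x y }.

(* Elements and faces are given by their sets of vertices. *)
Record mesh (R : realType) (d : nat) := Mesh {
  nv : nat ;
  node : 'I_nv -> 'rV[R]_d ;
  cells : {set {set 'I_nv}} }.

Section mesh.
Context (R : realType) (d : nat).
Variable m : mesh R d.

Notation cell := {set 'I_(nv m)}.

Definition region (S : cell) : set 'rV[R]_d := hull (@node _ _ m) S.

Definition diam_cell (T : cell) : R := diameter (region T).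

(* Partition of [Om] into simplices, conforming (face to face). *)
Record triangulation (Om : set 'rV[R]_d) : Prop := {
  tri_simplex : forall T, T \in cells m ->
    #|T| = d.+1 /\ affine_indep (@node _ _ m) T ;
  tri_conform : forall T T', T \in cells m -> T' \in cells m ->
    region T `&` region T' = region (T :&: T')%SET ;
  tri_cover : closure Om =
    [set x | exists2 T, T \in cells m & region T x] }.

Definition quasiuniform (kappa h : R) : Prop :=
  forall T, T \in cells m -> diam_cell T <= h <= kappa * diam_cell T.

(* Each simplex contains a Euclidean ball of radius comparable to its
   diameter. *)
Definition shape_regular (sigma : R) : Prop :=
  forall T, T \in cells m -> exists c, forall x,
    sigma * enorm (x - c) <= diam_cell T -> region T x.

Definition active (D : set 'rV[R]_d) : {set cell} :=
  [set T in cells m | `[< region T `&` D !=set0 >]]%SET.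

Definition face_adj : rel cell := fun T T' => #|(T :&: T')%SET| == d.

(* The interior faces of a set of elements, each one represented once, by the
   pair of elements sharing it; [enum_rank] only serves to choose which of the
   two comes first (the sign of the jump is irrelevant). *)
Definition int_faces (A : {set cell}) : {set cell * cell} :=
  [set F : cell * cell | [&& F.1 \in A, F.2 \in A, face_adj F.1 F.2 &
                             (enum_rank F.1 < enum_rank F.2)%N]]%SET.

Definition face (F : cell * cell) : cell := (F.1 :&: F.2)%SET.

(* Integral of [f] over the part of the face [S] inside [B], with respect to
    surface measure, by affine parametrization of the face. *)

Definition vertex (S : cell) (k : nat) : 'rV[R]_d :=
  nth 0 [seq node j | j <- enum S] k.

Definition edges (S : cell) : 'M[R]_(d.-1, d) :=
  \matrix_(k < d.-1) (vertex S k.+1 - vertex S 0%N).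

Definition face_param (S : cell) (s : 'rV[R]_d.-1) : 'rV[R]_d :=
  vertex S 0%N + s *m edges S.

Definition face_integral (S : cell) (B : set 'rV[R]_d) (f : 'rV[R]_d -> R) :
    R :=
  Num.sqrt (\det (edges S *m (edges S)^T)) *
  integral_rV [set s | (region S `&` B) (face_param S s)]
    (fun s => f (face_param S s)).

(* Discontinuous piecewise linear functions: the pair [(a, b)] is the affine
    function x |-> a . x + b, of gradient a. *)

Definition p1 : Type := ('rV[R]_d * R)%type.
Definition p1_eval (f : p1) (x : 'rV[R]_d) : R := dotv f.1 x + f.2.
Definition p1_grad (f : p1) : 'rV[R]_d := f.1.

Definition dgfun : Type := cell -> p1.

(* "Vanishing on the boundary" is meant for the traces on the boundary faces. *)
Definition Vh (Om : set 'rV[R]_d) (v : dgfun) : Prop :=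
  forall T, T \in cells m -> forall S : cell, S \subset T -> #|S| = d ->
    region S `<=` boundary Om -> forall x, region S x -> p1_eval (v T) x = 0.

(* Restriction of [Vh] to the active mesh: only the values on the active
   elements matter. *)
Definition Wh (Om D : set 'rV[R]_d) (v : dgfun) : Prop :=
  exists2 w, Vh Om w & forall T, T \in active D -> v T = w T.

Definition jump (v : dgfun) (F : cell * cell) (x : 'rV[R]_d) : R :=
  p1_eval (v F.1) x - p1_eval (v F.2) x.

Definition jump_grad (v : dgfun) (F : cell * cell) (x : 'rV[R]_d) :
  'rV[R]_d := p1_grad (v F.1) - p1_grad (v F.2).

Definition jump_norm2 (FF : {set cell * cell}) (B : set 'rV[R]_d) (v : dgfun) :
    R :=
  \sum_(F in FF) face_integral (face F) B (fun x => jump v F x ^+ 2).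

Definition jump_grad_norm2 (FF : {set cell * cell}) (B : set 'rV[R]_d)
    (v : dgfun) : R :=
  \sum_(F in FF) face_integral (face F) B
    (fun x => enorm (jump_grad v F x) ^+ 2).

Definition grad_norm2 (D : set 'rV[R]_d) (v : dgfun) : R :=
  \sum_(T in active D)
    integral_rV (region T `&` D) (fun=> enorm (p1_grad (v T)) ^+ 2).

(* Sum over k = 0, 1 of h^(2k-1) times the squared norm of the jump of the k-th
   derivative over full faces. *)
Definition stab (h : R) (FF : {set cell * cell}) (v : dgfun) : R :=
  h^-1 * jump_norm2 FF setT v + h * jump_grad_norm2 FF setT v.

(* [gamma] is the large intersection constant, [N]
    bounds the number of elements of a macro element and the number of faces
    crossed when going from its large element to any other one. *)

Definition large_intersection (D : set 'rV[R]_d) (gamma : R) (T : cell) :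
  Prop := gamma <= volume (region T `&` D) / diam_cell T ^+ d.

Definition macro_partition (D : set 'rV[R]_d) (gamma : R) (N : nat)
    (MM : {set {set cell}}) : Prop :=
  finset.partition MM (active D) /\
  forall M : {set cell}, M \in MM ->
    (#|M| <= N)%N /\
    exists TM, [/\ TM \in M, large_intersection D gamma TM &
      forall T, T \in M -> exists p : seq cell,
        [/\ path face_adj TM p, last TM p = T,
            {subset p <= M} & (size p <= N)%N]].

End mesh.

Arguments region {R d m}.
Arguments active {R d}.
Arguments triangulation {R d}.
Arguments quasiuniform {R d}.
Arguments shape_regular {R d}.
Arguments Wh {R d}.
Arguments macro_partition {R d}.
Arguments grad_norm2 {R d m}.
Arguments jump_norm2 {R d m}.
Arguments stab {R d m}.
Arguments int_faces {R d m}.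

(* Main.v *)
(** Let [F] be a face shared by two active elements. Gradients are controlled
    everywhere: each element is joined inside its macro element to one with a
    large intersection, through faces whose gradient jumps are on the right-hand
    side. The jump of [v] across [F] is the difference of the two traces at a
    point of [F], which telescopes along any chain of adjacent elements joining
    the two sides. If every face of the chain is either interior to a macro
    element or meets [Omega_i] in a fixed fraction (it contains a homothetic copy
    of the face), each term is bounded by a local part of the right-hand side.

    Such a chain exists. Away from the interface it is obtained by crossing a
    ball intersected with [Omega]. Near the interface, [Omega_i] lies on one side
    of a Lipschitz graph, hence is stable under translations by a cone of vectors.
    A large intersection contains a point [a] with a ball of radius [rho h]
    around it in [Omega_i] (otherwise the intersection would be a thin strip), so
    [a] + ball + cone is a convex subset of [Omega_i]; the two such sets attached
    to the two macro elements meet at distance [O(h)]. A generic segment in an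
    open convex set avoids all faces of codimension 2, so it passes from element
    to element through facets only. The constants are uniform because the
    interface is compact, and the number of elements in a ball of radius [O(h)]
    is bounded. *)
Require Import Defs.
From HB Require Import structures.
From mathcomp Require Import all_boot all_order all_algebra.
From mathcomp Require Import all_classical all_reals all_analysis.
From mathcomp Require Import measurable_realfun ring lra.

Set Implicit Arguments.
Unset Strict Implicit.
Unset Printing Implicit Defensive.

Import Order.TTheory GRing.Theory Num.Theory.
Import numFieldNormedType.Exports.

Local Open Scope classical_set_scope.
Local Open Scope ring_scope.

(** * Convex hulls and hyperplanes *)

(** The obstacle is a face shared by two different macro elements: it may meet [Omega_i] in an
    arbitrarily small piece, or not at all, so no term of the right-hand side sees its jump
    directly. An arbitrary chain of active elements is no better, since its faces may be cut just as
    badly. Hence the convex subsets of [Omega_i] with a margin proportional to [h]: the point where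
    a chain crosses a facet is then the centre of a homothetic copy of that facet lying in
    [Omega_i]. The estimates are pointwise: on such a copy the L2 norm of an affine function bounds
    its maximum over the facet. A single scale suffices. If the part of the right-hand side carried
    by the elements near [x] is [slope ^+ 2 * h ^+ n.+1], then near [x] gradients are O([slope]) and
    differences of traces are O([h * slope]). To sum over the faces, the right-hand side is
    distributed over the elements, each of which is used by boundedly many faces. Distances are sup
    norms, so that balls are boxes; factors [n.+1] compare them with Euclidean norms and scalar
    products. *)

Lemma continuous_sum (R : realType) (T : topologicalType) (V : normedModType R)
    (I : Type) (r : seq I) (F : I -> T -> V) :
  (forall i, continuous (F i)) -> continuous (fun x => \sum_(i <- r) F i x).
Proof.
move=> cF; elim: r => [|i r IH] x; rewrite /continuous_at.
  by under eq_cvg do rewrite big_nil; rewrite big_nil; exact: cvg_cst.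
under eq_cvg do rewrite big_cons.
by rewrite big_cons; apply: cvgD; [exact: cF | exact: IH].
Qed.

Section vectors.
Context (R : realType) (d : nat).
Implicit Types x y z : 'rV[R]_d.

Lemma coord_le_norm x j : `|x 0 j| <= `|x|.
Proof.
rewrite [leRHS]/Num.Def.normr /= mx_normrE.
by apply/bigmax_geP; right => /=; exists (0, j).
Qed.

Lemma norm_le_coord x (c : R) :
  0 <= c -> (forall j, `|x 0 j| <= c) -> `|x| <= c.
Proof.
move=> c0 xc; rewrite [leLHS]/Num.Def.normr /= mx_normrE; apply/bigmax_leP; split=> //.
by move=> [i j] _ /=; rewrite (ord1 i).
Qed.

Lemma norm_lt_coord x (c : R) :
  0 < c -> (forall j, `|x 0 j| < c) -> `|x| < c.
Proof.
move=> c0 xc; rewrite [ltLHS]/Num.Def.normr /= mx_normrE; apply/bigmax_ltP; split=> //.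
by move=> [i j] _ /=; rewrite (ord1 i).
Qed.

Lemma dotv_ge0 x : 0 <= dotv x x.
Proof. by apply: sumr_ge0 => j _; rewrite -expr2 sqr_ge0. Qed.

Lemma enorm_ge0 x : 0 <= enorm x.
Proof. exact: sqrtr_ge0. Qed.

Lemma norm_le_enorm x : `|x| <= enorm x.
Proof.
apply: norm_le_coord; first exact: enorm_ge0.
move=> j; rewrite -sqrtr_sqr ler_wsqrtr//.
rewrite /dotv (bigD1 j)//= -expr2 lerDl; apply: sumr_ge0 => k _.
by rewrite -expr2 sqr_ge0.
Qed.

Lemma normr_dotv_le x y : `|dotv x y| <= d%:R * `|x| * `|y|.
Proof.
apply: (le_trans (ler_norm_sum _ _ _)).
apply: (@le_trans _ _ (\sum_(j < d) `|x| * `|y|)); last first.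
  by rewrite sumr_const card_ord -mulrA mulr_natl.
by apply: ler_sum => j _; rewrite normrM ler_pM// coord_le_norm.
Qed.

Lemma enorm_le_norm x : enorm x <= d%:R * `|x|.
Proof.
have dx0 : 0 <= d%:R * `|x| by rewrite mulr_ge0.
rewrite -[leRHS]ger0_norm// -sqrtr_sqr ler_wsqrtr//.
apply: (le_trans (ler_norm _)); apply: (le_trans (normr_dotv_le _ _)).
rewrite expr2 [leRHS]mulrACA -mulrA ler_wpM2r ?mulr_ge0//.
by rewrite -natrM ler_nat; case: d => // n; rewrite leq_pmulr.
Qed.

Lemma dotvDr x y z : dotv x (y + z) = dotv x y + dotv x z.
Proof. by rewrite -big_split; apply: eq_bigr => j _; rewrite mxE mulrDr. Qed.

Lemma dotvZr x y (c : R) : dotv x (c *: y) = c * dotv x y.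
Proof.
by rewrite mulr_sumr; apply: eq_bigr => j _; rewrite mxE mulrCA.
Qed.

Lemma dotvBl x y z : dotv (x - y) z = dotv x z - dotv y z.
Proof.
by rewrite -sumrB; apply: eq_bigr => j _; rewrite !mxE mulrBl.
Qed.

Lemma dotv_sumr (I : Type) (r : seq I) x (F : I -> 'rV[R]_d) :
  dotv x (\sum_(i <- r) F i) = \sum_(i <- r) dotv x (F i).
Proof.
elim/big_rec2 : _ => [|i a b _ <-]; last by rewrite dotvDr.
by rewrite /dotv big1// => j _; rewrite mxE mulr0.
Qed.

Lemma p1_evalD (f : p1 R d) x y :
  p1_eval f (x + y) = p1_eval f x + dotv f.1 y.
Proof. by rewrite /p1_eval dotvDr addrAC. Qed.

Lemma p1_evalB (f : p1 R d) x y :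
  p1_eval f x - p1_eval f y = dotv f.1 (x - y).
Proof. by rewrite -[x in LHS](subrK y) addrC [_ + y]addrC p1_evalD; ring. Qed.

Lemma p1_eval_segment (f : p1 R d) x y (t : R) :
  p1_eval f (x + t *: (y - x)) =
  (1 - t) * p1_eval f x + t * p1_eval f y.
Proof. by rewrite p1_evalD dotvZr -p1_evalB; ring. Qed.

Lemma continuous_coord j : continuous (fun x => x 0 j).
Proof. exact: coord_continuous. Qed.

Lemma continuous_dotv x : continuous (dotv x).
Proof.
apply: continuous_sum => j y; rewrite /continuous_at.
by apply: (cvgM (cvg_cst _) (@continuous_coord j y)).
Qed.

Lemma continuous_p1_eval (f : p1 R d) : continuous (p1_eval f).
Proof.
by move=> x; rewrite /continuous_at; apply: (cvgD (@continuous_dotv f.1 x) (cvg_cst _)).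
Qed.

Lemma ballE x (r : R) y : ball x r y <-> `|x - y| < r.
Proof. by rewrite mx_norm_ball. Qed.

Lemma open_ballP (U : set 'rV[R]_d) x :
  open U -> U x -> exists2 r : R, 0 < r & forall y, `|x - y| < r -> U y.
Proof.
rewrite openE => Uo /Uo; rewrite /interior -nbhs_ballE => -[r /= r0 xU].
by exists r => // y; rewrite -ballE; exact: xU.
Qed.

Lemma interior_ballP (A : set 'rV[R]_d) x (r : R) :
  0 < r -> (forall y, `|x - y| < r -> A y) -> A° x.
Proof.
move=> r0 xA; rewrite /interior -nbhs_ballE; exists r => //= y.
by rewrite ballE; exact: xA.
Qed.

Lemma open_by_balls (U : set 'rV[R]_d) :
  (forall x, U x -> exists2 r : R, 0 < r & forall y, `|x - y| < r -> U y) ->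
  open U.
Proof.
by move=> UU; rewrite openE => x /UU[r r0 xU]; exact: interior_ballP xU.
Qed.

Lemma open_normball x (r : R) : open [set y | `|x - y| < r].
Proof.
apply: open_by_balls => y /= xy; exists (r - `|x - y|); first by rewrite subr_gt0.
move=> z yz; rewrite -(subrKA y); apply: (le_lt_trans (ler_normD _ _)).
by rewrite addrC -ltrBrDr.
Qed.

Lemma closureP (A : set 'rV[R]_d) x (r : R) :
  closure A x -> 0 < r -> exists2 y, A y & `|x - y| < r.
Proof.
move=> clA r0; have [y [Ay]] := clA _ (nbhsx_ballx x r r0).
by rewrite ballE => xy; exists y.
Qed.

End vectors.

Section convexity.
Context (R : realType) (d : nat).
Implicit Types (x y c : 'rV[R]_d) (A B : set 'rV[R]_d).

Definition convex A : Prop :=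
  forall x y, A x -> A y -> forall t : R, 0 <= t <= 1 -> A (x + t *: (y - x)).

Lemma convexI A B : convex A -> convex B -> convex (A `&` B).
Proof.
by move=> cA cB x y [Ax Bx] [Ay By] t t01; split; [exact: cA | exact: cB].
Qed.

Lemma segment_subr x y c (t : R) :
  x + t *: (y - x) - c = (1 - t) *: (x - c) + t *: (y - c).
Proof.
rewrite !scalerBr !scalerBl !scale1r; apply/rowP => j.
by rewrite !mxE; ring.
Qed.

Lemma convex_normball c (r : R) : convex [set y | `|c - y| < r].
Proof.
move=> x y /= cx cy t /andP[t0 t1]; rewrite distrC segment_subr.
apply: (le_lt_trans (ler_normD _ _)).
rewrite !normrZ (ger0_norm t0) ger0_norm ?subr_ge0//.
rewrite (distrC x) (distrC y).
have [->|t0'] := eqVneq t 0; first by rewrite subr0 mul1r mul0r addr0.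
have t0'' : 0 < t by rewrite lt0r t0' t0.
have : t * `|c - y| < t * r by rewrite ltr_pM2l.
have : (1 - t) * `|c - x| <= (1 - t) * r by rewrite ler_wpM2l ?subr_ge0// ltW.
lra.
Qed.

(* The homothety of centre [x] maps the ball into the convex set. *)
Lemma convex_ball_contract A x c (r t : R) : convex A -> A x ->
  (forall y, `|c - y| < r -> A y) -> 0 < t <= 1 ->
  forall y, `|x + t *: (c - x) - y| < t * r -> A y.
Proof.
move=> cA Ax cr /andP[t0 t1] y xy.
have t0' : t != 0 by rewrite gt_eqF.
pose z := x + t^-1 *: (y - x).
have -> : y = x + t *: (z - x).
  by rewrite /z addrAC subrr add0r scalerA divff// scale1r subrKC.
apply: cA => //; last by rewrite ltW.
apply: cr; rewrite -(ltr_pM2l t0); apply: le_lt_trans xy.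
rewrite -{1}(gtr0_norm t0) -normrZ; rewrite le_eqVlt; apply/orP; left; apply/eqP; congr `|_|.
by rewrite /z; apply/rowP => j; rewrite !mxE; field.
Qed.

Lemma convex_interior A : convex A -> convex A°.
Proof.
move=> cA x y Ax Ay t /andP[t0 t1].
have [r r0 xr] := open_ballP (@open_interior _ A) Ax.
have [s s0 ys] := open_ballP (@open_interior _ A) Ay.
have rs0 : 0 < Num.min r s by rewrite lt_min r0.
apply: (interior_ballP rs0) => z; rewrite lt_min => /andP[zr zs].
(* Moving both endpoints by the same vector [w] moves the point at parameter [t] by [w]. *)
pose w := z - (x + t *: (y - x)).
have -> : z = (x + w) + t *: ((y + w) - (x + w)).
  by rewrite /w; apply/rowP => j; rewrite !mxE; ring.
apply: cA; last by rewrite t0.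
  by apply: interior_subset; apply: xr; rewrite opprD addNKr normrN -normrN opprB.
by apply: interior_subset; apply: ys; rewrite opprD addNKr normrN -normrN opprB.
Qed.

(** Connectedness of the unit interval, phrased with two closed sets: [segment_same_side] applies it
    to complements of open sets, [connect_crossing] to finite unions of cells. *)
Lemma segment_closed_dichotomy (P Q : set R) : closed P -> closed Q ->
  P 0 -> (forall t, 0 <= t <= 1 -> P t \/ Q t) ->
  (forall t, 0 <= t <= 1 -> P t -> Q t -> False) -> P 1.
Proof.
move=> clP clQ P0 PQ PQF.
have := @segment_connected R 0 1.
move/(_ (`[0, 1] `&` P)) => H.
have : `[0, 1] `&` P = `[(0:R), 1]%classic.
  apply: H.
  - by exists 0; split => //=; rewrite in_itv/= lexx ler01.
  - exists (~` Q); first exact: closed_openC.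
    apply/seteqP; split=> t /= []; rewrite in_itv/= => t01 Pt; split=> //.
      by move=> Qt; exact: (PQF t).
    by case: (PQ t t01) => // /Pt.
  - by exists P.
move/seteqP => [_ /(_ 1)]; rewrite /= in_itv/= lexx ler01 => H1.
by case: H1.
Qed.

Lemma continuous_segment x y : continuous (fun t : R => x + t *: (y - x)).
Proof.
move=> t; apply: cvgD; first exact: cvg_cst.
by apply: cvgZr_tmp; exact: cvg_id.
Qed.

End convexity.

Section hulls.
Context (R : realType) (d N : nat).
Variable p : 'I_N -> 'rV[R]_d.
Implicit Types (S T : {set 'I_N}) (x : 'rV[R]_d).

Lemma p1_eval_comb (f : p1 R d) (l : 'I_N -> R) : \sum_j l j = 1 ->
  p1_eval f (\sum_j l j *: p j) = \sum_j l j * p1_eval f (p j).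
Proof.
move=> l1; rewrite /p1_eval dotv_sumr -{1}[f.2]mul1r -l1 mulr_suml -big_split.
by apply: eq_bigr => j _ /=; rewrite dotvZr -mulrDr.
Qed.

Lemma hull_vertex S j : j \in S -> hull p S (p j).
Proof.
move=> jS; exists (fun i => (i == j)%:R); split => //.
- by move=> i iS; case: eqP => // ij; move: iS; rewrite ij jS.
- by rewrite (bigD1 j)//= eqxx big1 ?addr0// => i /negPf ->.
- by rewrite (bigD1 j)//= eqxx scale1r big1 ?addr0// => i /negPf ->; rewrite scale0r.
Qed.

Lemma hull_subset S T : S \subset T -> hull p S `<=` hull p T.
Proof.
move=> ST x [l [l0 lS l1 ->]]; exists l; split => // j jT; apply: lS.
by apply: contra jT; apply: (fintype.subsetP ST).
Qed.

Lemma convex_hull S : convex (hull p S).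
Proof.
move=> x y [l [l0 lS l1 ->]] [k [k0 kS k1 ->]] t /andP[t0 t1].
exists (fun j => (1 - t) * l j + t * k j); split.
- by move=> j; rewrite addr_ge0// mulr_ge0// subr_ge0.
- by move=> j jS; rewrite lS// kS// !mulr0 addr0.
- by rewrite big_split/= -!mulr_sumr l1 k1; ring.
- rewrite -sumrB scaler_sumr -big_split; apply: eq_bigr => j _.
  by apply/rowP => i; rewrite !mxE; ring.
Qed.

Lemma hull_p1_eq0 (f : p1 R d) S : (forall j, j \in S -> p1_eval f (p j) = 0) ->
  forall x, hull p S x -> p1_eval f x = 0.
Proof.
move=> f0 x [l [l0 lS l1 ->]]; rewrite p1_eval_comb// big1// => j _.
have [jS|jS] := boolP (j \in S); first by rewrite f0// mulr0.
by rewrite lS// mul0r.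
Qed.

Lemma hull_bounded S x : hull p S x -> `|x| <= \sum_j `|p j|.
Proof.
move=> [l [l0 lS l1 ->]]; apply: (le_trans (ler_norm_sum _ _ _)).
apply: ler_sum => j _; rewrite normrZ ger0_norm// ler_piMl//.
by rewrite -l1 (bigD1 j)//= lerDl sumr_ge0.
Qed.

Lemma closed_hull S : closed (hull p S).
Proof.
(* Weights outside [S] are confined to the degenerate interval at 0, so the admissible weights form
   a closed part of a compact box, and the hull is its continuous image. *)
pose A (j : 'I_N) : set R := if j \in S then `[0, 1]%classic else `[0, 0]%classic.
have cA : compact [set l : 'rV[R]_N | forall j, A j (l ord0 j)].
  by apply: rV_compact => j; rewrite /A; case: ifP => _; exact: segment_compact.
have csum : continuous (fun l : 'rV[R]_N => \sum_j l ord0 j).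
  by apply: continuous_sum => j; exact: continuous_coord.
have cl1 : closed [set l : 'rV[R]_N | \sum_j l ord0 j = 1].
  by apply: (@closed_comp _ _ (fun l : 'rV[R]_N => \sum_j l ord0 j) [set 1]).
have -> : hull p S = (fun l : 'rV[R]_N => \sum_j l ord0 j *: p j) @`
    ([set l : 'rV[R]_N | forall j, A j (l ord0 j)] `&`
     [set l | \sum_j l ord0 j = 1]).
  apply/seteqP; split=> x.
    move=> [l [l0 lS l1 ->]]; exists (\row_j l j); last first.
      by apply: eq_bigr => j _; rewrite mxE.
    split=> /=.
      move=> j; rewrite mxE /A; case: ifPn => jS /=; rewrite in_itv/=.
        by rewrite l0 -l1 (bigD1 j)//= lerDl sumr_ge0.
      by rewrite lS// lexx.
    by rewrite -[RHS]l1; apply: eq_bigr => j _; rewrite mxE.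
  move=> [l [/= lA l1] <-]; exists (fun j => l ord0 j); split => //.
    by move=> j; have := lA j; rewrite /A; case: ifP => _; rewrite /= in_itv/= => /andP[].
  move=> j /negPf jS; have := lA j; rewrite /A jS/= in_itv/= => lj.
  by apply/eqP; rewrite eq_le andbC.
apply: compact_closed; first exact: norm_hausdorff.
apply: continuous_compact; last exact: compact_closedI.
apply: continuous_subspaceT; apply: continuous_sum => j l.
by rewrite /continuous_at; apply: cvgZr_tmp (@continuous_coord R N j l).
Qed.

(* Two points of the ball differ by an arbitrary small vector, whose barycentric
   coordinates are differences of numbers of [[0, 1]]. *)
Lemma bary_coef_le T (c : 'rV[R]_d) (r : R) (a : 'I_N -> R) :
  affine_indep p T -> 0 < r -> (forall y, `|c - y| < r -> hull p T y) ->
  (forall j, j \notin T -> a j = 0) -> \sum_j a j = 0 ->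
  forall j, `|a j| * r <= 2 * `|\sum_k a k *: p k|.
Proof.
move=> aT r0 cT aT0 a0 j; rewrite leNgt; apply/negP => ajr.
set w := \sum_k _ in ajr.
have aj0 : 0 < `|a j|.
  rewrite -(pmulr_lgt0 _ r0); apply: le_lt_trans ajr; exact: mulr_ge0.
(* The vector [t *: w] is shorter than [r], yet its [j]-th coefficient has modulus 2, while a
   difference of two barycentric coordinates has modulus at most 1. *)
pose t := 2 / `|a j|.
have t0 : 0 < t by rewrite divr_gt0.
have [l [l0 lT l1 cE]] : hull p T c by apply: cT; rewrite subrr normr0.
have [k [k0 kT k1 yE]] : hull p T (c + t *: w).
  apply: cT; rewrite opprD addNKr normrN normrZ gtr0_norm//.
  by rewrite /t mulrAC ltr_pdivrMr// [r * _]mulrC.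
have /(_ j)/eqP : forall i, k i - l i - t * a i = 0.
  apply: aT => [i iT||].
  - by rewrite kT// lT// aT0// mulr0 !subrr.
  - by rewrite !sumrB k1 l1 -mulr_sumr a0 mulr0 !subrr.
  - transitivity (\sum_i (k i *: p i - l i *: p i - t *: (a i *: p i))).
      by apply: eq_bigr => i _; rewrite !scalerBl scalerA.
    by rewrite !sumrB -yE -cE -scaler_sumr -/w [c + _]addrC addrK subrr.
rewrite subr_eq0 => /eqP E.
have : `|t * a j| = 2 by rewrite normrM gtr0_norm// /t divfK// gt_eqF.
rewrite -E => E2.
have kj : k j <= 1 by rewrite -k1 (bigD1 j)//= lerDl sumr_ge0.
have lj : l j <= 1 by rewrite -l1 (bigD1 j)//= lerDl sumr_ge0.
have : `|k j - l j| <= 1 by rewrite ler_norml; have := k0 j; have := l0 j; lra.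
by rewrite E2 => ?; lra.
Qed.

End hulls.

Section hyperplanes.
Context (R : realType) (d : nat).

(** At most [d] linear equations on the [d + 1] coefficients of an affine function have a nonzero
    solution. Its linear part cannot vanish, since the equation of the first column would then make
    the constant term vanish too. *)
Lemma hyperplane_through (s : seq 'rV[R]_d) : (0 < d)%N -> (size s <= d)%N ->
  exists2 f : p1 R d, f.1 != 0 & forall x, x \in s -> p1_eval f x = 0.
Proof.
move=> d0 sd.
(* Past [size s] the columns are the default [0], which only adds the origin to the given points. *)
pose A : 'M[R]_d := \matrix_(i < d, k < d) (nth 0 s k) 0 i.
pose M : 'M[R]_(d + 1, d) := col_mx A (const_mx 1).
have : kermx M != 0.
  rewrite kermx_eq0 /row_free neq_ltn; apply/orP; left.
  by rewrite (leq_ltn_trans (rank_leq_col M))// addn1.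
move=> /rowV0Pn[u uM u0].
have {}uM : u *m M = 0 by apply/sub_kermxP.
have E k : dotv (lsubmx u) (nth 0 s k) + u 0 (rshift d 0) = 0 \/ (d <= k)%N.
  have [|kd] := leqP d k; [by right|left].
  have := congr1 (fun B : 'rV[R]_d => B 0 (Ordinal kd)) uM.
  rewrite -{1}[u]hsubmxK mul_row_col !mxE => <-; congr (_ + _).
    by apply: eq_bigr => i _; rewrite !mxE.
  by rewrite big_ord1 !mxE mulr1.
exists (lsubmx u, u 0 (rshift d 0)) => /=.
  apply: contra u0 => /eqP u0.
  case: (E 0%N) => [|]; last by rewrite leqNgt d0.
  rewrite u0 /dotv big1 => [|j _]; last by rewrite mxE mul0r.
  rewrite add0r => ur; apply/eqP; rewrite -[u]hsubmxK u0.
  apply/rowP => j; rewrite mxE; case: splitP => k _; rewrite !mxE//.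
  by rewrite (ord1 k).
move=> x xs; have xsd : (index x s < d)%N by rewrite (leq_trans _ sd)// index_mem.
case: (E (index x s)) => [|]; first by rewrite nth_index.
by rewrite leqNgt xsd.
Qed.

Lemma p1_neq0_in_open (f : p1 R d) (U : set 'rV[R]_d) : f.1 != 0 -> open U ->
  U !=set0 -> exists2 x, U x & p1_eval f x != 0.
Proof.
move=> f0 oU [x Ux].
have [fx|fx] := eqVneq (p1_eval f x) 0; last by exists x.
have [r r0 xU] := open_ballP oU Ux.
have f0' : 0 < `|f.1| by rewrite normr_gt0.
pose t := r / 2 / `|f.1|.
have t0 : 0 < t by rewrite !divr_gt0.
exists (x + t *: f.1).
  apply: xU; rewrite opprD addNKr normrN normrZ gtr0_norm//.
  by rewrite /t divfK ?gt_eqF//; lra.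
rewrite p1_evalD fx add0r dotvZr mulf_neq0 ?gt_eqF//.
rewrite lt_neqAle dotv_ge0 andbT; apply: contra f0 => /eqP/esym ff.
apply/eqP; apply/rowP => j; rewrite mxE.
move/eqP: ff; rewrite psumr_eq0 => [/allP/(_ j (mem_index_enum _))|k _].
  by rewrite mulf_eq0 orbb => /eqP.
by rewrite -expr2 sqr_ge0.
Qed.

(** Finitely many hyperplanes do not fill an open set: after removing one of them, what remains is
    still open and nonempty. *)
Lemma generic_point (fs : seq (p1 R d)) (U : set 'rV[R]_d) :
  (forall f, f \in fs -> f.1 != 0) -> open U -> U !=set0 ->
  exists2 x, U x & forall f, f \in fs -> p1_eval f x != 0.
Proof.
elim: fs U => [|f fs IH] U ffs oU U0.
  by case: U0 => x Ux; exists x.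
have [x Ux fx] := p1_neq0_in_open (ffs f (mem_head _ _)) oU U0.
have oV : open (U `&` [set y | p1_eval f y != 0]).
  apply: openI => //.
  rewrite (_ : [set y | _] = ~` (p1_eval f @^-1` [set 0])); last first.
    by apply/seteqP; split=> y /= /eqP.
  apply/closed_openC; apply: (@closed_comp _ _ (p1_eval f) [set 0]).
    by move=> y _; exact: continuous_p1_eval.
  exact: closed_eq.
have [||y [Uy fy] fsy] := IH _ _ oV; last 1 first.
- exists y => // g; rewrite inE => /orP[/eqP -> //|]; exact: fsy.
- by move=> g gfs; apply: ffs; rewrite inE gfs orbT.
- by exists x.
Qed.

End hyperplanes.

(** * Integrals over row vectors *)

Section tuple_measure.
Context (R : realType) (n : nat).
Notation tupleR := (n.-tuple (measurableTypeR R)).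

(** The topology lives on row vectors and the measure on tuples; [tset] carries sets from the former
    to the latter. *)
Definition tset (A : set 'rV[R]_n) : set tupleR := [set t | A (row_of t)].

Lemma measurable_tset_coord (j : 'I_n) (B : set R) : measurable B ->
  measurable ([set t | B (tnth t j)] : set tupleR).
Proof.
move=> mB; rewrite -[X in measurable X]setTI.
exact: (@measurable_tnth _ (measurableTypeR R) n j measurableT B mB).
Qed.

Lemma measurable_tset_coords (B : 'I_n -> set R) :
  (forall j, measurable (B j)) ->
  measurable ([set t | forall j, B j (tnth t j)] : set tupleR).
Proof.
move=> mB.
rewrite (_ : mkset _ = \bigcap_(j in [set: 'I_n])
    ([set t | B j (tnth t j)] : set tupleR)).
  apply: fin_bigcap_measurable; first exact: finite_finset.
  by move=> j _; exact: measurable_tset_coord.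
by apply/seteqP; split=> t /= Bt j; [move=> _; exact: Bt | exact: Bt].
Qed.

(** The sigma-algebra on tuples comes from the coordinates, so an open set is written as a countable
    union of boxes with rational centres and half-widths [k.+1%:R^-1]. *)
Lemma measurable_tset_open (U : set 'rV[R]_n) : open U -> measurable (tset U).
Proof.
move=> oU.
pose box (i : 'rV[rat]_n * nat) : set tupleR :=
  [set t | forall j, `](ratr (i.1 0 j) - i.2.+1%:R^-1 : R),
                       (ratr (i.1 0 j) + i.2.+1%:R^-1)[%classic (tnth t j)].
pose I := [set i : 'rV[rat]_n * nat | box i `<=` tset U].
have -> : tset U = \bigcup_(i in I) box i.
  apply/seteqP; split=> [t Ut|t [i Ii bt]]; last exact: (Ii t).
  have [r r0 tU] := open_ballP oU Ut.
  (* Two points of a box of half-width [e] differ by less than [2 * e] in each coordinate, hence the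
     bound [r / 2]. *)
  have [k kr] : exists k, (k.+1%:R^-1 : R) < r / 2.
    have [k _ /(_ k (leqnn k))] := near_infty_natSinv_lt (PosNum (divr_gt0 r0 (ltr0n R 2))).
    by exists k.
  set e : R := k.+1%:R^-1 in kr.
  have e0 : 0 < e by rewrite invr_gt0.
  have qP j : exists q : rat, ratr q \in `](tnth t j - e : R), (tnth t j + e)[.
    by apply: rat_in_itvoo; lra.
  have [q qE] := choice qP.
  have boxE s : box (\row_j q j, k) s <->
      forall j, `|ratr (q j) - (tnth s j : R)| < e.
    split=> + j => /(_ j); rewrite /= mxE in_itv/= -/e ltr_norml; lra.
  exists (\row_j q j, k).
    move=> s /boxE qs; apply: tU; apply: norm_lt_coord => // j.
    rewrite !mxE; have := qs j; have := qE j; rewrite in_itv/= !ltr_norml; lra.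
  apply/boxE => j; have := qE j; rewrite in_itv/= ltr_norml; lra.
rewrite bigcup_mkcond; apply: countable_bigcupT_measurable; first exact: countableP.
move=> i; case: ifP => // _.
apply: (@measurable_tset_coords (fun j => `](ratr (i.1 0 j) - i.2.+1%:R^-1 : R),
  (ratr (i.1 0 j) + i.2.+1%:R^-1)[%classic)) => j.
exact: measurable_itv.
Qed.

Lemma measurable_tset_closed (A : set 'rV[R]_n) : closed A -> measurable (tset A).
Proof.
move=> cA; rewrite -[A]setCK; apply: measurableC.
by apply: measurable_tset_open; exact: closed_openC.
Qed.

Lemma measurable_fun_row (f : 'rV[R]_n -> R) : continuous f ->
  measurable_fun setT ((fun t => f (row_of t)) : tupleR -> measurableTypeR R).
Proof.
move=> /continuousP cf; apply: (measurability _ (RGenOpens.measurableE R)).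
move=> _ [_ [a [b ->] <-]]; rewrite setTI.
apply: (@measurable_tset_open (f @^-1` `]a, b[%classic)); apply: cf.
exact: interval_open.
Qed.

End tuple_measure.

Lemma lebesgue_tuple_box (R : realType) (n : nat) (a b : 'I_n -> R) :
  (forall j, a j <= b j) ->
  lebesgue_tuple R n [set t | forall j, `[a j, b j]%classic (tnth t j)] =
  (\prod_j (b j - a j))%:E.
Proof.
elim: n a b => [|n IH] a b ab.
  by rewrite /= diracE big_ord0 mem_set//= => -[].
rewrite /= /cons_measure /pushforward.
set A := (X in _ X = _).
have -> : A = `[a ord0, b ord0]%classic `*`
    [set t | forall j, `[a (lift ord0 j), b (lift ord0 j)]%classic (tnth t j)].
  apply/seteqP; split=> [[x t]|[x t] []] /=.
    move=> H; split; first by have := H ord0; rewrite tnth0.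
    by move=> j; have := H (lift ord0 j); rewrite tnthS.
  move=> xab H j; case: (unliftP ord0 j) => [k|] ->; last by rewrite tnth0.
  by rewrite tnthS; exact: H.
rewrite product_measure1E; last 2 first.
- exact: measurable_itv.
- apply: (@measurable_tset_coords R n
    (fun j => `[a (lift ord0 j), b (lift ord0 j)]%classic)) => j.
  exact: measurable_itv.
rewrite IH// big_ord_recl EFinM; congr (_ * _)%E.
transitivity (lebesgue_measure (`[a ord0, b ord0]%classic : set R)) => //.
rewrite lebesgue_measure_itv/= lte_fin; case: ltgtP (ab ord0) => // ->.
by rewrite subrr.
Qed.

Section tuple_integral.
Context (R : realType) (n : nat).
Notation tupleR := (n.-tuple (measurableTypeR R)).
Implicit Types (A : set 'rV[R]_n) (f : 'rV[R]_n -> R) (a b : 'I_n -> R).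

Definition box a b : set 'rV[R]_n := [set x | forall j, a j <= x 0 j <= b j].

Lemma tset_box a b :
  tset (box a b) = [set t | forall j, `[a j, b j]%classic (tnth t j)].
Proof.
by apply/seteqP; split=> t /= H j; have := H j; rewrite /= ?mxE in_itv.
Qed.

Lemma measurable_box a b : measurable (tset (box a b)).
Proof.
rewrite tset_box.
apply: (@measurable_tset_coords R n (fun j => `[a j, b j]%classic)) => j.
exact: measurable_itv.
Qed.

Lemma lebesgue_box a b : (forall j, a j <= b j) ->
  lebesgue_tuple R n (tset (box a b)) = (\prod_j (b j - a j))%:E.
Proof. by move=> ab; rewrite tset_box lebesgue_tuple_box. Qed.

Lemma lebesgue_sub_box A a b : (forall j, a j <= b j) -> measurable (tset A) ->
  A `<=` box a b ->
  (lebesgue_tuple R n (tset A) <= (\prod_j (b j - a j))%:E)%E.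
Proof.
move=> ab mA Aab; rewrite -lebesgue_box//.
by apply: le_measure; rewrite ?inE//; [exact: measurable_box | move=> t; exact: Aab].
Qed.

Lemma integrable_row A f a b (M : R) : (forall j, a j <= b j) ->
  measurable (tset A) -> A `<=` box a b -> continuous f ->
  (forall x, A x -> `|f x| <= M) ->
  (lebesgue_tuple R n).-integrable (tset A) (EFin \o (fun t => f (row_of t))).
Proof.
move=> ab mA Aab cf fM; apply: measurable_bounded_integrable => //.
- exact: le_lt_trans (lebesgue_sub_box ab mA Aab) (ltry _).
- exact: measurable_funS (measurable_fun_row cf).
- exists M; split; first exact: num_real.
  by move=> y My t At; apply: (le_trans (fM _ At)); exact: ltW.
Qed.

Lemma integral_rV_le A f a b (M : R) : (forall j, a j <= b j) ->
  measurable (tset A) -> A `<=` box a b -> continuous f ->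
  (forall x, A x -> `|f x| <= M) -> 0 <= M ->
  integral_rV A f <= M * \prod_j (b j - a j).
Proof.
move=> ab mA Aab cf fM M0.
have muA := lebesgue_sub_box ab mA Aab.
apply: (@le_trans _ _ (\int[lebesgue_tuple R n]_(t in tset A) M)).
  apply: le_Rintegral => //.
  - exact: integrable_row fM.
  - apply: (@integrable_row A (fun=> M) a b M) => //; first exact: cst_continuous.
    by move=> x _; rewrite ger0_norm.
  - by move=> t /fM; apply: le_trans; exact: ler_norm.
rewrite Rintegral_cst// ler_wpM2l//.
rewrite -[leRHS]/(fine (\prod_j (b j - a j))%:E) fine_le// ge0_fin_numE//.
exact: le_lt_trans muA (ltry _).
Qed.

Lemma integral_rV_ge A f a b a' b' (M c : R) : (forall j, a j <= b j) ->
  measurable (tset A) -> A `<=` box a b -> continuous f ->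
  (forall x, A x -> 0 <= f x <= M) ->
  (forall j, a' j <= b' j) -> box a' b' `<=` A ->
  (forall x, box a' b' x -> c <= f x) ->
  c * \prod_j (b' j - a' j) <= integral_rV A f.
Proof.
move=> ab mA Aab cf fM ab' boxA cf'.
have fM' x : A x -> `|f x| <= M by move=> /fM /andP[f0 fM0]; rewrite ger0_norm.
have iA := integrable_row ab mA Aab cf fM'.
have iB : (lebesgue_tuple R n).-integrable (tset (box a' b'))
    (EFin \o (fun t => f (row_of t))).
  apply: (@integrable_row _ _ a' b' M) => //; first exact: measurable_box.
  by move=> x /boxA/fM'.
apply: (@le_trans _ _ (integral_rV (box a' b') f)).
  rewrite -[\prod_j _]/(fine (\prod_j (b' j - a' j))%:E) -lebesgue_box//.
  rewrite -Rintegral_cst; last exact: measurable_box.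
  apply: le_Rintegral => //; first exact: measurable_box.
    apply: (@integrable_row _ (fun=> c) a' b' `|c|) => //.
      exact: measurable_box.
    exact: cst_continuous.
  by move=> t /cf'.
apply: fine_le.
- by apply: integrable_fin_num iB; exact: measurable_box.
- exact: integrable_fin_num iA.
apply: ge0_subset_integral => //.
- exact: measurable_box.
- apply/measurable_EFinP; exact: measurable_funS (measurable_fun_row cf).
- by move=> t /fM /andP[f0 _]; rewrite lee_fin.
- by move=> t; exact: boxA.
Qed.

Lemma integral_rV_cst A (c : R) : measurable (tset A) ->
  integral_rV A (fun=> c) = c * volume A.
Proof. by move=> mA; rewrite /integral_rV Rintegral_cst. Qed.

End tuple_integral.

(** * Integrals over facets *)

(** An affine function may be small near its zero set, so the box is placed off the centre: each
    coordinate moves from [c] by between [e / 2] and [e] in the direction in which the modulus of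
    [g] grows. If [B] is the sum of the moduli of the slopes, the modulus is at least that of [g c]
    plus [e / 2 * B] there, and at most that of [g c] plus [B] within distance 1 of [c]. *)
Lemma affine_large_on_box (R : realType) (n : nat) (g : p1 R n) (c : 'rV[R]_n)
    (e : R) : 0 < e <= 1 ->
  exists a b : 'I_n -> R,
    [/\ forall j, b j - a j = e / 2,
        forall s : 'rV[R]_n, box a b s -> forall j, `|s 0 j - c 0 j| <= e &
        forall s s' : 'rV[R]_n, box a b s -> (forall j, `|s' 0 j - c 0 j| <= 1) ->
          e / 2 * `|p1_eval g s'| <= `|p1_eval g s|].
Proof.
move=> /andP[e0 e1].
(* Multiplying by the sign of [g c] makes the value at the centre and all the increments
   nonnegative, so that nothing cancels. *)
pose sg : R := if 0 <= p1_eval g c then 1 else -1.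
have sgc : sg * p1_eval g c = `|p1_eval g c|.
  by rewrite /sg; case: ger0P => ?; rewrite ?mul1r ?mulN1r.
have sg1 : `|sg| = 1 by rewrite /sg; case: ifP => _; rewrite ?normrN normr1.
pose pos j := 0 <= sg * g.1 0 j.
pose a j := if pos j then c 0 j + e / 2 else c 0 j - e.
pose b j := if pos j then c 0 j + e else c 0 j - e / 2.
exists a, b; split.
- by move=> j; rewrite /a /b; case: ifP => _; lra.
- move=> s sab j; have := sab j; rewrite /a /b ler_norml.
  by case: ifP => _ /andP[]; lra.
move=> s s' sab s'c.
pose B := \sum_j `|g.1 0 j|.
have B0 : 0 <= B by apply: sumr_ge0.
have evalE x : p1_eval g x = p1_eval g c + dotv g.1 (x - c).
  by rewrite -p1_evalD subrKC.
have H1 : `|p1_eval g s'| <= `|p1_eval g c| + B.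
  rewrite evalE (le_trans (ler_normD _ _))// lerD2l.
  apply: (le_trans (ler_norm_sum _ _ _)); apply: ler_sum => j _.
  by rewrite normrM ler_piMr// !mxE.
have H2 : `|p1_eval g c| + e / 2 * B <= `|p1_eval g s|.
  apply: (@le_trans _ _ (sg * p1_eval g s)); last first.
    by rewrite (le_trans (ler_norm _))// normrM sg1 mul1r.
  rewrite [in leRHS]evalE mulrDr sgc lerD2l /B /dotv !mulr_sumr.
  apply: ler_sum => j _; rewrite !mxE mulrA.
  have -> : `|g.1 0 j| = `|sg * g.1 0 j| by rewrite normrM sg1 mul1r.
  have := sab j; rewrite /a /b; case: (ger0P (sg * g.1 0 j)) => gj.
    rewrite /pos gj => /andP[sj _]; rewrite mulrC ler_wpM2l//; lra.
  have /negPf -> : ~~ pos j by rewrite /pos -ltNge.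
  move=> /andP[_ sj].
  rewrite mulrC -subr_ge0.
  rewrite (_ : _ - _ = - (sg * g.1 0 j) * (c 0 j - s 0 j - e / 2)); last by ring.
  by apply: mulr_ge0; [rewrite oppr_ge0 ltW | lra].
apply: le_trans H2; apply: (@le_trans _ _ (e / 2 * (`|p1_eval g c| + B))).
  by rewrite ler_wpM2l// divr_ge0// ltW.
rewrite mulrDr lerD2r ler_piMl//; lra.
Qed.

Section facets.
Context (R : realType) (n : nat) (m : mesh R n.+1).
Variable S : {set 'I_(nv m)}.
Hypothesis cardS : #|S| = n.+1.

Definition vertex_index (k : 'I_n.+1) : 'I_(nv m) :=
  enum_val (cast_ord (esym cardS) k).
Local Notation q := vertex_index.

Lemma vertex_index_in k : q k \in S.
Proof. exact: enum_valP. Qed.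

Lemma vertex_index_inj : injective q.
Proof. by move=> i j /enum_val_inj /cast_ord_inj. Qed.

Lemma vertexE (k : 'I_n.+1) : vertex S k = node (q k).
Proof.
rewrite /vertex (nth_map (q k)); last by rewrite -cardE cardS.
have E x0 : q k = nth x0 (enum S) k by rewrite /vertex_index (enum_val_nth x0).
by rewrite -E.
Qed.

Lemma sum_facet (V : nmodType) (F : 'I_(nv m) -> V) :
  (forall j, j \notin S -> F j = 0) -> \sum_j F j = \sum_k F (q k).
Proof.
move=> F0; rewrite (bigID (mem S))/= [X in _ + X]big1 ?addr0; last first.
  by move=> j jS; rewrite F0.
rewrite big_enum_val (reindex (cast_ord (esym cardS)))//.
by exists (cast_ord cardS) => i _; [rewrite cast_ordKV | rewrite cast_ordK].
Qed.

Lemma face_paramE (s : 'rV[R]_n) : face_param S s =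
  node (q ord0) + \sum_k s 0 k *: (node (q (lift ord0 k)) - node (q ord0)).
Proof.
rewrite /face_param (vertexE ord0) mulmx_sum_row; congr (_ + _).
apply: eq_bigr => k _; congr (_ *: _); apply/rowP => j.
by rewrite !mxE -(vertexE (lift ord0 k)) -(vertexE ord0).
Qed.

Lemma face_paramB (s s' : 'rV[R]_n) :
  face_param S s - face_param S s' = (s - s') *m edges S.
Proof. by rewrite /face_param mulmxBl opprD addrACA subrr add0r. Qed.

(** Barycentric coordinates of [face_param S s]: vertex 0 takes what the parameters leave. *)
Definition facet_weights (s : 'rV[R]_n) (k : 'I_n.+1) : R :=
  if unlift ord0 k is Some i then s 0 i else 1 - \sum_i s 0 i.

Lemma sum_facet_weights s : \sum_k facet_weights s k = 1.
Proof.
rewrite big_ord_recl /facet_weights unlift_none.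
by under [X in _ + X]eq_bigr do rewrite liftK; rewrite subrK.
Qed.

Lemma face_param_comb s :
  face_param S s = \sum_k facet_weights s k *: node (q k).
Proof.
rewrite face_paramE big_ord_recl /facet_weights unlift_none.
under [X in _ = _ + X]eq_bigr do rewrite liftK.
rewrite scalerBl scale1r -addrA; congr (_ + _).
rewrite scaler_suml -sumrN -big_split; apply: eq_bigr => k _ /=.
by rewrite scalerBr addrC.
Qed.

Lemma facet_weights_ge0 (s : 'rV[R]_n) : (forall k, 0 <= s 0 k) -> \sum_k s 0 k <= 1 ->
  forall k, 0 <= facet_weights s k.
Proof.
by move=> s0 s1 k; rewrite /facet_weights; case: unlift => //; rewrite subr_ge0.
Qed.

Lemma face_param_region (s : 'rV[R]_n) : (forall k, 0 <= s 0 k) -> \sum_k s 0 k <= 1 ->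
  region S (face_param S s).
Proof.
move=> s0 s1.
exists (fun j => \sum_k (q k == j)%:R * facet_weights s k); split.
- by move=> j; apply: sumr_ge0 => k _; rewrite mulr_ge0// facet_weights_ge0.
- move=> j jS; apply: big1 => k _; case: eqP => [kj|]; last by rewrite mul0r.
  by move: jS; rewrite -kj vertex_index_in.
- rewrite exchange_big/= -[RHS](sum_facet_weights s); apply: eq_bigr => k _.
  rewrite -mulr_suml (bigD1 (q k))//= eqxx big1 ?addr0 ?mul1r// => j.
  by rewrite eq_sym => /negPf ->.
- rewrite face_param_comb; under [RHS]eq_bigr do rewrite scaler_suml.
  rewrite exchange_big/=; apply: eq_bigr => k _.
  rewrite (bigD1 (q k))//= eqxx mul1r big1 ?addr0// => j.
  by rewrite eq_sym => /negPf ->; rewrite mul0r scale0r.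
Qed.

Lemma region_face_param x : region S x -> exists s : 'rV[R]_n,
  [/\ forall k, 0 <= s 0 k, \sum_k s 0 k <= 1 & x = face_param S s].
Proof.
move=> [l [l0 lS l1 ->]]; exists (\row_k l (q (lift ord0 k))).
have sE : \sum_k (\row_k l (q (lift ord0 k)) : 'rV[R]_n) 0 k = 1 - l (q ord0).
  apply/eqP; rewrite eq_sym subr_eq -l1 (sum_facet lS) big_ord_recl addrC.
  apply/eqP; congr (_ + _).
  by apply: eq_bigr => k _; rewrite mxE.
split.
- by move=> k; rewrite mxE.
- by rewrite sE gerBl.
rewrite sum_facet; last by move=> j jS; rewrite lS// scale0r.
rewrite face_param_comb; apply: eq_bigr => k _; congr (_ *: _).
rewrite /facet_weights; case: unliftP => [i|] ->; first by rewrite mxE.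
by rewrite sE subKr.
Qed.

Section simplex.
Variables (T : {set 'I_(nv m)}) (c : 'rV[R]_n.+1) (r : R).
Hypotheses (ST : S \subset T) (aT : affine_indep (@node _ _ m) T).
Hypotheses (r0 : 0 < r) (cT : forall y, `|c - y| < r -> region T y).

(** A combination of edges is a combination of vertices of [T] whose coefficients sum to 0, so
    [bary_coef_le] applies. The facet thus inherits its nondegeneracy from the ball inscribed in the
    cell. *)
Lemma edges_lower_bound (a : 'rV[R]_n) : `|a| * r <= 2 * `|a *m edges S|.
Proof.
pose b j : R := \sum_k a 0 k * ((q (lift ord0 k) == j)%:R - (q ord0 == j)%:R).
have delta_sum (i : 'I_(nv m)) : \sum_j ((i == j)%:R : R) = 1.
  by rewrite (bigD1 i)//= eqxx big1 ?addr0// => j; rewrite eq_sym => /negPf ->.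
have delta_comb (i : 'I_(nv m)) :
    \sum_j ((i == j)%:R : R) *: node j = node i :> 'rV[R]_n.+1.
  rewrite (bigD1 i)//= eqxx scale1r big1 ?addr0// => j.
  by rewrite eq_sym => /negPf ->; rewrite scale0r.
have inT k : q k \in T by apply: (fintype.subsetP ST); exact: vertex_index_in.
have bT j : j \notin T -> b j = 0.
  move=> jT; apply: big1 => k _.
  have /negPf -> : q (lift ord0 k) != j by apply: contraNneq jT => <-.
  have /negPf -> : q ord0 != j by apply: contraNneq jT => <-.
  by rewrite subrr mulr0.
have b0 : \sum_j b j = 0.
  rewrite exchange_big/=; apply: big1 => k _.
  by rewrite -mulr_sumr sumrB !delta_sum subrr mulr0.
have bE : \sum_j b j *: node j = a *m edges S.
  rewrite mulmx_sum_row; under eq_bigr do rewrite scaler_suml.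
  rewrite exchange_big/=; apply: eq_bigr => k _.
  under eq_bigr do rewrite -scalerA scalerBl.
  rewrite -scaler_sumr sumrB !delta_comb; congr (_ *: _); apply/rowP => j.
  by rewrite !mxE (vertexE (lift ord0 k)) (vertexE ord0).
have bq k : b (q (lift ord0 k)) = a 0 k.
  rewrite /b (bigD1 k)//= eqxx (inj_eq vertex_index_inj) eq_liftF subr0 mulr1.
  rewrite big1 ?addr0// => i ik.
  rewrite (inj_eq vertex_index_inj) (inj_eq (@lift_inj _ _)).
  by rewrite (negPf ik) subrr mulr0.
rewrite -ler_pdivlMr//; apply: norm_le_coord => [|k].
  by rewrite divr_ge0// ?mulr_ge0// ltW.
rewrite ler_pdivlMr// -bE -bq.
exact: (bary_coef_le aT r0 cT bT b0).
Qed.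

Lemma face_param_in_region s : region S (face_param S s) ->
  (forall k, 0 <= s 0 k) /\ \sum_k s 0 k <= 1.
Proof.
move=> /region_face_param[s' [s0 s1 /eqP]].
rewrite -subr_eq0 face_paramB => /eqP E.
suff -> : s = s' by [].
apply/eqP; rewrite -subr_eq0 -normr_eq0 eq_le normr_ge0 andbT.
rewrite -(pmulr_lle0 _ r0).
by apply: (le_trans (edges_lower_bound _)); rewrite E normr0 mulr0.
Qed.

End simplex.
End facets.

(** * Gram determinant of one or two edge vectors *)

Section gram.
Context (R : realType).

Definition gram (n d : nat) (E : 'M[R]_(n, d)) : 'M[R]_n := E *m E^T.

Lemma gramE n d (E : 'M[R]_(n, d)) i j :
  gram E i j = dotv (row i E) (row j E).
Proof. by rewrite mxE; apply: eq_bigr => k _; rewrite !mxE. Qed.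

Lemma det_mx22 (A : 'M[R]_2) : \det A = A 0 0 * A 1 1 - A 0 1 * A 1 0.
Proof.
rewrite (expand_det_row _ ord0) !big_ord_recl big_ord0 addr0.
rewrite /cofactor !det_mx11 !mxE /= expr0 mul1r expr1 mulN1r mulrN.
by congr (_ * A _ _ - A _ _ * A _ _); apply: val_inj.
Qed.

Lemma dotv_ge_normr (d : nat) (x : 'rV[R]_d) : `|x| ^+ 2 <= dotv x x.
Proof.
rewrite -[leRHS]sqr_sqrtr ?dotv_ge0// ler_sqr ?nnegrE ?sqrtr_ge0//.
exact: norm_le_enorm.
Qed.

Lemma sqrt_gram_bounds (n : nat) (E : 'M[R]_(n, n.+1)) (r h : R) :
  n = 1%N \/ n = 2%N -> 0 <= r -> 0 <= h ->
  (forall k, `|row k E| <= h) -> (forall a : 'rV_n, `|a| * r <= `|a *m E|) ->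
  r ^+ n <= Num.sqrt (\det (gram E)) <= (n.+1%:R * h) ^+ n.
Proof.
move=> n12 r0 h0 Eh Er.
have nh0 : 0 <= n.+1%:R * h by rewrite mulr_ge0.
have entry i j : `|gram E i j| <= n.+1%:R * h ^+ 2.
  rewrite gramE (le_trans (normr_dotv_le _ _))// -mulrA ler_wpM2l// expr2.
  by rewrite ler_pM.
have form (a : 'rV[R]_n) : (`|a| * r) ^+ 2 <= dotv (a *m E) (a *m E).
  apply: le_trans (dotv_ge_normr _); rewrite ler_sqr ?nnegrE ?mulr_ge0//.
suff : (r ^+ n) ^+ 2 <= \det (gram E) <= ((n.+1%:R * h) ^+ n) ^+ 2.
  move=> /andP[d1 d2]; apply/andP; split.
    by rewrite -[leLHS]ger0_norm ?exprn_ge0// -sqrtr_sqr ler_wsqrtr.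
  by rewrite -[leRHS]ger0_norm ?exprn_ge0// -sqrtr_sqr ler_wsqrtr.
case: n12 => nE; subst n.
  rewrite det_mx11 !expr1 exprMn; apply/andP; split.
    have := form (const_mx 1); rewrite gramE.
    have -> : `|const_mx 1 : 'rV[R]_1| = 1.
      by apply/eqP; rewrite eq_le norm_le_coord//= => [|j];
        [have := coord_le_norm (const_mx 1 : 'rV[R]_1) 0; rewrite mxE normr1
        | rewrite mxE normr1].
    rewrite mul1r; suff -> : const_mx 1 *m E = row 0 E by [].
    by apply/rowP => j; rewrite !mxE big_ord1 !mxE mul1r.
  apply: (le_trans (ler_norm _)); apply: (le_trans (entry 0 0)).
  rewrite ler_wpM2r ?sqr_ge0//; lra.
rewrite det_mx22; set p := gram E 0 0; set q := gram E 0 1; set s := gram E 1 1.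
have -> : gram E 1 0 = q by rewrite /q !gramE; apply: eq_bigr => k _; rewrite mulrC.
have formE (x y : R) : Num.max `|x| `|y| ^+ 2 * r ^+ 2 <=
    x ^+ 2 * p + 2 * x * y * q + y ^+ 2 * s.
  pose a : 'rV[R]_2 := \row_i (if i == 0 then x else y).
  have aE : a *m E = x *: row 0 E + y *: row 1 E.
    apply/rowP => j; rewrite !mxE !big_ord_recl big_ord0 addr0 !mxE/=.
    by congr (_ * E _ _ + _ * E _ _); apply: val_inj.
  have -> : x ^+ 2 * p + 2 * x * y * q + y ^+ 2 * s = dotv (a *m E) (a *m E).
    rewrite aE /p /q /s !gramE /dotv !mulr_sumr -!big_split/=.
    by apply: eq_bigr => j _; rewrite !mxE; ring.
  apply: le_trans (form a); rewrite exprMn ler_wpM2r ?sqr_ge0//.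
  rewrite ler_sqr ?nnegrE ?le_max ?normr_ge0// ge_max.
  by have := coord_le_norm a 0; have := coord_le_norm a 1; rewrite !mxE/= => -> ->.
have p_ge : r ^+ 2 <= p.
  have := formE 1 0; rewrite normr1 normr0 maxC.
  by rewrite (_ : Num.max 0 1 = 1) ?expr1n ?mul1r; [nra | apply/max_idPr].
have p0 : 0 <= p by rewrite (le_trans _ p_ge)// sqr_ge0.
apply/andP; split.
  (* At the vector [(- q, p)] the quadratic form equals [p] times the determinant, and the sup norm
     of this vector is at least [p]. *)
  have H : p ^+ 2 * r ^+ 2 <= p * (p * s - q * q).
    have := formE (- q) p; rewrite (_ : _ + _ + _ = p * (p * s - q * q)); last by ring.
    apply: le_trans; rewrite ler_wpM2r ?sqr_ge0//.
    by rewrite ler_sqr ?nnegrE ?le_max ?normr_ge0// (ger0_norm p0) lexx orbT.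
  have [p00|p_gt0] : p = 0 \/ 0 < p.
  - by move: p0; rewrite le_eqVlt => /predU1P[<-|]; [left|right].
  - have r00 : r ^+ 2 = 0 by apply/eqP; rewrite eq_le sqr_ge0 andbT -p00.
    move: (formE 0 1) (formE 1 0) => _ _.
    have q0 : q = 0.
      have := entry 0 1; have rowE : dotv (row 0 E) (row 0 E) = 0 by rewrite -gramE.
      have x0 : row 0 E = 0.
        apply/eqP; rewrite -normr_eq0 -sqrf_eq0 eq_le sqr_ge0 andbT -rowE.
        exact: dotv_ge_normr.
      by rewrite /q gramE x0 /dotv big1// => k _; rewrite mxE mul0r.
    by rewrite r00 expr0n/= p00 q0 !mul0r subrr.
  - have : p * r ^+ 2 <= p * s - q * q.
      rewrite -(ler_pM2l p_gt0); apply: le_trans H.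
      by rewrite le_eqVlt; apply/orP; left; apply/eqP; ring.
    apply: le_trans; rewrite [leLHS]expr2 ler_wpM2r ?sqr_ge0//.
have s0 : 0 <= s by rewrite /s gramE dotv_ge0.
have pb : p <= 3 * h ^+ 2 by apply: le_trans (entry 0 0); exact: ler_norm.
have sb : s <= 3 * h ^+ 2 by apply: le_trans (entry 1 1); exact: ler_norm.
apply: (@le_trans _ _ (p * s)); first by rewrite gerBl -expr2 sqr_ge0.
apply: (@le_trans _ _ ((3 * h ^+ 2) * (3 * h ^+ 2))); first by rewrite ler_pM.
have := exprn_ge0 4 h0; nra.
Qed.

End gram.

(** * Squares of affine functions integrated over cut facets *)

Section facet_integrals.
Context (R : realType) (n : nat) (m : mesh R n.+1).
Variables (S T : {set 'I_(nv m)}) (c : 'rV[R]_n.+1) (r h : R).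
Hypotheses (n12 : n = 1%N \/ n = 2%N) (cardS : #|S| = n.+1).
Hypotheses (ST : S \subset T) (aT : affine_indep (@node _ _ m) T).
Hypotheses (r0 : 0 < r) (cT : forall y, `|c - y| < r -> region T y).
Hypothesis Sh : forall x y, region S x -> region S y -> `|x - y| <= h.
Variable B : set 'rV[R]_n.+1.
Hypothesis oB : open B.

Let q := vertex_index cardS.
Let A : set 'rV[R]_n := [set s | (region S `&` B) (face_param S s)].

Lemma facet_size_ge0 : 0 <= h.
Proof.
by apply: le_trans (Sh (hull_vertex _ (vertex_index_in cardS ord0))
  (hull_vertex _ (vertex_index_in cardS ord0))).
Qed.

Lemma facet_jacobian_bounds :
  (r / 2) ^+ n <= Num.sqrt (\det (edges S *m (edges S)^T)) <=
  (n.+1%:R * h) ^+ n.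
Proof.
apply: sqrt_gram_bounds => //.
- by rewrite divr_ge0// ltW.
- exact: facet_size_ge0.
- move=> k; rewrite (_ : row k (edges S) = node (q (lift ord0 k)) - node (q ord0)).
    by apply: Sh; apply: hull_vertex; exact: vertex_index_in.
  by apply/rowP => j; rewrite !mxE -(vertexE cardS (lift ord0 k)) -(vertexE cardS ord0).
- move=> a; have := edges_lower_bound cardS ST aT r0 cT a.
  by rewrite mulrA ler_pdivrMr// [_ * 2]mulrC.
Qed.

Lemma continuous_face_param : continuous (@face_param R n.+1 m S).
Proof.
have csum : continuous (fun s : 'rV[R]_n => \sum_k s 0 k *: row k (edges S)).
  apply: continuous_sum => k t; rewrite /continuous_at.
  by apply: cvgZr_tmp (@continuous_coord R n k t).
rewrite (_ : @face_param _ _ _ S = fun s => vertex S 0 +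
    \sum_k s 0 k *: row k (edges S)); last first.
  by apply/funext => s; rewrite /face_param mulmx_sum_row.
by move=> s; exact: (cvgD (cvg_cst _) (csum s)).
Qed.

Lemma measurable_face : measurable (tset A).
Proof.
rewrite (_ : tset A = tset (face_param S @^-1` region S) `&`
    tset (face_param S @^-1` B)) //.
apply: measurableI.
  apply: measurable_tset_closed; apply: closed_comp; last exact: closed_hull.
  by move=> s _; exact: continuous_face_param.
apply: measurable_tset_open; apply: open_comp; last exact: oB.
by move=> s _; exact: continuous_face_param.
Qed.

Lemma face_sub_unit_box : A `<=` box (fun=> 0) (fun=> 1).
Proof.
move=> s [Ss _] k; have [s0 s1] := face_param_in_region cardS ST aT r0 cT Ss.
rewrite s0/=; apply: le_trans s1.
by rewrite (bigD1 k)//= lerDl; apply: sumr_ge0.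
Qed.

Lemma prod_unit_box : \prod_(j < n) (1 - 0 : R) = 1.
Proof. by rewrite big1// => j _; rewrite subr0. Qed.

Definition pull_p1 (f : p1 R n.+1) : p1 R n :=
  (\row_k dotv f.1 (row k (edges S)), p1_eval f (vertex S 0)).

Lemma pull_p1E f s : p1_eval (pull_p1 f) s = p1_eval f (face_param S s).
Proof.
rewrite /face_param p1_evalD mulmx_sum_row dotv_sumr /p1_eval /= addrC.
congr (_ + _); apply: eq_bigr => k _.
by rewrite dotvZr mxE mulrC.
Qed.

Lemma continuous_sqr_pull f : continuous (fun s => p1_eval f (face_param S s) ^+ 2).
Proof.
have C := @continuous_p1_eval _ _ (pull_p1 f).
rewrite (_ : (fun s => _) =
    (fun s => p1_eval (pull_p1 f) s * p1_eval (pull_p1 f) s)); last first.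
  by apply/funext => s; rewrite pull_p1E expr2.
by move=> s; exact: (cvgM (C s) (C s)).
Qed.

Lemma face_integral_le (f : p1 R n.+1) (b : R) :
  (forall x, region S x -> `|p1_eval f x| <= b) ->
  face_integral S B (fun x => p1_eval f x ^+ 2) <= (n.+1%:R * h) ^+ n * b ^+ 2.
Proof.
move=> fb; have /andP[_ Jh] := facet_jacobian_bounds.
rewrite /face_integral; apply: ler_pM => //.
  by apply: Rintegral_ge0 => t _; exact: sqr_ge0.
rewrite -[leRHS]mulr1 -prod_unit_box.
apply: (integral_rV_le _ measurable_face face_sub_unit_box).
- by move=> _; exact: ler01.
- exact: continuous_sqr_pull.
- move=> s [Ss _]; rewrite ger0_norm ?sqr_ge0// -[leLHS]real_normK ?num_real//.
  by rewrite ler_sqr ?nnegrE ?fb// (le_trans _ (fb _ Ss)).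
- exact: sqr_ge0.
Qed.

(** In parameter space the homothetic copy of the facet contains a cube around [c0], and
    [affine_large_on_box] selects in it a box on which the modulus of [f] is at least a fixed
    fraction of its value at any point of the facet. Of the exponent [n.+2], [n] comes from the
    volume of that box and 2 from the square. *)
Lemma face_integral_ge (f : p1 R n.+1) (y : 'rV[R]_n.+1) (th : R) :
  0 < th <= 1 -> region S y ->
  (forall z, region S z -> B (y + th *: (z - y))) ->
  forall x, region S x ->
    (r / 2) ^+ n * (th / (4 * n.+1%:R)) ^+ n.+2 * p1_eval f x ^+ 2 <=
    face_integral S B (fun x => p1_eval f x ^+ 2).
Proof.
move=> /andP[th0 th1] Sy yB x Sx; have /andP[Jr _] := facet_jacobian_bounds.
have nn0 : 0 < n.+1%:R :> R by rewrite ltr0n.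
have [u [u0 u1 yE]] := region_face_param cardS Sy.
have [w [w0 w1 xE]] := region_face_param cardS Sx.
(* Undoing the homothety turns a width [2 * e] into [n.+1%:R^-1], so [n] parameters of that size
   still sum to at most 1. *)
pose e : R := th / (2 * n.+1%:R).
have e0 : 0 < e by rewrite divr_gt0// mulr_gt0.
have e1 : e <= 1.
  rewrite ler_pdivrMr ?mulr_gt0// mul1r (le_trans th1)//.
  by rewrite -natrM ler1n muln_gt0.
have eE : e / 2 = th / (4 * n.+1%:R).
  by rewrite /e; field; rewrite addrC natr1 pnatr_eq0.
(* Image under the homothety of the point all of whose parameters are [e / th]. *)
pose c0 : 'rV[R]_n := \row_k ((1 - th) * u 0 k + e).
have e01 : 0 < e <= 1 by rewrite e0.
have [a' [b' [ab' boxe boxg]]] := affine_large_on_box (pull_p1 f) c0 e01.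
have u01 k : 0 <= u 0 k <= 1.
  by rewrite u0/= (le_trans _ u1)// (bigD1 k)//= lerDl sumr_ge0.
have w01 k : 0 <= w 0 k <= 1.
  by rewrite w0/= (le_trans _ w1)// (bigD1 k)//= lerDl sumr_ge0.
have the : 2 * e <= th.
  rewrite /e (_ : 2 * _ = th / n.+1%:R); last first.
    by field; rewrite addrC natr1 pnatr_eq0.
  by rewrite ler_pdivrMr// ler_peMr ?ler1n// ltW.
have boxA : box a' b' `<=` A.
  move=> s /boxe sc0.
  pose z : 'rV[R]_n := \row_k (th^-1 * (s 0 k - (1 - th) * u 0 k)).
  have zb k : 0 <= z 0 k <= n.+1%:R^-1.
    have := sc0 k; rewrite !mxE ler_norml => /andP[H1 H2].
    apply/andP; split; first by apply: mulr_ge0; [rewrite invr_ge0 ltW | lra].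
    rewrite ler_pdivrMl// (_ : th * _ = 2 * e); last first.
      by rewrite /e; field; rewrite addrC natr1 pnatr_eq0.
    lra.
  have Sz : region S (face_param S z).
    apply: face_param_region => // [k|]; first by case/andP: (zb k).
    apply: (@le_trans _ _ (\sum_(k < n) n.+1%:R^-1)).
      by apply: ler_sum => k _; case/andP: (zb k).
    rewrite sumr_const card_ord -[X in X <= _]mulr_natl ler_pdivrMr// mul1r ler_nat.
    exact: leqnSn.
  have E : face_param S s = y + th *: (face_param S z - y).
    rewrite yE face_paramB scalemxAl /face_param -addrA -mulmxDl.
    congr (_ + _ *m _); apply/rowP => k; rewrite !mxE.
    by field; rewrite gt_eqF.
  rewrite /A/= E; split; last exact: yB.
  by apply: convex_hull => //; rewrite ltW.
have ab'' j : a' j <= b' j by have := ab' j; lra.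
have glow s : box a' b' s -> (e / 2 * `|p1_eval f x|) ^+ 2 <=
    p1_eval f (face_param S s) ^+ 2.
  move=> sab; rewrite -[leRHS]real_normK ?num_real//.
  have e20 : 0 <= e / 2 by lra.
  rewrite ler_sqr; [|by rewrite nnegrE mulr_ge0|by rewrite nnegrE].
  rewrite -pull_p1E xE -pull_p1E; apply: boxg => // k.
  have := u01 k; have := w01 k; rewrite mxE ler_norml.
  have : 0 <= th * u 0 k by rewrite mulr_ge0 ?u0// ltW.
  have : 0 <= (1 - th) * u 0 k by rewrite mulr_ge0 ?u0// subr_ge0.
  have : (1 - th) * u 0 k <= (1 - th) by rewrite ler_piMr ?subr_ge0//; case/andP: (u01 k).
  lra.
(* A crude upper bound, which supplies integrability. *)
pose M : R := (\sum_k `|(pull_p1 f).1 0 k| + `|(pull_p1 f).2|) ^+ 2.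
have fM s : A s -> 0 <= p1_eval f (face_param S s) ^+ 2 <= M.
  move=> /face_sub_unit_box s01; rewrite sqr_ge0/= -pull_p1E.
  rewrite -[leLHS]real_normK ?num_real// ler_sqr ?nnegrE ?addr_ge0 ?sumr_ge0//.
  apply: (le_trans (ler_normD _ _)); rewrite lerD2r.
  apply: (le_trans (ler_norm_sum _ _ _)); apply: ler_sum => k _.
  by rewrite normrM ler_piMr// ger0_norm; case/andP: (s01 k).
have := integral_rV_ge (fun=> ler01) measurable_face face_sub_unit_box
  (@continuous_sqr_pull f) fM ab'' boxA glow.
under eq_bigr do rewrite ab'; rewrite prodr_const card_ord eE => H.
rewrite /face_integral; apply: le_trans (ler_pM _ _ Jr H).
- rewrite -mulrA; apply: ler_wpM2l; first by rewrite exprn_ge0// divr_ge0// ltW.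
  move: (th / _) => t.
  by rewrite (exprMn 2 t) real_normK ?num_real// -addn2 exprD; lra.
- by rewrite exprn_ge0// divr_ge0// ltW.
- by rewrite mulr_ge0 ?sqr_ge0// exprn_ge0// divr_ge0 ?mulr_ge0// ltW.
Qed.

End facet_integrals.

(** * Points deep inside a Lipschitz domain *)

Section strips.
Context (R : realType).

Lemma coordB (d : nat) (x y : 'rV[R]_d) i : (x - y) 0 i = x 0 i - y 0 i.
Proof. by rewrite !mxE. Qed.

Lemma lebesgue_tuple_sub_sum (n : nat) (I : Type) (r : seq I)
    (B : I -> set (n.-tuple (measurableTypeR R)))
    (A : set (n.-tuple (measurableTypeR R))) :
  measurable A -> (forall i, measurable (B i)) ->
  A `<=` \big[setU/set0]_(i <- r) B i ->
  (lebesgue_tuple R n A <= \sum_(i <- r) lebesgue_tuple R n (B i))%E.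
Proof.
move=> mA mB AB.
apply: (@le_trans _ _ (lebesgue_tuple R n (\big[setU/set0]_(i <- r) B i))).
  apply: le_measure; rewrite ?inE//.
  by apply: bigsetU_measurable => i _; exact: mB.
elim: r {AB} => [|i r IH]; first by rewrite !big_nil measure0.
rewrite !big_cons; apply: le_trans (leeD2l _ IH).
apply: measureU2; first exact: mB.
by apply: bigsetU_measurable => k _; exact: mB.
Qed.

(* [A] is covered by [K ^ n] boxes of width [2 h / K], whose extent in the
   direction [j] is bounded by the oscillation of [A]. *)
Lemma strip_volume_le (n K : nat) (A : set 'rV[R]_n.+1) (o : 'rV[R]_n.+1)
    (j : 'I_n.+1) (h H L : R) : (0 < K)%N -> 0 <= h -> 0 <= H -> 0 <= L ->
  measurable (tset A) -> (forall x, A x -> `|x - o| <= h) ->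
  (forall x y (M : R), A x -> A y -> (forall k, `|(x - y) 0 (lift j k)| <= M) ->
    `|(x - y) 0 j| <= H + L * M) ->
  volume A <= (2 * h) ^+ n * (2 * (H + L * (2 * h / K%:R))).
Proof.
move=> K0 h0 H0 L0 mA Ao strip.
have KR : 0 < K%:R :> R by rewrite ltr0n.
pose w : R := 2 * h / K%:R.
have w0 : 0 <= w by rewrite divr_ge0 ?mulr_ge0// ltW.
have E0 : 0 <= H + L * w by rewrite addr_ge0// mulr_ge0.
pose lo (c : {ffun 'I_n -> 'I_K}) k : R := o 0 (lift j k) - h + (c k)%:R * w.
pose col c : set 'rV[R]_n.+1 :=
  [set x | A x /\ forall k, lo c k <= x 0 (lift j k) <= lo c k + w].
(* A reference point of the column. For an empty column it is a default value, harmless because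
   [colbox] then holds vacuously. *)
pose p c : 'rV[R]_n.+1 := get (col c).
pose a c (i : 'I_n.+1) : R :=
  if unlift j i is Some k then lo c k else p c 0 j - (H + L * w).
pose b c (i : 'I_n.+1) : R :=
  if unlift j i is Some k then lo c k + w else p c 0 j + (H + L * w).
have ab c i : a c i <= b c i.
  by rewrite /a /b; case: unlift => [k|]; [rewrite lerDl|lra].
have colbox c : col c `<=` box (a c) (b c).
  move=> x cx i; rewrite /a /b; case: unliftP => [k|] ->; first by case: cx.
  have [Ap pc] : col c (p c) by apply: getPex; exists x.
  have [Ax xc] := cx.
  have : `|(x - p c) 0 j| <= H + L * w.
    apply: strip => // k; have := xc k; have := pc k.
    by rewrite !mxE ler_norml; lra.
  by rewrite !mxE ler_norml; lra.
have cover : tset A `<=` \big[setU/set0]_c tset (box (a c) (b c)).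
  move=> t At; set x := row_of t in At.
  have cP k : exists i : 'I_K, o 0 (lift j k) - h + i%:R * w <= x 0 (lift j k)
      <= o 0 (lift j k) - h + i%:R * w + w.
    have := Ao _ At => /(le_trans (coord_le_norm _ (lift j k))).
    rewrite coordB ler_norml -/x; set z := x 0 _; set oz := o 0 _ => oh.
    (* For [h = 0] the width [w] is 0 and cannot be divided by. *)
    have [h00|hneq] := eqVneq h 0.
      by exists (Ordinal K0); rewrite /w h00; move: oh; rewrite h00 => ?;
         rewrite mulr0 mul0r mulr0; lra.
    have hgt : 0 < h by rewrite lt0r hneq.
    have wgt : 0 < w by rewrite divr_gt0 ?mulr_gt0.
    pose q := (z - oz + h) / w.
    have q0 : 0 <= q by rewrite divr_ge0//; lra.
    have qK : q <= K%:R.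
      by rewrite ler_pdivrMr// /w mulrCA divff ?gt_eqF// mulr1; lra.
    have qE : z = oz - h + q * w by rewrite /q divfK ?gt_eqF//; lra.
    have /andP[t1 t2] := truncn_itv q0.
    have [tK|tK] := ltnP (Num.truncn q) K.
      exists (Ordinal tK) => /=; rewrite qE; apply/andP; split.
        by rewrite lerD2l ler_wpM2r.
      by have := ler_wpM2r w0 (ltW t2); rewrite -natr1 mulrDl mul1r; lra.
    (* The right endpoint [q = K%:R] is put into the last interval. *)
    have K1 : (K.-1 < K)%N by rewrite prednK.
    have qK' : q = K%:R.
      by apply/eqP; rewrite eq_le qK (le_trans _ t1)// ler_nat.
    exists (Ordinal K1) => /=; rewrite qE qK'.
    have -> : (K%:R : R) = K.-1%:R + 1 by rewrite natr1 prednK.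
    by rewrite mulrDl mul1r !addrA lexx andbT lerDl.
  have [c0 c0P] := choice cP.
  pose c : {ffun 'I_n -> 'I_K} := [ffun k => c0 k].
  rewrite (bigD1 c)//=; left; apply: colbox; split => // k.
  by rewrite /lo ffunE; exact: c0P.
have vol c : lebesgue_tuple R n.+1 (tset (box (a c) (b c))) =
    (w ^+ n * (2 * (H + L * w)))%:E.
  rewrite lebesgue_box//; congr (_%:E).
  rewrite (bigD1_ord j)//= mulrC; congr (_ * _); last first.
    by rewrite /a /b unlift_none; ring.
  rewrite -[n in RHS]card_ord -prodr_const; apply: eq_bigr => k _.
  by rewrite /a /b liftK addrAC subrr add0r.
have := lebesgue_tuple_sub_sum mA (fun c => measurable_box (a c) (b c)) cover.
under eq_bigr do rewrite vol.
rewrite sumEFin sumr_const card_ffun !card_ord => le1.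
rewrite /volume -lee_fin fineK; last first.
  by rewrite ge0_fin_numE//; apply: le_lt_trans le1 (ltry _).
apply: (le_trans le1); rewrite lee_fin le_eqVlt; apply/orP; left; apply/eqP.
have -> : 2 * h = K%:R * w by rewrite /w [K%:R * _]mulrC divfK ?gt_eqF.
by rewrite (exprMn n K%:R w) -natrX [K%:R * w]mulrC mulfK ?gt_eqF// -mulrA
  [RHS]mulr_natl.
Qed.

End strips.

(** * Cones, and points with a ball of radius proportional to the mesh size *)

Section cones.
Context (R : realType) (n : nat).
Implicit Types (x y w : 'rV[R]_n.+1) (D A : set 'rV[R]_n.+1).

(** Axis in direction [j], oriented by the sign [s]; increasing [L] narrows the cone. *)
Definition cone (j : 'I_n.+1) (s L : R) : set 'rV[R]_n.+1 :=
  [set w | 0 <= s * w 0 j /\ forall k, L * `|w 0 (lift j k)| <= s * w 0 j].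

Lemma convex_cone j s L : 0 <= L -> convex (cone j s L).
Proof.
move=> L0 x y [x0 xL] [y0 yL] t /andP[t0 t1].
have E i : (x + t *: (y - x)) 0 i = (1 - t) * x 0 i + t * y 0 i.
  by rewrite !mxE; ring.
have t1' : 0 <= 1 - t by rewrite subr_ge0.
split; first by rewrite E mulrDr !(mulrCA s) addr_ge0// mulr_ge0.
move=> k; rewrite !E mulrDr !(mulrCA s).
apply: (@le_trans _ _ (L * ((1 - t) * `|x 0 (lift j k)| + t * `|y 0 (lift j k)|))).
  rewrite ler_wpM2l// (le_trans (ler_normD _ _))// !normrM.
  by rewrite (ger0_norm t0) (ger0_norm t1').
rewrite mulrDr !(mulrCA L); apply: lerD; exact: ler_wpM2l.
Qed.

Definition cone_property D (x0 : 'rV[R]_n.+1) (e L : R) : Prop :=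
  exists (j : 'I_n.+1) (s : R), `|s| = 1 /\
    forall x y, D x -> `|x0 - x| < e -> `|x0 - y| < e ->
      cone j s L (y - x) -> D y.

(** If [y] lies above [x] by more than [eta * h + L * M], with lateral distance at most [M], then a
    whole ball around [y] lies in [x] + cone, hence in [D]. If no such ball exists, heights in [A]
    vary by at most [eta * h + L * M], and [strip_volume_le] contradicts the lower bound on the
    volume. The radius depends on [v] and [L] only. *)
Lemma deep_point (v L : R) : (0 < n)%N -> 0 < v -> 0 <= L ->
  exists2 rho : R, 0 < rho <= 1 &
  forall D A x0 o (e h : R), cone_property D x0 e L -> A `<=` D ->
    measurable (tset A) -> 0 < h -> (forall x, A x -> `|x - o| <= h) ->
    `|x0 - o| + 2 * h < e -> v * h ^+ n.+1 <= volume A ->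
    exists2 x, A x & forall y, `|x - y| < rho * h -> D y.
Proof.
move=> n0 v0 L0.
(* The strip bound will be [2 ^+ n.+2 * eta * h ^+ n.+1]; the larger power [2 ^+ n.+4] makes the
   contradiction strict. *)
pose eta : R := Num.min 1 (v / (2 ^+ n.+4)).
have eta0 : 0 < eta by rewrite lt_min ltr01 divr_gt0// exprn_gt0.
have eta1 : eta <= 1 by rewrite ge_min lexx.
have etav : eta * 2 ^+ n.+4 <= v.
  by rewrite -ler_pdivlMr ?exprn_gt0// ge_min lexx orbT.
have L1 : 0 < 1 + L by rewrite ltr_pwDl.
(* Moving [y] within radius [r] costs at most [r] in height and [L * r] in the lateral term,
   together [(1 + L) * r], which equals [eta * h] for this choice. *)
exists (eta / (1 + L)).
  by rewrite divr_gt0//= ler_pdivrMr// mul1r (le_trans eta1)// lerDl.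
move=> D A x0 o e h [j [s [s1 coneD]]] AD mA h0 Ao x0o vA.
apply: contrapT => nodeep.
have nAx x : A x -> `|x0 - x| <= `|x0 - o| + h.
  move=> /Ao xo; rewrite -(subrKA o) (le_trans (ler_normD _ _))// lerD2l.
  by rewrite distrC.
have ss : s * s = 1.
  by rewrite -expr2 -real_normK ?num_real// s1 expr1n.
have strip0 x y (M : R) : A x -> A y -> (forall k, `|(x - y) 0 (lift j k)| <= M) ->
    s * (y - x) 0 j <= eta * h + L * M.
  move=> Ax Ay xyM; rewrite leNgt; apply/negP => big.
  apply: nodeep; exists y => // z yz.
  have rh : eta / (1 + L) * h <= h.
    rewrite ler_piMl ?(ltW h0)// ler_pdivrMr// mul1r (le_trans eta1)// lerDl//.
  apply: (coneD x) => //; first exact: AD.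
  - by apply: le_lt_trans (nAx _ Ax) _; lra.
  - rewrite -(subrKA y); apply: (le_lt_trans (ler_normD _ _)).
    by have := nAx _ Ay; lra.
  have rE : (1 + L) * (eta / (1 + L) * h) = eta * h.
    by rewrite mulrA mulrCA divff ?gt_eqF// mulr1.
  set r := eta / (1 + L) * h in yz rh rE.
  have yzi i : `|y 0 i - z 0 i| < r.
    by have := coord_le_norm (y - z) i; rewrite !mxE; move/le_lt_trans; apply.
  have sj : s * (y 0 j - z 0 j) <= r.
    apply: (le_trans (ler_norm _)); rewrite normrM s1 mul1r; exact: ltW.
  have E : s * (z - x) 0 j = s * (y - x) 0 j - s * (y 0 j - z 0 j).
    by rewrite !mxE; ring.
  have key k : L * `|(z - x) 0 (lift j k)| <= s * (z - x) 0 j.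
    have : `|(z - x) 0 (lift j k)| <= r + M.
      rewrite !mxE -(subrKA (y 0 (lift j k))) (le_trans (ler_normD _ _))//.
      apply: lerD; first by rewrite distrC ltW.
      by have := xyM k; rewrite !mxE distrC.
    move=> /(ler_wpM2l L0) /le_trans; apply; rewrite E; lra.
  (* The sign condition follows from any lateral inequality; there is one because [n] is
     positive. *)
  by split=> //; apply: le_trans (key (Ordinal n0)); rewrite mulr_ge0.
have strip x y (M : R) : A x -> A y ->
    (forall k, `|(x - y) 0 (lift j k)| <= M) -> `|(x - y) 0 j| <= eta * h + L * M.
  move=> Ax Ay xyM; rewrite -[leLHS]mul1r -s1 -normrM ler_norml.
  have xy := strip0 _ _ _ Ax Ay xyM.
  have yx : s * (x - y) 0 j <= eta * h + L * M.
    by apply: strip0 => // k; rewrite -opprB mxE normrN.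
  rewrite yx andbT lerNl; apply: le_trans xy.
  by rewrite !mxE le_eqVlt; apply/orP; left; apply/eqP; ring.
(* Columns narrow enough for the lateral term [L * (2 * h / K%:R)] not to exceed [eta * h]. *)
pose K := (Num.truncn (2 * L / eta)).+1.
have tK : 2 * L / eta < K%:R.
  by have /andP[] := truncn_itv (divr_ge0 (mulr_ge0 (ler0n R 2) L0) (ltW eta0)).
have KL : 2 * L <= eta * K%:R by rewrite [eta * _]mulrC -ler_pdivrMr// ltW.
have K0 : 0 < K%:R :> R by rewrite ltr0n.
have := strip_volume_le (ltn0Sn _ : (0 < K)%N) (ltW h0)
  (mulr_ge0 (ltW eta0) (ltW h0)) L0 mA Ao strip.
move=> /(le_trans vA); apply/negP; rewrite -ltNge.
have LK : L * (2 * h / K%:R) <= eta * h.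
  rewrite (_ : L * _ = 2 * L * h / K%:R); last by ring.
  by rewrite ler_pdivrMr//; have := ler_wpM2r (ltW h0) KL; lra.
have hn : 0 < h ^+ n by rewrite exprn_gt0.
have n2 : 0 < 2 ^+ n :> R by rewrite exprn_gt0.
apply: (@le_lt_trans _ _ ((2 * h) ^+ n * (4 * (eta * h)))).
  by rewrite ler_wpM2l ?exprn_ge0 ?mulr_ge0 ?(ltW h0)//; lra.
rewrite exprMn (_ : _ * _ = (eta * (4 * 2 ^+ n)) * h ^+ n.+1); last first.
  by rewrite exprS; ring.
rewrite ltr_pM2r ?exprn_gt0//; apply: lt_le_trans etav.
by rewrite ltr_pM2l// !exprS; lra.
Qed.

End cones.

(** * Cone property at the interface *)

Section interface.
Context (R : realType) (n : nat).
Implicit Types (x y z : 'rV[R]_n.+1) (D G : set 'rV[R]_n.+1).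

Lemma segment_same_side (d : nat) (U1 U2 : set 'rV[R]_d) (x y : 'rV[R]_d) :
  open U1 -> open U2 -> U1 `&` U2 = set0 -> U1 x ->
  (forall t : R, 0 <= t <= 1 -> (U1 `|` U2) (x + t *: (y - x))) -> U1 y.
Proof.
move=> o1 o2 U12 U1x seg.
have disj (z : 'rV[R]_d) : U1 z -> U2 z -> False.
  by move=> z1 z2; have : (U1 `&` U2) z by []; rewrite U12.
have clo U : open U -> closed [set t : R | ~ U (x + t *: (y - x))].
  move=> oU; apply: (@closed_comp _ _ (fun t : R => x + t *: (y - x)) (~` U)).
    by move=> t _; exact: continuous_segment.
  exact: open_closedC.
have := segment_closed_dichotomy (clo _ o2) (clo _ o1).
have E0 : x + (0 : R) *: (y - x) = x by rewrite scale0r addr0.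
have E1 : x + (1 : R) *: (y - x) = y by rewrite scale1r subrKC.
rewrite /= E0 E1 => H.
have := seg 1; rewrite ler01 lexx E1 => -[]// .
move=> U2y; exfalso; apply: H U2y.
- exact: disj U1x.
- move=> t /seg[H|H]; [left|right] => H'; first exact: disj H H'.
  exact: disj H' H.
- by move=> t /seg[H|H].
Qed.

Lemma derive_line (d : nat) (g : 'rV[R]_d -> R) (z v : 'rV[R]_d) (t : R) :
  derivable g (z + t *: v) v ->
  is_derive t 1 (fun s => g (z + s *: v)) ('D_v g (z + t *: v)).
Proof.
move=> dg.
have E : (fun h : R => h^-1 *: (((fun s => g (z + s *: v)) \o shift t) (h *: 1) -
      g (z + t *: v))) =
    (fun h => h^-1 *: ((g \o shift (z + t *: v)) (h *: v) - g (z + t *: v))).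
  apply/funext => h /=; congr (_ *: (g _ - _)).
  by rewrite -[h *: 1]/(h * 1) mulr1; apply/rowP => i; rewrite !mxE; ring.
by split; rewrite /derivable /derive E.
Qed.

Lemma increment_le (f df : R -> R) (M a b : R) :
  (forall t, Num.min a b <= t <= Num.max a b -> is_derive t 1 f (df t)) ->
  (forall t, Num.min a b <= t <= Num.max a b -> `|df t| <= M) ->
  `|f b - f a| <= M * `|b - a|.
Proof.
wlog ab : a b / a <= b.
  move=> H fdf dfM; have [ab|/ltW ba] := leP a b; first exact: H.
  by rewrite distrC (distrC b); apply: H => // t; rewrite minC maxC;
    [exact: fdf | exact: dfM].
rewrite (min_idPl ab) (max_idPr ab) => fdf dfM.
have [||c cab ->] := @MVT_segment R f df a b ab.
- by move=> t; rewrite in_itv/= => /andP[/ltW ta /ltW tb]; apply: fdf; rewrite ta.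
- apply: derivable_within_continuous => t; rewrite in_itv/= => tab.
  by have [] := fdf t tab.
- by rewrite normrM ler_wpM2r// dfM.
Qed.

Lemma C1_locally_lipschitz (d : nat) (g : 'rV[R]_d -> R) (x0 : 'rV[R]_d) :
  Ck 1 g -> exists e L : R, [/\ 0 < e, 0 <= L & forall x y : 'rV[R]_d,
    `|x0 - x| < e -> `|x0 - y| < e -> `|g x - g y| <= L * `|x - y|].
Proof.
move=> [_ dg cdg].
pose M j := `|'D_(delta_mx 0 j) g x0| + 1.
have key j : \forall x \near x0, `|'D_(delta_mx 0 j) g x| <= M j.
  have /cvgrPdist_lt/(_ 1 ltr01) := cdg j x0.
  apply: filterS => x xx0; rewrite /M.
  rewrite -[X in `|X|](subrK ('D_(delta_mx 0 j) g x0)).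
  by rewrite (le_trans (ler_normD _ _))// addrC lerD2l distrC ltW.
have := @filter_forall _ _ _ (nbhs x0) (nbhs_filter x0) key.
rewrite nearE -nbhs_ballE => -[e /= e0 xM].
pose L := \sum_j M j.
have M0 j : 0 <= M j by rewrite addr_ge0.
exists e, (\sum_j M j); split => //; first exact: sumr_ge0.
move=> x y xe ye.
(* From [x] to [y] one coordinate at a time, so that partial derivatives suffice; the intermediate
   points stay in the ball because a sup-norm ball is a box. *)
pose z (k : nat) : 'rV[R]_d := \row_i (if (i < k)%N then y 0 i else x 0 i).
have step (k : 'I_d) : `|g (z k.+1) - g (z k)| <= M k * `|x - y|.
  pose v : 'rV[R]_d := delta_mx 0 k.
  have zS : z k.+1 = z k + (y 0 k - x 0 k) *: v.
    apply/rowP => i; rewrite !mxE eqxx /= ltnS leq_eqVlt.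
    have [->|ik] := eqVneq i k; first by rewrite eqxx ltnn mulr1 subrKC.
    by rewrite (negPf (ik : val i != val k)) mulr0 addr0.
  have inball t : Num.min 0 (y 0 k - x 0 k) <= t <= Num.max 0 (y 0 k - x 0 k) ->
      `|x0 - (z k + t *: v)| < e.
    move=> tb; apply: norm_lt_coord => // i.
    have xi : `|x0 0 i - x 0 i| < e.
      by rewrite -coordB; apply: le_lt_trans xe; exact: coord_le_norm.
    have yi : `|x0 0 i - y 0 i| < e.
      by rewrite -coordB; apply: le_lt_trans ye; exact: coord_le_norm.
    rewrite !mxE eqxx /=; have [ik|ik] := eqVneq i k; last first.
      by rewrite mulr0 addr0; case: ifP.
    rewrite ik ltnn mulr1; move: xi yi tb; rewrite ik !ltr_norml.
    rewrite ge_min le_max; move=> /andP[? ?] /andP[? ?] /andP[/orP[?|?] /orP[?|?]]; lra.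
  have := @increment_le (fun t => g (z k + t *: v))
    (fun t => 'D_v g (z k + t *: v)) (M k) 0 (y 0 k - x 0 k).
  rewrite -zS scale0r addr0 subr0 => H.
  apply: (le_trans (H _ _)).
  - by move=> t _; apply: derive_line; exact: dg.
  - by move=> t /inball tb; apply: xM; rewrite ballE.
  - by rewrite ler_wpM2l// distrC -coordB coord_le_norm.
have z0 : z 0%N = x by apply/rowP => i; rewrite mxE.
have zd : z d = y by apply/rowP => i; rewrite mxE ltn_ord.
rewrite distrC -[in leLHS]z0 -[in leLHS]zd.
rewrite -(@telescope_sumr _ 0%N d (fun k => g (z k)))// big_mkord mulr_suml.
by apply: (le_trans (ler_norm_sum _ _ _)); apply: ler_sum => k _; exact: step.
Qed.

Lemma cone_property_mono D x0 (e L e' L' : R) y0 : 0 <= L -> L <= L' ->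
  `|x0 - y0| + e' <= e -> cone_property D x0 e L -> cone_property D y0 e' L'.
Proof.
move=> L0 LL xe [j [s [s1 H]]]; exists j, s; split => // x y Dx xe' ye' [c1 c2].
have near z : `|y0 - z| < e' -> `|x0 - z| < e.
  by move=> yz; rewrite -(subrKA y0) (le_lt_trans (ler_normD _ _))//; lra.
apply: (H x) => //; [exact: near|exact: near|split => // k].
by apply: le_trans (c2 k); rewrite ler_wpM2r.
Qed.

Lemma normr_sg_mul (s x : R) : `|s| = 1 -> - `|x| <= s * x.
Proof. by move=> s1; rewrite lerNl -mulrN (le_trans (ler_norm _))// normrM s1 mul1r normrN. Qed.

Section local.
Variables (D1 D2 G U : set 'rV[R]_n.+1) (x0 : 'rV[R]_n.+1) (j : 'I_n.+1).
Variable g : 'rV[R]_n -> R.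
Hypotheses (o1 : open D1) (o2 : open D2) (D12 : D1 `&` D2 = set0).
Hypotheses (G1 : G `&` D1 = set0) (G2 : G `&` D2 = set0).
Hypotheses (oU : open U) (Ux0 : U x0) (cover : U `<=` D1 `|` G `|` D2).
Hypothesis graph : forall x, U x -> (G x <-> x 0 j = g (col' j x)).
Hypotheses (c1 : closure D1 x0) (c2 : closure D2 x0) (C1 : Ck 1 g).

(** The chart does not tell which side of the graph belongs to [D1]. Near [x0] the points off [G] on
    one side of the graph all belong to the same domain; as [x0] is in the closure of [D2], one side
    is taken by [D2], so [D1] lies on the other. A cone steeper than the Lipschitz constant never
    leaves a side. *)
Lemma graph_cone_property : exists e L : R,
  [/\ 0 < e, 0 <= L & cone_property D1 x0 e L].
Proof.
have [e1 [L [e10 L0 lip]]] := C1_locally_lipschitz (col' j x0) C1.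
have [e2 e20 xU] := open_ballP oU Ux0.
pose e := Num.min e1 e2.
have e0 : 0 < e by rewrite lt_min e10.
have inU x : `|x0 - x| < e -> U x by rewrite lt_min => /andP[_ /xU].
have colB x y : col' j x - col' j y = col' j (x - y).
  by apply/rowP => k; rewrite !mxE.
have col_le x : `|col' j x| <= `|x|.
  by apply: norm_le_coord => // k; rewrite mxE coord_le_norm.
have lip' x y : `|x0 - x| < e -> `|x0 - y| < e ->
    `|g (col' j x) - g (col' j y)| <= L * `|col' j (x - y)|.
  rewrite !lt_min => /andP[xe _] /andP[ye _]; rewrite -colB; apply: lip.
    by rewrite colB; apply: le_lt_trans xe.
  by rewrite colB; apply: le_lt_trans ye.
pose side s x := 0 < s * (x 0 j - g (col' j x)).
have cone_side s x y : `|s| = 1 -> `|x0 - x| < e -> `|x0 - y| < e ->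
    cone j s L (y - x) -> side s x -> side s y.
  move=> s1 xe ye [w0 wL] sx.
  have : L * `|col' j (y - x)| <= s * (y - x) 0 j.
    have [L00|Lp] : L = 0 \/ 0 < L.
    - by move: L0; rewrite le_eqVlt => /predU1P[<-|]; [left|right].
    - by rewrite L00 mul0r.
    - rewrite mulrC -ler_pdivlMr//; apply: norm_le_coord => [|k].
        by rewrite divr_ge0.
      by rewrite mxE ler_pdivlMr// mulrC.
  have := lip' _ _ ye xe; have := normr_sg_mul (g (col' j x) - g (col' j y)) s1.
  rewrite distrC /side !mxE; move: sx; rewrite /side; lra.
(* The segment stays on one side of the graph, hence off [G], and cannot pass from one domain to the
   other. *)
have cone_same D D' s x y : open D -> open D' -> D `&` D' = set0 ->
    U `<=` D `|` G `|` D' -> `|s| = 1 -> `|x0 - x| < e -> `|x0 - y| < e ->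
    cone j s L (y - x) -> side s x -> D x -> D y.
  move=> oD oD' DD' cov s1 xe ye wc sx Dx.
  apply: (segment_same_side oD oD' DD' Dx) => t t01.
  have ze : `|x0 - (x + t *: (y - x))| < e by apply: convex_normball.
  have sz : side s (x + t *: (y - x)).
    apply: cone_side sx => //; rewrite addrC addKr.
    have z0 : cone j s L 0 by split=> [|k]; rewrite !mxE mulr0// normr0 mulr0.
    by have := convex_cone L0 z0 wc t01; rewrite subr0 add0r.
  have [[]|] := cov _ (inU _ ze); [by left| |by right].
  move=> /(graph (inU _ ze)) E; move: sz; rewrite /side E subrr mulr0 ltxx.
  by [].
have L1 : 0 < 1 + L by rewrite ltr_pwDl.
have [e' e'0 e'L] : exists2 e' : R, 0 < e' & (1 + L) * e' < e.
  exists (e / (2 * (1 + L))); first by rewrite divr_gt0// mulr_gt0.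
  have -> : (1 + L) * (e / (2 * (1 + L))) = e / 2 by field; rewrite gt_eqF.
  lra.
have e'e : e' < e.
  by apply: le_lt_trans e'L; rewrite ler_peMl ?lerDl// ltW.
have U21 : U `<=` D2 `|` G `|` D1 by move=> z /cover[[]|]; [right|left; right|left; left].
have same_class s x y : `|s| = 1 -> `|x0 - x| < e' -> `|x0 - y| < e' ->
    side s x -> side s y -> D1 x -> D2 y -> False.
  move=> s1 xe ye sx sy x1 y2.
  (* A point so high above [x0] that it lies in the cones issued from both [x] and [y]; the bound on
     [(1 + L) * e'] keeps it in the chart. *)
  pose z := x0 + (s * ((1 + L) * e')) *: delta_mx 0 j.
  have ze : `|x0 - z| < e.
    rewrite opprD addNKr normrN; apply: norm_lt_coord => // k.
    rewrite !mxE eqxx/= normrM normrM s1 mul1r (gtr0_norm (mulr_gt0 L1 e'0)).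
    by case: eqP => _; rewrite ?normr1 ?normr0 ?mulr0 ?mulr1.
  have ss : s * s = 1 by rewrite -expr2 -real_normK ?num_real// s1 expr1n.
  have zc w : `|x0 - w| < e' -> cone j s L (z - w).
    move=> we.
    have wi i : `|x0 0 i - w 0 i| < e'.
      by rewrite -coordB; apply: le_lt_trans we; exact: coord_le_norm.
    have H1 : L * e' <= s * (z - w) 0 j.
      rewrite !mxE !eqxx /= mulr1.
      have := normr_sg_mul (x0 0 j - w 0 j) s1; have := wi j => H2 H3.
      rewrite (_ : s * _ = s * s * ((1 + L) * e') + s * (x0 0 j - w 0 j)); last by ring.
      by rewrite ss; lra.
    split; first by apply: le_trans H1; rewrite mulr_ge0// ltW.
    move=> k; apply: le_trans H1; rewrite ler_wpM2l//.
    by rewrite !mxE [lift j k == j]eq_sym eq_liftF andbF mulr0 addr0 ltW.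
  have z1 : D1 z by apply: (cone_same D1 D2 s x) => //; [exact: lt_trans e'e|exact: zc].
  have z2 : D2 z.
    by apply: (cone_same D2 D1 s y) => //; [rewrite setIC|exact: lt_trans e'e|exact: zc].
  by have : (D1 `&` D2) z by []; rewrite D12.
have [p p2 pe] := closureP c2 e'0.
have onside D x : G `&` D = set0 -> D x -> `|x0 - x| < e' ->
    side 1 x \/ side (- 1) x.
  move=> GD Dx xe; have Ux := inU _ (lt_trans xe e'e).
  rewrite /side mul1r mulN1r oppr_gt0.
  case: (ltrgtP (x 0 j - g (col' j x)) 0) => [|| /eqP]; [by right|by left|].
  rewrite subr_eq0 => /eqP/(graph Ux) Gx.
  by have : (G `&` D) x by []; rewrite GD.
have s11 : `|1 : R| = 1 by rewrite normr1.
have sN1 : `|-1 : R| = 1 by rewrite normrN normr1.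
have fin s : `|s| = 1 -> (forall x, D1 x -> `|x0 - x| < e' -> side s x) ->
    cone_property D1 x0 e' L.
  move=> s1 Ds; exists j, s; split => // x y Dx xe ye wc.
  apply: (cone_same D1 D2 s x) => //; [exact: lt_trans e'e|exact: lt_trans e'e|].
  exact: Ds.
exists e', L; split => //.
case: (onside D2 p G2 p2 pe) => ps.
  apply: (fin (-1)) => // x x1 xe; case: (onside D1 x G1 x1 xe) => // xs.
  by exfalso; exact: (same_class 1 x p).
apply: (fin 1) => // x x1 xe; case: (onside D1 x G1 x1 xe) => // xs.
by exfalso; exact: (same_class (-1) x p).
Qed.

End local.

(** A single parameter [e] plays two roles, radius [e] and slope [e^-1]: as it decreases to 0 the
    ball shrinks and the cone narrows, so the property holds for all small [e] near each point, and
    compactness makes [e] uniform. *)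
Lemma compact_cone_property G D : compact G ->
  (forall x0, G x0 -> exists e L : R,
    [/\ 0 < e, 0 <= L & cone_property D x0 e L]) ->
  exists2 e : R, 0 < e & forall x0, G x0 -> cone_property D x0 e e^-1.
Proof.
move=> /compact_near_coveringP cG loc.
have : \forall e \near (0:R)^'+, G `<=` (fun x0 => cone_property D x0 e e^-1).
  apply: cG => x Gx; have [e [L [e0 L0 c]]] := loc x Gx.
  have e20 : 0 < e / 2 by rewrite divr_gt0.
  have L1 : 0 < 1 + L by rewrite ltr_pwDl.
  near=> y t.
  have t0 : 0 < t by near: t; exact: nbhs_right_gt.
  have te : t <= e / 2 by near: t; apply: nbhs_right_le.
  have tL : t <= (1 + L)^-1 by near: t; apply: nbhs_right_le; rewrite invr_gt0.
  apply: cone_property_mono c => //.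
    apply: (@le_trans _ _ (1 + L)); first by rewrite lerDr.
    by rewrite -[leLHS]invrK lef_pV2 ?posrE ?invr_gt0.
  have : `|x - y| < e / 2.
    by near: y; apply: (open_nbhs_nbhs (A := [set y | `|x - y| < e / 2]));
      split => /=; [exact: open_normball | rewrite subrr normr0].
  by move=> /= xy; lra.
move=> ncone; near (0:R)^'+ => e; exists e.
  by near: e; exact: nbhs_right_gt.
by near: e.
Unshelve. all: by end_near. Qed.

End interface.

(** * Chains of elements *)

Section chains.
Context (R : realType) (n : nat) (m : mesh R n.+1) (Om : set 'rV[R]_n.+1).
Notation cell := {set 'I_(nv m)}.
Implicit Types (S T : cell) (U : set 'rV[R]_n.+1).
Hypothesis tri : triangulation m Om.
Hypothesis fat : forall T, T \in cells m ->
  exists (c : 'rV[R]_n.+1) (r : R), 0 < r /\ forall y, `|c - y| < r -> region T y.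

(** The inscribed ball of the cell is contracted towards the common point until it fits into [U]. *)
Lemma cell_meets_open T U : T \in cells m -> open U -> region T `&` U !=set0 ->
  exists (c : 'rV[R]_n.+1) (r : R),
    0 < r /\ forall y, `|c - y| < r -> region T y /\ U y.
Proof.
move=> /fat[c [r [r0 cT]]] oU [x [Tx Ux]].
have [e e0 xU] := open_ballP oU Ux.
pose q := `|c - x| + r.
have q0 : 0 < q by rewrite ltr_wpDl.
pose t := Num.min 1 (e / (2 * q)).
have t0 : 0 < t by rewrite lt_min ltr01 divr_gt0// mulr_gt0.
have t1 : t <= 1 by rewrite ge_min lexx.
have tq : t * q < e.
  apply: (@le_lt_trans _ _ (e / (2 * q) * q)).
    by rewrite ler_wpM2r ?(ltW q0)// ge_min lexx orbT.
  by rewrite (_ : _ * _ = e / 2); [lra | field; rewrite gt_eqF].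
exists (x + t *: (c - x)), (t * r); split; first by rewrite mulr_gt0.
move=> y yt; split.
  by apply: (convex_ball_contract (@convex_hull _ _ _ _ T) Tx cT _ yt); rewrite t0.
apply: xU; rewrite -(subrKA (x + t *: (c - x))) (le_lt_trans (ler_normD _ _))//.
rewrite opprD addNKr normrN normrZ gtr0_norm//.
by move: tq; rewrite /q mulrDr; lra.
Qed.

(** The vertices of [S] and [z] are at most [n.+1] points of a space of dimension [n.+1]. *)
Lemma codim2_hyperplane S (z : 'rV[R]_n.+1) : (#|S| <= n)%N ->
  exists2 f : p1 R n.+1, f.1 != 0 &
    p1_eval f z = 0 /\ forall y, region S y -> p1_eval f y = 0.
Proof.
move=> Sn.
have [|f f0 fz] := @hyperplane_through R n.+1
  (z :: [seq @node _ _ m j | j <- enum S]) isT.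
  by rewrite /= size_map -cardE.
exists f => //; split; first by apply: fz; rewrite mem_head.
apply: hull_p1_eq0 => j jS; apply: fz.
by rewrite inE map_f ?orbT// mem_enum.
Qed.

(** The hyperplanes also contain [z]: when [z] is the other end of a segment, the segment meets each
    of them only at [z], so it can meet a face of codimension 2 nowhere else. *)
Lemma generic_point_in_cell T U (z : 'rV[R]_n.+1) : T \in cells m -> open U ->
  region T `&` U !=set0 ->
  exists p, [/\ region T p, U p & forall S, (#|S| <= n)%N ->
    exists f : p1 R n.+1, [/\ p1_eval f p != 0, p1_eval f z = 0 &
      forall y, region S y -> p1_eval f y = 0]].
Proof.
move=> Tm oU /(cell_meets_open Tm oU)[c [r [r0 cTU]]].
have /choice[F FP] : forall S : cell, exists f : p1 R n.+1, f.1 != 0 /\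
    ((#|S| <= n)%N -> p1_eval f z = 0 /\ forall y, region S y -> p1_eval f y = 0).
  move=> S; have [Sn|nS] := leqP #|S| n.
    by have [f f0 fP] := codim2_hyperplane z Sn; exists f.
  (* Any nonconstant affine function will do for the larger sets; it makes the choice total. *)
  have [|f f0 _] := @codim2_hyperplane finset.set0 z; first by rewrite cards0.
  by exists f; split.
have [|||p pc pF] := @generic_point _ _ [seq F C | C : cell] [set y | `|c - y| < r].
- by move=> f /mapP[S _ ->]; have [] := FP S.
- exact: open_normball.
- by exists c; rewrite /= subrr normr0.
have [Tp Up] := cTU _ pc.
exists p; split => // S Sn; have [_ /(_ Sn)[fz fS]] := FP S.
by exists (F S); split => //; apply: pF; apply: map_f; rewrite mem_enum.
Qed.

Definition crossing U : rel cell := fun A B =>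
  [&& A \in cells m, B \in cells m, @face_adj R n.+1 m A B &
      `[< region (A :&: B)%SET `&` U !=set0 >] ].

(* A generic segment in [U] avoids the faces of codimension 2, so it leaves a
   cell only through the interior of a facet. *)
Lemma connect_crossing U T T' : open U -> convex U -> U `<=` closure Om ->
  T \in cells m -> T' \in cells m ->
  region T `&` U !=set0 -> region T' `&` U !=set0 -> connect (crossing U) T T'.
Proof.
move=> oU cU UOm Tm T'm TU T'U.
(* For [p] the base point [0] is arbitrary; [q] is then taken generic with respect to [p]. *)
have [p [Tp Up pS]] := generic_point_in_cell 0 Tm oU TU.
have [q [T'q Uq qS]] := generic_point_in_cell p T'm oU T'U.
pose seg (t : R) := p + t *: (q - p).
have seg0 : seg 0 = p by rewrite /seg scale0r addr0.
have seg1 : seg 1 = q by rewrite /seg scale1r subrKC.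
(* Cells linked to [T] against the others. At a point of the segment common to both kinds, the two
   cells share either a facet, which would link them, or a face with at most [n] vertices, which
   genericity excludes. So the two closed sets cannot share the segment. *)
pose reach (b : bool) : set 'rV[R]_n.+1 := [set x | exists C : cell,
  [/\ C \in cells m, connect (crossing U) T C = b & region C x]].
have clo b : closed (reach b).
  rewrite (_ : reach b = \big[setU/set0]_(C : cell |
      (C \in cells m) && (connect (crossing U) T C == b)) region C).
    by apply: big_ind; [exact: closed0 | exact: closedU | move=> C _; exact: closed_hull].
  apply/seteqP; split=> x.
    move=> [C [Cm /eqP Cb Cx]]; rewrite (bigD1 C)/=; last by rewrite Cm.
    by left.
  move=> H; elim/big_ind : _ H => [//|A B HA HB [/HA|/HB]//|C /andP[Cm /eqP Cb] Cx].
  by exists C.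
have segc b : closed (seg @^-1` reach b).
  by apply: closed_comp => // t _; exact: continuous_segment.
have := segment_closed_dichotomy (segc true) (segc false).
rewrite /= seg0 seg1 => H.
apply/negPn/negP => TT'.
have covered t : 0 <= t <= 1 -> exists2 C, C \in cells m & region C (seg t).
  move=> t01; have : closure Om (seg t) by apply/UOm/cU.
  by rewrite (tri_cover tri).
have disj t : 0 <= t <= 1 -> reach true (seg t) -> reach false (seg t) -> False.
  move=> t01 [C [Cm TC Cy]] [C' [C'm TC' C'y]].
  have Uy : U (seg t) by exact: cU.
  have Iy : region (C :&: C')%SET (seg t) by rewrite -(tri_conform tri).
  have CC' : C != C' by apply/eqP => CC'; move: TC'; rewrite -CC' TC.
  have [cardC _] := tri_simplex tri Cm; have [cardC' _] := tri_simplex tri C'm.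
  have card_lt : (#|C :&: C'| < n.+2)%N.
    rewrite ltnNge; apply/negP => In; case/eqP: CC'.
    have /eqP <- : (C :&: C')%SET == C.
      by rewrite eqEcard finset.subsetIl cardC.
    by apply/eqP; rewrite eqEcard finset.subsetIr cardC'.
  move: card_lt; rewrite ltnS leq_eqVlt => /orP[/eqP In|].
    have : connect (crossing U) T C'.
      apply: (connect_trans (y := C)) => //; apply: connect1.
      rewrite /crossing Cm C'm /face_adj In eqxx/=.
      by apply/asboolP; exists (seg t).
    by rewrite TC'.
  rewrite ltnS => In.
  have [f [fq fp fI]] := qS _ In.
  have := fI _ Iy; rewrite p1_eval_segment fp mulr0 add0r => /eqP.
  rewrite mulf_eq0 (negPf fq) orbF => /eqP t0.
  have [f' [f'p _ f'I]] := pS _ In.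
  by move/eqP: f'p; apply; rewrite -seg0; apply: f'I; rewrite -[X in seg X]t0.
have : reach true q.
  apply: H => //; first by exists T; split; rewrite ?connect0.
  move=> t /covered[C Cm Cy]; case TC : (connect (crossing U) T C).
    by left; exists C.
  by right; exists C.
rewrite -seg1 => rq; apply: (disj 1 _ rq); first by rewrite ler01 lexx.
by exists T'; split; rewrite ?seg1//; apply/negbTE.
Qed.

End chains.

(** * Size, inscribed balls and number of cells *)

Section mesh_geometry.
Context (R : realType) (n : nat).
Implicit Types (m : mesh R n.+1) (x y : 'rV[R]_n.+1).

Definition cells_of_size m (h : R) : Prop :=
  forall T, T \in cells m -> forall x y, region T x -> region T y -> `|x - y| <= h.

Definition cells_fat m (r : R) : Prop :=
  forall T, T \in cells m -> exists c : 'rV[R]_n.+1, forall y,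
    `|c - y| < r -> region T y.

Lemma enorm_le_diam m T x y : region T x -> region T y ->
  enorm (x - y) <= @diam_cell R n.+1 m T.
Proof.
move=> Tx Ty; apply: ub_le_sup; last by exists x, y.
exists (n.+1%:R * (2 * \sum_j `|@node _ _ m j|)) => _ [a [b [Ta Tb ->]]].
apply: (le_trans (enorm_le_norm _)); rewrite ler_wpM2l//.
rewrite (le_trans (ler_normB _ _))//.
by have := hull_bounded Ta; have := hull_bounded Tb; lra.
Qed.

Lemma quasiuniform_size m kappa h : quasiuniform m kappa h -> cells_of_size m h.
Proof.
move=> qu T Tm x y Tx Ty; apply: (le_trans (norm_le_enorm _)).
by apply: (le_trans (enorm_le_diam Tx Ty)); have /andP[] := qu T Tm.
Qed.

(** [kappa] converts the diameter into [h], [sigma] is the shape constant, and [n.+1] converts the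
    Euclidean ball into a sup-norm ball. *)
Lemma shape_regular_fat m kappa sigma h : 1 <= kappa -> 1 <= sigma ->
  quasiuniform m kappa h -> shape_regular m sigma ->
  cells_fat m ((kappa * sigma * n.+1%:R)^-1 * h).
Proof.
move=> k1 s1 qu sr T Tm; have [c cT] := sr T Tm; exists c => y cy; apply: cT.
have /andP[_ hk] := qu T Tm.
have k0 : 0 < kappa by rewrite (lt_le_trans ltr01).
have s0 : 0 < sigma by rewrite (lt_le_trans ltr01).
have n0 : 0 < n.+1%:R :> R by rewrite ltr0n.
rewrite -(ler_pM2l k0); apply: le_trans hk; rewrite mulrA.
apply: (@le_trans _ _ (kappa * sigma * (n.+1%:R * `|c - y|))).
  by rewrite ler_wpM2l ?mulr_ge0 ?(ltW k0) ?(ltW s0)// distrC enorm_le_norm.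
by rewrite mulrA mulrC -ler_pdivlMr ?mulr_gt0// mulrC ltW.
Qed.

Lemma card_cell_capI m Om T T' : triangulation m Om -> T \in cells m ->
  T' \in cells m -> T != T' -> (#|T :&: T'| <= n.+1)%N.
Proof.
move=> tri Tm T'm; apply: contraNT; rewrite -ltnNge => In.
have [cT _] := tri_simplex tri Tm; have [cT' _] := tri_simplex tri T'm.
have /eqP <- : (T :&: T')%SET == T by rewrite eqEcard finset.subsetIl cT.
by rewrite eqEcard finset.subsetIr cT'.
Qed.

(* Rounding the centres of the inscribed balls to a grid of the size of their
   radius is injective. *)
Lemma card_near_cells_le (R0 r0 : R) : 0 <= R0 -> 0 < r0 -> exists K : nat,
  forall m Om (h : R), triangulation m Om -> 0 < h -> cells_of_size m h ->
    cells_fat m (r0 * h) -> forall (x : 'rV[R]_n.+1) (A : {set {set 'I_(nv m)}}),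
    (forall T, T \in A -> T \in cells m /\ exists2 y, region T y & `|x - y| <= R0 * h) ->
    (#|A| <= K)%N.
Proof.
(* The centres are within [(R0 + 1) * h] of [x], so their offsets in units of [r0 * h] range over an
   interval of length [2 * (R0 + 1) / r0]. *)
move=> R00 r00; pose K := Num.truncn (2 * (R0 + 1) / r0).
exists (K.+1 ^ n.+1)%N => m Om h tri h0 size fat x A Ax.
have /choice[c cP] : forall T, exists c : 'rV[R]_n.+1, T \in cells m ->
    forall y, `|c - y| < r0 * h -> region T y.
  move=> T; case: (boolP (T \in cells m)) => [/fat[c cT]|_]; first by exists c.
  by exists 0.
have w0 : 0 < r0 * h by rewrite mulr_gt0.
pose q T i : R := (c T 0 i - x 0 i + (R0 + 1) * h) / (r0 * h).
have qP T : T \in A -> forall i, 0 <= q T i < K.+1%:R.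
  move=> /Ax[Tm [y Ty xy]] i.
  have Tc : region T (c T) by apply: cP => //; rewrite subrr normr0.
  have : `|c T 0 i - x 0 i| <= (R0 + 1) * h.
    rewrite -coordB (le_trans (coord_le_norm _ _))//.
    rewrite -(subrKA y) (le_trans (ler_normD _ _))// mulrDl addrC lerD//.
      by rewrite distrC.
    by rewrite mul1r; apply: (size T).
  rewrite ler_norml => /andP[c1 c2]; apply/andP; split.
    by apply: divr_ge0; [lra | exact: ltW].
  apply: (@le_lt_trans _ _ (2 * (R0 + 1) / r0)).
    rewrite ler_pdivrMr// (_ : _ * (r0 * h) = 2 * (R0 + 1) * h); last first.
      by field; rewrite gt_eqF.
    lra.
  have : 0 <= 2 * (R0 + 1) / r0.
    by apply: divr_ge0; [lra | exact: ltW].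
  by move=> /truncn_itv/andP[].
pose f T : {ffun 'I_n.+1 -> 'I_K.+1} := [ffun i => inord (Num.truncn (q T i))].
rewrite -[X in (_ <= X)%N](_ : #|{ffun 'I_n.+1 -> 'I_K.+1}| = _); last first.
  by rewrite card_ffun !card_ord.
rewrite -(@card_in_imset _ _ f); first exact: max_card.
move=> T T' TA T'A fTT'; apply: contrapT => /eqP TT'.
have [Tm _] := Ax _ TA; have [T'm _] := Ax _ T'A.
have cc : `|c T - c T'| < r0 * h.
  apply: norm_lt_coord => // i.
  have /andP[t1 t2] := qP _ TA i; have /andP[t1' t2'] := qP _ T'A i.
  have := congr1 (fun g : {ffun 'I_n.+1 -> 'I_K.+1} => val (g i)) fTT'.
  have tr (u : R) : 0 <= u < K.+1%:R -> (Num.truncn u < K.+1)%N.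
    move=> /andP[u0 uK]; rewrite -(ltr_nat R); apply: le_lt_trans uK.
    by have /andP[] := truncn_itv u0.
  rewrite /= !ffunE !inordK; [|by apply: tr; rewrite t1'|by apply: tr; rewrite t1].
  move=> tE; have /andP[a1 a2] := truncn_itv t1.
  have /andP[b1 b2] := truncn_itv t1'; rewrite -tE -natr1 in b1 b2.
  rewrite -natr1 in a2.
  have qB : q T i - q T' i = (c T - c T') 0 i / (r0 * h).
    by rewrite coordB /q; field; rewrite !gt_eqF.
  have : `|(c T - c T') 0 i / (r0 * h)| < 1 by rewrite -qB ltr_norml; lra.
  by rewrite normrM [X in _ * X]gtr0_norm ?invr_gt0// ltr_pdivrMr// mul1r.
(* The overlap of the two balls is open and nonempty, yet it lies in the common face, which is
   contained in a hyperplane. *)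
pose s := [seq @node _ _ m j | j <- enum (T :&: T')%SET].
have [||g g0 gs] := @hyperplane_through R n.+1 s => //.
  by rewrite size_map -cardE; exact: (card_cell_capI tri).
pose U : set 'rV[R]_n.+1 := [set y | `|c T - y| < r0 * h] `&` [set y | `|c T' - y| < r0 * h].
have oU : open U by apply: openI; exact: open_normball.
have [|y [y1 y2]] := p1_neq0_in_open g0 oU.
  by exists (c T'); split => //=; rewrite subrr normr0.
have : region (T :&: T')%SET y.
  by rewrite -(tri_conform tri)//; split; exact: cP.
move=> Iy; apply/negP; rewrite negbK; apply/eqP; apply: hull_p1_eq0 Iy => j jI.
by apply: gs; rewrite map_f// mem_enum.
Qed.

Lemma face_adj_region m (A B : {set 'I_(nv m)}) : @face_adj R n.+1 m A B ->
  exists y, region (A :&: B)%SET y.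
Proof.
move=> /eqP AB; have /card_gt0P[j jAB] : (0 < #|A :&: B|)%N by rewrite AB.
by exists (node j); apply: hull_vertex.
Qed.

Lemma face_adj_sym m : symmetric (@face_adj R n.+1 m).
Proof. by move=> A B; rewrite /face_adj finset.setIC. Qed.

Lemma regionIl m (A B : {set 'I_(nv m)}) : region (A :&: B)%SET `<=` region A.
Proof. by apply: hull_subset; exact: finset.subsetIl. Qed.

Lemma regionIr m (A B : {set 'I_(nv m)}) : region (A :&: B)%SET `<=` region B.
Proof. by apply: hull_subset; exact: finset.subsetIr. Qed.

Lemma face_path_dist m h (T : {set 'I_(nv m)}) p : 0 <= h -> cells_of_size m h ->
  path (@face_adj R n.+1 m) T p -> T \in cells m -> {subset p <= cells m} ->
  forall x y, region T x -> region (last T p) y -> `|x - y| <= (size p).+1%:R * h.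
Proof.
move=> h0 size; elim: p T => [|A p IH] T /=.
  by move=> _ Tm _ x y Tx Ty; rewrite mul1r; exact: (size T).
move=> /andP[/face_adj_region[z TAz] Ap] Tm pm x y Tx py.
rewrite -(subrKA z) (le_trans (ler_normD _ _))// -natr1 mulrDl mul1r addrC lerD//.
  apply: IH py => //; [by apply: pm; rewrite mem_head| |exact: regionIr TAz].
  by move=> B Bp; apply: pm; rewrite inE Bp orbT.
by apply: (size T) => //; exact: regionIl TAz.
Qed.

End mesh_geometry.

(** * Estimate along chains of good links *)

Lemma path_dist_le (R : realType) (V : normedModType R) (T : eqType)
    (e : rel T) (P : pred T) (f : T -> V) (b : R) (x : T) (p : seq T) :
  (forall y z, P y -> P z -> e y z -> `|f y - f z| <= b) ->
  P x -> all P p -> path e x p -> `|f x - f (last x p)| <= (size p)%:R * b.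
Proof.
move=> fb; elim: p x => [|y p IH] x /=; first by rewrite subrr normr0 mul0r.
move=> Px /andP[Py Pp] /andP[xy yp].
rewrite -(subrKA (f y)) (le_trans (ler_normD _ _))// -natr1 mulrDl mul1r addrC.
by apply: lerD; [exact: IH | exact: fb].
Qed.

(** The factor [1 + c^-1] dominates the inverse square root of [c] and keeps the constants rational
    in [c]. *)
Lemma sqr_le_sqr (R : realType) (c a s : R) : 0 < c -> 0 <= s ->
  c * a ^+ 2 <= s ^+ 2 -> `|a| <= (1 + c^-1) * s.
Proof.
move=> c0 s0 cas; have c1 : 0 <= c^-1 by rewrite invr_ge0 ltW.
have k0 : 0 <= (1 + c^-1) * s by rewrite mulr_ge0// addr_ge0.
rewrite -(ger0_norm k0) -ler_sqr ?nnegrE// !real_normK ?num_real//.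
rewrite -(ler_pM2l c0); apply: (le_trans cas).
rewrite exprMn mulrA ler_peMl ?sqr_ge0//.
have -> : c * (1 + c^-1) ^+ 2 = 1 + (1 + c + c^-1).
  by field; rewrite gt_eqF.
by rewrite lerDl !addr_ge0// ltW.
Qed.

Section mesh_estimate.
Context (R : realType) (n : nat) (m : mesh R n.+1) (Om D : set 'rV[R]_n.+1).
Notation cell := {set 'I_(nv m)}.
Implicit Types (T A B : cell) (M : {set cell}) (F : cell * cell).
Variables (h r0 gam th R1 : R) (N K : nat) (MM : {set {set cell}}).
Variable v : dgfun m.
Hypotheses (n12 : n = 1%N \/ n = 2%N) (tri : triangulation m Om).
Hypotheses (h0 : 0 < h) (size : cells_of_size m h) (r00 : 0 < r0).
Hypotheses (fat : cells_fat m (r0 * h)) (oD : open D).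
Hypotheses (gam0 : 0 < gam) (th01 : 0 < th <= 1) (R10 : 0 <= R1).
Hypothesis MM_active : forall M, M \in MM -> {subset M <= active m D}.
Hypothesis MM_cover : forall T, T \in active m D -> exists2 M, M \in MM & T \in M.
Hypothesis MM_large : forall M, M \in MM -> exists TM : cell,
  [/\ TM \in M, gam * h ^+ n.+1 <= volume (region TM `&` D) &
      forall T, T \in M -> exists p : seq cell,
        [/\ path (@face_adj R n.+1 m) TM p, last TM p = T, {subset p <= M} &
            (seq.size p <= N)%N]].

Definition near_cell (x : 'rV[R]_n.+1) (r : R) : pred cell :=
  fun T => `[< forall y, region T y -> `|x - y| <= r >].

(** The nearness conditions confine a chain to distance [r] of [x], so that it draws only on
    energies near [x]. *)
Definition good_link (x : 'rV[R]_n.+1) (r : R) : rel cell := fun A B =>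
  [&& A \in active m D, B \in active m D, @face_adj R n.+1 m A B,
      near_cell x r A, near_cell x r B &
      [exists M in MM, (A \in M) && (B \in M)] ||
      `[< exists2 y, region (A :&: B)%SET y &
          forall z, region (A :&: B)%SET z -> D (y + th *: (z - y)) >] ].

Definition cell_energy T : R :=
  integral_rV (region T `&` D) (fun=> enorm (p1_grad (v T)) ^+ 2).

Definition cut_energy F : R :=
  h^-1 * face_integral (face F) D (fun x => jump v F x ^+ 2).

Definition full_energy F : R :=
  h^-1 * face_integral (face F) setT (fun x => jump v F x ^+ 2) +
  h * face_integral (face F) setT (fun x => enorm (jump_grad v F x) ^+ 2).

(** The share of [T] in the right-hand side: each face is charged to its first element, so that the
    shares add up exactly ([sum_energy]). *)
Definition energy T : R :=
  cell_energy T + \sum_(F in int_faces (active m D) | F.1 == T) cut_energy F +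
  \sum_(M in MM) \sum_(F in int_faces M | F.1 == T) full_energy F.

Lemma face_integral_ge0 (S : cell) (B : set 'rV[R]_n.+1) f :
  (forall x, 0 <= f x) -> 0 <= face_integral S B f.
Proof.
move=> f0; rewrite mulr_ge0 ?sqrtr_ge0//.
by apply: Rintegral_ge0 => t _; exact: f0.
Qed.

Lemma cell_energy_ge0 T : 0 <= cell_energy T.
Proof. by apply: Rintegral_ge0 => t _; exact: sqr_ge0. Qed.

Lemma cut_energy_ge0 F : 0 <= cut_energy F.
Proof.
rewrite mulr_ge0 ?invr_ge0 ?(ltW h0)//.
by apply: face_integral_ge0 => x; exact: sqr_ge0.
Qed.

Lemma full_energy_ge0 F : 0 <= full_energy F.
Proof.
rewrite addr_ge0// mulr_ge0 ?invr_ge0 ?(ltW h0)//;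
  by apply: face_integral_ge0 => x; exact: sqr_ge0.
Qed.

Lemma energy_ge0 T : 0 <= energy T.
Proof.
rewrite !addr_ge0 ?cell_energy_ge0//.
  by apply: sumr_ge0 => F _; exact: cut_energy_ge0.
by apply: sumr_ge0 => M _; apply: sumr_ge0 => F _; exact: full_energy_ge0.
Qed.

Lemma stabE (FF : {set cell * cell}) : stab h FF v = \sum_(F in FF) full_energy F.
Proof. by rewrite /stab big_split !mulr_sumr. Qed.

Lemma int_facesP (A : {set cell}) F : F \in int_faces A ->
  [/\ F.1 \in A, F.2 \in A & @face_adj R n.+1 m F.1 F.2].
Proof. by rewrite inE => /and4P[]. Qed.

Lemma sum_energy : \sum_(T in active m D) energy T =
  grad_norm2 D v + h^-1 * jump_norm2 (int_faces (active m D)) D v +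
  \sum_(M in MM) stab h (int_faces M) v.
Proof.
rewrite (eq_bigr (fun M => \sum_(F in int_faces M) full_energy F)
  (fun M _ => stabE (int_faces M))).
rewrite /energy !big_split/=; congr (_ + _ + _).
  rewrite mulr_sumr [RHS](partition_big (fun F => F.1) (mem (active m D)))//=.
  by move=> F /int_facesP[].
rewrite exchange_big/=; apply: eq_bigr => M MMM.
rewrite [RHS](partition_big (fun F => F.1) (mem (active m D)))//=.
by move=> F /int_facesP[FM _ _]; exact: MM_active FM.
Qed.

Lemma active_cell T : T \in active m D -> T \in cells m.
Proof. by rewrite inE => /andP[]. Qed.

Lemma active_point T : T \in active m D -> exists2 y, region T y & D y.
Proof. by rewrite inE => /andP[_ /asboolP[y [Ty Dy]]]; exists y. Qed.

Lemma cut_energy_le T F : F \in int_faces (active m D) -> F.1 = T ->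
  cut_energy F <= energy T.
Proof.
move=> FA FT; rewrite /energy (bigD1 F)/=; last by rewrite FA FT eqxx.
rewrite -!addrA addrCA lerDl !addr_ge0 ?cell_energy_ge0//.
  by apply: sumr_ge0 => G _; exact: cut_energy_ge0.
by apply: sumr_ge0 => M _; apply: sumr_ge0 => G _; exact: full_energy_ge0.
Qed.

Lemma full_energy_le T F M : M \in MM -> F \in int_faces M -> F.1 = T ->
  full_energy F <= energy T.
Proof.
move=> MMM FM FT.
have H : full_energy F <= \sum_(G in int_faces M | G.1 == T) full_energy G.
  rewrite (bigD1 F)/=; last by rewrite FM FT eqxx.
  by rewrite lerDl; apply: sumr_ge0 => G _; exact: full_energy_ge0.
apply: (le_trans H); rewrite /energy (bigD1 M)//= addrCA lerDl.
rewrite !addr_ge0 ?cell_energy_ge0//.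
- by apply: sumr_ge0 => G _; exact: cut_energy_ge0.
- by apply: sumr_ge0 => M' _; apply: sumr_ge0 => G _; exact: full_energy_ge0.
Qed.

(** The constant of [face_integral_ge] for an inscribed ball of radius [r0 * h], with the power of
    [h] taken out. *)
Definition facet_const : R := (r0 / 2) ^+ n * (th / (4 * n.+1%:R)) ^+ n.+2.

Lemma th_gt0 : 0 < th. Proof. by case/andP: th01. Qed.

Lemma facet_const_gt0 : 0 < facet_const.
Proof.
by rewrite mulr_gt0// exprn_gt0// divr_gt0// ?th_gt0// mulr_gt0// ltr0n.
Qed.

Section facet.
Variables (A B : cell).
Hypotheses (Am : A \in cells m) (AB : @face_adj R n.+1 m A B).

Lemma facet_upper (f : p1 R n.+1) (b : R) :
  (forall x, region (A :&: B)%SET x -> `|p1_eval f x| <= b) ->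
  face_integral (A :&: B)%SET setT (fun x => p1_eval f x ^+ 2) <=
    (n.+1%:R * h) ^+ n * b ^+ 2.
Proof.
have [c cA] := fat Am; have [_ aA] := tri_simplex tri Am.
have rh0 : 0 < r0 * h by rewrite mulr_gt0.
apply: (face_integral_le n12 (eqP AB) (finset.subsetIl A B) aA rh0 cA _ openT).
by move=> x y /regionIl Ax /regionIl Ay; exact: (size Am).
Qed.

Lemma facet_lower (E : set 'rV[R]_n.+1) (f : p1 R n.+1) y : open E ->
  region (A :&: B)%SET y ->
  (forall z, region (A :&: B)%SET z -> E (y + th *: (z - y))) ->
  forall x, region (A :&: B)%SET x ->
    facet_const * h ^+ n * p1_eval f x ^+ 2 <=
    face_integral (A :&: B)%SET E (fun x => p1_eval f x ^+ 2).
Proof.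
move=> oE Iy yE x Ix.
have [c cA] := fat Am; have [_ aA] := tri_simplex tri Am.
have rh0 : 0 < r0 * h by rewrite mulr_gt0.
have sz a b : region (A :&: B)%SET a -> region (A :&: B)%SET b -> `|a - b| <= h.
  by move=> /regionIl Aa /regionIl Ab; exact: (size Am).
have := face_integral_ge n12 (eqP AB) (finset.subsetIl A B) aA rh0 cA sz oE f
  th01 Iy yE Ix.
apply: le_trans; rewrite /facet_const le_eqVlt; apply/orP; left; apply/eqP.
have -> : r0 * h / 2 = r0 / 2 * h by ring.
by rewrite (exprMn n (r0 / 2) h); ring.
Qed.

End facet.

Definition p1_sub (f g : p1 R n.+1) : p1 R n.+1 := (f.1 - g.1, f.2 - g.2).

Lemma p1_eval_sub f g x : p1_eval (p1_sub f g) x = p1_eval f x - p1_eval g x.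
Proof. by rewrite /p1_eval dotvBl /=; ring. Qed.

Lemma jumpE F : (fun x => jump v F x ^+ 2) =
  (fun x => p1_eval (p1_sub (v F.1) (v F.2)) x ^+ 2).
Proof. by apply/funext => x; rewrite p1_eval_sub. Qed.

Lemma p1_eval_cst (c : R) (x : 'rV[R]_n.+1) : p1_eval (0, c) x = c.
Proof. by rewrite /p1_eval /dotv big1 ?add0r// => j _; rewrite mxE mul0r. Qed.

(** The gradient jump is constant on a face; seen as a constant affine function it falls under the
    same facet bounds as the jump of [v]. *)
Lemma jump_gradE F : (fun x => enorm (jump_grad v F x) ^+ 2) =
  (fun x => p1_eval (0, enorm (p1_grad (v F.1) - p1_grad (v F.2))) x ^+ 2).
Proof. by apply/funext => x; rewrite p1_eval_cst. Qed.

Section local.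
Variable x : 'rV[R]_n.+1.

(** If one element of a macro element is within [R1 * h] of [x], all its elements are within this
    many [h]: one path to the large element and one back, each of at most [N.+1] cells. *)
Definition macro_reach : R := R1 + 2 * N.+1%:R.

Definition local_energy : R :=
  \sum_(T in active m D | near_cell x (macro_reach * h) T) energy T.

(** The size of a gradient whose square, over a volume [h ^+ n.+1], accounts for all of the local
    energy. *)
Definition slope : R := Num.sqrt (local_energy / h ^+ n.+1).

Lemma slopeE : slope ^+ 2 * h ^+ n.+1 = local_energy.
Proof.
rewrite sqr_sqrtr ?divfK ?expf_neq0 ?gt_eqF//.
rewrite divr_ge0 ?exprn_ge0 ?(ltW h0)//.
by apply: sumr_ge0 => T _; exact: energy_ge0.
Qed.

Lemma slope_ge0 : 0 <= slope.
Proof. exact: sqrtr_ge0. Qed.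

Lemma energy_le_local T : T \in active m D -> near_cell x (macro_reach * h) T ->
  energy T <= slope ^+ 2 * h ^+ n.+1.
Proof.
move=> TA Tx; rewrite slopeE /local_energy (bigD1 T)/=; last by rewrite TA.
by rewrite lerDl; apply: sumr_ge0 => G _; exact: energy_ge0.
Qed.

Lemma near_cell_reach T : near_cell x (R1 * h) T -> near_cell x (macro_reach * h) T.
Proof.
move=> /asboolP Tx; apply/asboolP => y /Tx /le_trans; apply.
by rewrite ler_wpM2r ?(ltW h0)// /macro_reach lerDl mulr_ge0.
Qed.

Lemma near_macro M A B : M \in MM -> A \in M -> B \in M ->
  near_cell x (R1 * h) A -> near_cell x (macro_reach * h) B.
Proof.
move=> MMM AM BM /asboolP Ax; apply/asboolP => y By.
have Mm C : C \in M -> C \in cells m by move=> /(MM_active MMM)/active_cell.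
have [TM [TMM _ conn]] := MM_large MMM.
have far C a b : C \in M -> region TM a -> region C b -> `|a - b| <= N.+1%:R * h.
  move=> CM Ta Cb; have [p [pp pC pM pN]] := conn _ CM.
  rewrite -pC in Cb; have pm : {subset p <= cells m} by move=> E /pM/Mm.
  apply: (le_trans (face_path_dist (ltW h0) size pp (Mm _ TMM) pm Ta Cb)).
  by rewrite ler_wpM2r ?(ltW h0)// ler_nat.
have [a Aa _] := active_point (MM_active MMM AM).
have [t Tt _] := active_point (MM_active MMM TMM).
have H1 := Ax _ Aa; have H2 := far _ _ _ AM Tt Aa; have H3 := far _ _ _ BM Tt By.
rewrite -(subrKA a) (le_trans (ler_normD _ _))//.
have : `|a - y| <= `|t - a| + `|t - y|.
  by rewrite -(subrKA t) (le_trans (ler_normD _ _))// (distrC a).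
rewrite /macro_reach !mulrDl; lra.
Qed.

Lemma adj_orient (FF : {set cell}) A B : A \in FF -> B \in FF -> A != B ->
  @face_adj R n.+1 m A B -> (A, B) \in int_faces FF \/ (B, A) \in int_faces FF.
Proof.
move=> AF BF neqAB AB; rewrite !inE/= AF BF AB face_adj_sym AB/=.
have : val (enum_rank A) != val (enum_rank B).
  by apply: contra neqAB => /eqP/val_inj/enum_rank_inj ->.
by rewrite neq_ltn => /orP.
Qed.

Lemma face_adj_neq A B : A \in cells m -> @face_adj R n.+1 m A B -> A != B.
Proof.
move=> Am /eqP AB; apply/eqP => E; move: AB; rewrite -E finset.setIid.
by have [-> _] := tri_simplex tri Am => /eqP; rewrite eqn_leq ltnn.
Qed.

(** The full face is available here, so [facet_lower] is used with [setT], where the homothety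
    condition is void. The weights [h] and [h^-1] in front of a face integral of order [h ^+ n]
    produce the scales [slope] and [h * slope]. *)
Lemma macro_facet_le M A B : M \in MM -> A \in M -> B \in M ->
  (forall C, C \in M -> near_cell x (macro_reach * h) C) -> @face_adj R n.+1 m A B ->
  facet_const * enorm (p1_grad (v A) - p1_grad (v B)) ^+ 2 <= slope ^+ 2 /\
  forall y, region (A :&: B)%SET y ->
    facet_const * (p1_eval (v A) y - p1_eval (v B) y) ^+ 2 <= (h * slope) ^+ 2.
Proof.
move=> MMM AM BM Mx AB.
wlog FM : A B AM BM AB / (A, B) \in int_faces M.
  move=> H; have Am : A \in cells m by apply: active_cell; exact: MM_active AM.
  case: (adj_orient AM BM (face_adj_neq Am AB) AB) => [|FM]; first exact: H.
  have BA : @face_adj R n.+1 m B A by rewrite face_adj_sym.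
  have [H1 H2] := H B A BM AM BA FM.
  have E (z : 'rV[R]_n.+1) : enorm (- z) = enorm z.
    by rewrite /enorm /dotv; congr (Num.sqrt _); apply: eq_bigr => j _; rewrite mxE mulrNN.
  split; first by rewrite -E opprB.
  by move=> y; rewrite finset.setIC -opprB sqrrN; exact: H2.
have Am : A \in cells m by apply: active_cell; exact: MM_active AM.
have [y Iy] := face_adj_region AB.
have le1 : full_energy (A, B) <= slope ^+ 2 * h ^+ n.+1.
  apply: (le_trans (full_energy_le MMM FM erefl)); apply: energy_le_local.
    exact: MM_active AM.
  exact: Mx.
have low f z := @facet_lower A B Am AB setT f y openT Iy (fun _ _ => I) z.
have J0 : 0 <= face_integral (face (A, B)) setT (fun x => jump v (A, B) x ^+ 2).
  by apply: face_integral_ge0 => z; exact: sqr_ge0.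
have G0 : 0 <= face_integral (face (A, B)) setT
    (fun x => enorm (jump_grad v (A, B) x) ^+ 2).
  by apply: face_integral_ge0 => z; exact: sqr_ge0.
have hi0 : 0 < h^-1 by rewrite invr_gt0.
split.
  have := low (0, enorm (p1_grad (v A) - p1_grad (v B))) y Iy.
  rewrite -(jump_gradE (A, B)) p1_eval_cst => H.
  have /le_trans /(_ le1) : h * face_integral (face (A, B)) setT
      (fun x => enorm (jump_grad v (A, B) x) ^+ 2) <= full_energy (A, B).
    by rewrite /full_energy lerDr mulr_ge0// ltW.
  have /le_trans H' := ler_wpM2l (ltW h0) H => /H'.
  rewrite (_ : h * _ = facet_const * enorm (p1_grad (v A) - p1_grad (v B)) ^+ 2 * h ^+ n.+1).
    by rewrite ler_pM2r// exprn_gt0.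
  by rewrite (exprS h n); ring.
move=> z Iz; have := low (p1_sub (v A) (v B)) z Iz.
rewrite -(jumpE (A, B)) p1_eval_sub => H.
have /le_trans /(_ le1) : h^-1 * face_integral (face (A, B)) setT
    (fun x => jump v (A, B) x ^+ 2) <= full_energy (A, B).
  by rewrite /full_energy lerDl mulr_ge0// ltW.
have /le_trans H' := ler_wpM2l (ltW hi0) H => /H' {H'}.
rewrite -(ler_pM2l h0) mulrA divff ?gt_eqF// mul1r (exprS h n) => H'.
have hn0 : 0 < h ^+ n by rewrite exprn_gt0.
rewrite -(ler_pM2r hn0); apply: le_trans (le_trans H' _).
  by rewrite le_eqVlt; apply/orP; left; apply/eqP; ring.
by rewrite le_eqVlt; apply/orP; left; apply/eqP; ring.
Qed.

Definition jump_const : R := 1 + facet_const^-1.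
(** [1 + gam^-1] pays for the gradient on the large element, and each of at most [N] facets adds
    [jump_const]. *)
Definition grad_const : R := 1 + gam^-1 + N%:R * jump_const.

Lemma jump_const_ge0 : 0 <= jump_const.
Proof. by rewrite addr_ge0// invr_ge0 ltW// facet_const_gt0. Qed.

Lemma grad_const_ge0 : 0 <= grad_const.
Proof. by rewrite !addr_ge0// ?mulr_ge0 ?jump_const_ge0// invr_ge0 ltW. Qed.

Lemma grad_le A : A \in active m D -> near_cell x (R1 * h) A ->
  `|p1_grad (v A)| <= grad_const * slope.
Proof.
move=> AA Ax; have [M MMM AM] := MM_cover AA.
have Mx C : C \in M -> near_cell x (macro_reach * h) C by move=> CM; exact: (near_macro MMM AM CM Ax).
have [TM [TMM vol conn]] := MM_large MMM.
have TMA := MM_active MMM TMM.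
have h1 : 0 < h ^+ n.+1 by rewrite exprn_gt0.
(* The gradient is constant on [TM], so the cell energy is its square times a volume of at least
   [gam * h ^+ n.+1]. *)
have TMg : `|p1_grad (v TM)| <= (1 + gam^-1) * slope.
  apply: (le_trans (norm_le_enorm _)); rewrite -[leLHS]ger0_norm ?enorm_ge0//.
  apply: sqr_le_sqr slope_ge0 _ => //.
  rewrite -(ler_pM2r h1); apply: le_trans (energy_le_local TMA (Mx _ TMM)).
  apply: (@le_trans _ _ (cell_energy TM)); last first.
    rewrite /energy -addrA lerDl addr_ge0//.
      by apply: sumr_ge0 => F _; exact: cut_energy_ge0.
    by apply: sumr_ge0 => M' _; apply: sumr_ge0 => F _; exact: full_energy_ge0.
  rewrite /cell_energy integral_rV_cst.
    by rewrite mulrAC [leRHS]mulrC ler_wpM2r ?sqr_ge0.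
  have -> : tset (region TM `&` D) = tset (region TM) `&` tset D by [].
  apply: measurableI; last exact: measurable_tset_open.
  by apply: measurable_tset_closed; exact: closed_hull.
have [p [pp pA pM pN]] := conn _ AM.
have := @path_dist_le R 'rV[R]_n.+1 cell (@face_adj R n.+1 m) (mem M)
  (fun C => p1_grad (v C)) (jump_const * slope) TM p.
rewrite pA => H.
have {}H : `|p1_grad (v TM) - p1_grad (v A)| <= N%:R * (jump_const * slope).
  apply: (le_trans (H _ TMM _ pp)).
  - move=> B C BM CM BC; apply: (le_trans (norm_le_enorm _)).
    rewrite -[leLHS]ger0_norm ?enorm_ge0//; apply: sqr_le_sqr.
    + exact: facet_const_gt0.
    + exact: slope_ge0.
    + by have [] := macro_facet_le MMM BM CM Mx BC.
  - by apply/allP => C /pM.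
  - by rewrite ler_wpM2r ?mulr_ge0 ?jump_const_ge0 ?slope_ge0// ler_nat.
rewrite -[p1_grad (v A)](subrK (p1_grad (v TM))) (le_trans (ler_normD _ _))//.
by rewrite distrC /grad_const mulrDl addrC lerD// -mulrA.
Qed.

(** The point [z] need not belong to the facet: the two affine functions are compared at a point [y]
    of the facet and carried to [z] by their gradients. The constant collects [n.+1] for the scalar
    product, 2 for the two gradients and [2 * R1] for the distance. *)
Lemma link_le A B z : good_link x (R1 * h) A B -> `|x - z| <= R1 * h ->
  `|p1_eval (v A) z - p1_eval (v B) z| <=
    (jump_const + 4 * n.+1%:R * grad_const * R1) * (h * slope).
Proof.
move=> /and5P[AA BA AB Ax /andP[Bx good]] xz.
have Am := active_cell AA.
have [y Iy jy] : exists2 y, region (A :&: B)%SET y &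
    `|p1_eval (v A) y - p1_eval (v B) y| <= jump_const * (h * slope).
  have hs0 : 0 <= h * slope by rewrite mulr_ge0 ?slope_ge0 ?ltW.
  have [/existsP[M /and3P[MMM AM BM]]|] := orP good.
    have [y Iy] := face_adj_region AB; exists y => //.
    apply: sqr_le_sqr hs0 _; first exact: facet_const_gt0.
    have Mx C : C \in M -> near_cell x (macro_reach * h) C by move=> CM; exact: (near_macro MMM AM CM Ax).
    by have [_] := macro_facet_le MMM AM BM Mx AB; exact.
  move=> /asboolP[y Iy yD]; exists y => //.
  apply: sqr_le_sqr hs0 _; first exact: facet_const_gt0.
  wlog FM : A B AA BA AB Ax Bx Am Iy yD {good} / (A, B) \in int_faces (active m D).
    move=> H; case: (adj_orient AA BA (face_adj_neq Am AB) AB) => FM; first exact: H.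
    rewrite -opprB sqrrN; apply: (H B A) => //.
    - by rewrite face_adj_sym.
    - exact: active_cell.
    - by rewrite finset.setIC.
    - by rewrite finset.setIC.
  have le1 : cut_energy (A, B) <= slope ^+ 2 * h ^+ n.+1.
    apply: (le_trans (cut_energy_le FM erefl)).
    by apply: energy_le_local => //; exact: near_cell_reach.
  have := facet_lower Am AB (p1_sub (v A) (v B)) oD Iy yD Iy.
  rewrite -(jumpE (A, B)) p1_eval_sub => H.
  have hi0 : 0 < h^-1 by rewrite invr_gt0.
  have /le_trans /(_ le1) := ler_wpM2l (ltW hi0) H.
  rewrite -(ler_pM2l h0) mulrA divff ?gt_eqF// mul1r (exprS h n) => H'.
  have hn0 : 0 < h ^+ n by rewrite exprn_gt0.
  rewrite -(ler_pM2r hn0); apply: le_trans (le_trans H' _).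
    by rewrite le_eqVlt; apply/orP; left; apply/eqP; ring.
  by rewrite le_eqVlt; apply/orP; left; apply/eqP; ring.
have zy : `|z - y| <= 2 * (R1 * h).
  have := asboolP _ Ax => /(_ _ (regionIl Iy)) xy.
  rewrite -(subrKA x) (le_trans (ler_normD _ _))// distrC; lra.
have -> : p1_eval (v A) z - p1_eval (v B) z = (p1_eval (v A) y - p1_eval (v B) y) +
    dotv ((v A).1 - (v B).1) (z - y).
  by rewrite dotvBl -!p1_evalB; ring.
rewrite (le_trans (ler_normD _ _))// mulrDl lerD//.
apply: (le_trans (normr_dotv_le _ _)).
have gA := grad_le AA Ax; have gB := grad_le BA Bx.
apply: (@le_trans _ _ (n.+1%:R * (2 * (grad_const * slope)) * (2 * (R1 * h)))).
  apply: ler_pM => //.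
  rewrite ler_wpM2l// (le_trans (ler_normB _ _))//.
  by move: gA gB; rewrite /p1_grad; lra.
by rewrite le_eqVlt; apply/orP; left; apply/eqP; ring.
Qed.

Definition face_const : R :=
  n.+1%:R ^+ n * ((K%:R * (jump_const + 4 * n.+1%:R * grad_const * R1)) ^+ 2 + (2 * n.+1%:R * grad_const) ^+ 2).

(** At a fixed point [z] of the face the differences of traces telescope along the chain, while the
    gradient jump is bounded by the two gradients separately. *)
Lemma full_energy_le_local A B :
  (#|[set T in active m D | near_cell x (R1 * h) T]%SET| <= K)%N ->
  @face_adj R n.+1 m A B -> A \in active m D -> connect (good_link x (R1 * h)) A B ->
  full_energy (A, B) <= face_const * local_energy /\ near_cell x (R1 * h) A.
Proof.
move=> cK AB AA cAB; have Am := active_cell AA.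
have neqAB := face_adj_neq Am AB.
have [Ax Bx BA] : [/\ near_cell x (R1 * h) A, near_cell x (R1 * h) B & B \in active m D].
  have [p] := connectP cAB; case/lastP: p => [|p C]; first by move=> _ E; rewrite E eqxx in neqAB.
  move=> pp E; split.
  - by case: p pp {E} => [|C' p] /= /andP[/and5P[]].
  - move: pp; rewrite rcons_path => /andP[_ /and5P[_ _ _ _ /andP[]]].
    by rewrite last_rcons in E; rewrite E.
  - move: pp; rewrite rcons_path => /andP[_ /and5P[_ ? _ _ _]].
    by rewrite last_rcons in E; rewrite E.
split=> //.
have b0 : 0 <= jump_const + 4 * n.+1%:R * grad_const * R1.
  by rewrite addr_ge0 ?jump_const_ge0// !mulr_ge0// grad_const_ge0.
set b := jump_const + _ in b0 *.
have hs0 : 0 <= h * slope by rewrite mulr_ge0 ?slope_ge0 ?ltW.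
have jmp z : region (A :&: B)%SET z ->
    `|p1_eval (p1_sub (v A) (v B)) z| <= K%:R * (b * (h * slope)).
  move=> Iz; rewrite p1_eval_sub.
  have xz : `|x - z| <= R1 * h by have /asboolP := Ax; apply; exact: regionIl Iz.
  (* A chain without repetition has at most as many links as there are active cells near [x], hence
     at most [K]. *)
  have [p pp E] := connectP cAB; case/shortenP: pp E => q qq uq _ E.
  have := @path_dist_le R R cell (good_link x (R1 * h)) predT
    (fun C => p1_eval (v C) z) (b * (h * slope)) A q.
  rewrite -E => H; apply: (le_trans (H _ isT (all_predT _) qq)).
    by move=> C C' _ _ CC'; exact: link_le.
  apply: ler_wpM2r; first by rewrite mulr_ge0.
  rewrite ler_nat (leq_trans _ cK)//.
  have uq' : uniq q by move: uq; rewrite /= => /andP[].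
  rewrite -(card_uniqP uq'); apply/subset_leq_card/fintype.subsetP => C Cq.
  rewrite !inE; elim: q A qq Cq {H E uq uq' AB AA cAB Am neqAB Ax Iz} => //= C' q IH A.
  move=> /andP[/and5P[_ C'A _ _ /andP[C'x _]] C'q]; rewrite inE => /orP[/eqP ->|].
    by rewrite C'x andbT -in_setE; move: C'A; rewrite !inE.
  exact: IH C'q.
have grd : enorm (p1_grad (v A) - p1_grad (v B)) <= 2 * n.+1%:R * grad_const * slope.
  have gA := grad_le AA Ax; have gB := grad_le BA Bx.
  apply: (le_trans (enorm_le_norm _)).
  apply: (@le_trans _ _ (n.+1%:R * (2 * (grad_const * slope)))).
    by rewrite ler_wpM2l// (le_trans (ler_normB _ _))//; lra.
  by rewrite le_eqVlt; apply/orP; left; apply/eqP; ring.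
rewrite -slopeE /full_energy jumpE jump_gradE.
have U1 := facet_upper Am AB jmp.
have U2 : face_integral (A :&: B)%SET setT (fun x =>
    p1_eval (0, enorm (p1_grad (v A) - p1_grad (v B))) x ^+ 2) <=
    (n.+1%:R * h) ^+ n * (2 * n.+1%:R * grad_const * slope) ^+ 2.
  apply: (facet_upper Am AB) => z _; rewrite p1_eval_cst.
  by rewrite ger0_norm ?enorm_ge0.
have hi0 : 0 <= h^-1 by rewrite invr_ge0 ltW.
apply: (le_trans (lerD (ler_wpM2l hi0 U1) (ler_wpM2l (ltW h0) U2))).
rewrite le_eqVlt; apply/orP; left; apply/eqP.
rewrite /face_const -/b (exprMn n n.+1%:R h) (exprS h n); field.
by rewrite gt_eqF.
Qed.

End local.

Hypothesis few_near : forall x (S : {set cell}),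
  (forall T, T \in S -> T \in cells m /\
    exists2 y, region T y & `|x - y| <= (2 * macro_reach + 2) * h) -> (#|S| <= K)%N.
Hypothesis linked : forall A B, A \in active m D -> B \in active m D ->
  @face_adj R n.+1 m A B -> exists x, connect (good_link x (R1 * h)) A B.

(** The centre [x] of a chain depends on the face; this relation no longer mentions it and can be
    counted from the side of [T]. *)
Definition nearby (A T : cell) : bool := `[< exists a t,
  [/\ region A a, region T t & `|a - t| <= 2 * macro_reach * h] >].

Lemma macro_reach_ge0 : 0 <= macro_reach.
Proof. by rewrite addr_ge0// mulr_ge0. Qed.

Lemma full_energy_le_nearby F : F \in int_faces (active m D) ->
  full_energy F <= face_const * \sum_(T in active m D | nearby F.1 T) energy T.
Proof.
move=> /int_facesP[]; case: F => A B /= AA BA AB.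
have [x cAB] := linked AA BA AB.
have R20 := macro_reach_ge0.
have [|le1 Ax] := full_energy_le_local _ AB AA cAB.
  apply: (few_near (x := x)) => T; rewrite !inE -andbA => /and3P[Tm /asboolP[y [Ty _]] /asboolP Tx].
  split=> //; exists y => //; apply: (le_trans (Tx _ Ty)).
  rewrite ler_wpM2r ?(ltW h0)//; have : R1 <= macro_reach by rewrite lerDl mulr_ge0.
  lra.
apply: (le_trans le1); rewrite ler_wpM2l//.
  rewrite mulr_ge0 ?exprn_ge0// addr_ge0 ?sqr_ge0//.
rewrite /local_energy !big_mkcondr; apply: ler_sum => T TA.
case: ifPn => [/asboolP Tx|_]; last by case: ifP => _; rewrite ?energy_ge0.
suff -> : nearby A T by [].
have [a Aa _] := active_point AA; have [t Tt _] := active_point TA.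
apply/asboolP; exists a, t; split => //.
have /asboolP Ax' := near_cell_reach Ax.
rewrite -(subrKA x) (le_trans (ler_normD _ _))// distrC.
by have := Ax' _ Aa; have := Tx _ Tt; lra.
Qed.

(** A face is a pair of cells, both within [(2 * macro_reach + 2) * h] of a point of [T]: beyond the
    distance in [nearby], one [h] is spent inside [T] and one across the first cell of the face. *)
Lemma card_nearby T : T \in active m D ->
  (#|[set F in int_faces (active m D) | nearby F.1 T]%SET| <= K * K)%N.
Proof.
move=> TA; have [t Tt _] := active_point TA.
pose S : {set cell} := [set A in active m D | `[< exists2 y, region A y &
  `|t - y| <= (2 * macro_reach + 2) * h >] ]%SET.
have SK : (#|S| <= K)%N.
  apply: (few_near (x := t)) => A; rewrite inE => /andP[/active_cell Am /asboolP[y Ay ty]].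
  by split => //; exists y.
apply: (leq_trans _ (leq_mul SK SK)); rewrite -cardsX.
apply/subset_leq_card/fintype.subsetP => -[A B]; rewrite inE => /andP[].
move=> /int_facesP[/= AA BA AB] /asboolP[a [t' [Aa Tt' at']]].
have Tm := active_cell TA; have Am := active_cell AA.
have tt' := size Tm Tt Tt'.
have ta : `|t - a| <= (2 * macro_reach + 1) * h.
  by rewrite -(subrKA t') (le_trans (ler_normD _ _))// (distrC t'); lra.
have [b ABb] := face_adj_region AB.
have ab := size Am Aa (regionIl ABb).
rewrite !inE /=; move: AA BA; rewrite !inE => -> -> /=.
apply/andP; split; apply/asboolP.
  by exists a => //; move: (h0); lra.
exists b; first exact: regionIr ABb.
by rewrite -(subrKA a) (le_trans (ler_normD _ _))//; lra.
Qed.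

(** Double counting: after exchanging the sums, each element is used by at most [K * K] faces. *)
Lemma stab_le_energy : stab h (int_faces (active m D)) v <=
  face_const * (K * K)%:R * \sum_(T in active m D) energy T.
Proof.
rewrite stabE.
apply: (@le_trans _ _ (\sum_(F in int_faces (active m D))
    face_const * \sum_(T in active m D | nearby F.1 T) energy T)).
  by apply: ler_sum => F; exact: full_energy_le_nearby.
rewrite -mulr_sumr -mulrA ler_wpM2l//.
  by rewrite mulr_ge0 ?exprn_ge0// addr_ge0 ?sqr_ge0.
under eq_bigr do rewrite big_mkcondr.
rewrite exchange_big/= mulr_sumr; apply: ler_sum => T TA.
rewrite -big_mkcondr/= sumr_const -[X in X <= _]mulr_natl.
apply: ler_wpM2r; first exact: energy_ge0.
rewrite ler_nat.
by apply: leq_trans (card_nearby TA); rewrite cardsE.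
Qed.

End mesh_estimate.

(** * Existence of chains of good links *)

(** A ball around [y] contracted towards [z] stays in [A], even when [z] is on the boundary. This
    serves the faces that touch the boundary of the polytope. *)
Lemma convex_interior_star (R : realType) (d : nat) (A : set 'rV[R]_d)
    (y z : 'rV[R]_d) (t : R) : convex A -> A° y -> A z -> 0 <= t < 1 ->
  A° (y + t *: (z - y)).
Proof.
move=> cA Ay Az /andP[t0 t1].
have [r r0 yr] := open_ballP (@open_interior _ A) Ay.
have E : y + t *: (z - y) = z + (1 - t) *: (y - z).
  by apply/rowP => j; rewrite !mxE; ring.
have rt : 0 < (1 - t) * r by rewrite mulr_gt0// subr_gt0.
apply: (interior_ballP rt) => w; rewrite E.
apply: (convex_ball_contract cA Az) => [u /yr|]; first exact: interior_subset.
by apply/andP; split; lra.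
Qed.

Section linking.
Context (R : realType) (n : nat) (m : mesh R n.+1).
Notation cell := {set 'I_(nv m)}.
Implicit Types (T A B : cell) (M : {set cell}) (x y z : 'rV[R]_n.+1).
Variables (Om D D' G : set 'rV[R]_n.+1).
Variables (h r0 gam rho L e0 R1 : R) (N : nat) (MM : {set {set cell}}).
Hypotheses (oOm : open Om) (cOm : convex Om).
Hypothesis star : forall y z (t : R), Om y -> closure Om z -> 0 <= t < 1 ->
  Om (y + t *: (z - y)).
Hypotheses (oD : open D) (oD' : open D') (DD' : D `&` D' = set0).
Hypotheses (DOm : D `<=` Om) (Omcover : Om `<=` D `|` G `|` D').
Hypothesis coneG : forall x0, G x0 -> cone_property D x0 e0 L.
Hypotheses (L0 : 0 <= L) (rho01 : 0 < rho <= 1).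
Hypothesis deep : forall (E : set 'rV[R]_n.+1) (x0 c : 'rV[R]_n.+1) (e k : R),
  cone_property D x0 e L -> E `<=` D -> measurable (tset E) -> 0 < k ->
  (forall x, E x -> `|x - c| <= k) -> `|x0 - c| + 2 * k < e ->
  gam * k ^+ n.+1 <= volume E ->
  exists2 x, E x & forall y, `|x - y| < rho * k -> D y.
Hypotheses (tri : triangulation m Om) (h0 : 0 < h) (size : cells_of_size m h).
Hypotheses (r00 : 0 < r0) (fat : cells_fat m (r0 * h)).
Hypothesis MM_active : forall M, M \in MM -> {subset M <= active m D}.
Hypothesis MM_cover : forall T, T \in active m D -> exists2 M, M \in MM & T \in M.
Hypothesis MM_large : forall M, M \in MM -> exists TM : cell,
  [/\ TM \in M, gam * h ^+ n.+1 <= volume (region TM `&` D) &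
      forall T, T \in M -> exists p : seq cell,
        [/\ path (@face_adj R n.+1 m) TM p, last TM p = T, {subset p <= M} &
            (seq.size p <= N)%N]].

(* In units of [h]: the size of a macro element, and that of the two cones up to
   their common top. *)
Definition macro_radius : R := 2 * N.+1%:R + 1.
Definition tube_radius : R := (1 + L) * macro_radius + 1.
Hypothesis R1t : tube_radius + 1 <= R1.
Hypothesis he0 : (tube_radius + 5) * h < e0.

(** The ratio [rho / 4] moves a point of the crossing region by at most [rho * h / 4], less than the
    margin [rho * h / 2] of [cone_tube_ball]. *)
Local Notation good x := (@good_link R n m D (rho / 4) MM x (R1 * h)).

Lemma macro_radius_ge3 : 3 <= macro_radius.
Proof. by have : (1 : R) <= N.+1%:R by [rewrite ler1n]; rewrite /macro_radius; lra. Qed.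

Lemma macro_radius_lt_tube : macro_radius + 1 <= tube_radius.
Proof. by rewrite lerD2r ler_peMl ?lerDl// (le_trans _ macro_radius_ge3). Qed.

Lemma good_linkC x A B : good x A B -> good x B A.
Proof.
move=> /and5P[AA BA AB Ax /andP[Bx H]].
rewrite /good_link AA BA face_adj_sym AB Ax Bx /= finset.setIC.
case/orP: H => [/existsP[M /and3P[MM' AM BM]]|->]; last by rewrite orbT.
by apply/orP; left; apply/existsP; exists M; rewrite MM' AM BM.
Qed.

Lemma connect_good_sym x : connect_sym (good x).
Proof. by apply: sym_connect_sym => A B; apply/idP/idP; exact: good_linkC. Qed.

Lemma cell_contains_ball T : T \in cells m -> exists (c : 'rV[R]_n.+1) (r : R),
  0 < r /\ forall y, `|c - y| < r -> region T y.
Proof. by move=> /fat[c cT]; exists c, (r0 * h); rewrite mulr_gt0. Qed.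

(** The crossing point in [U] serves as the centre of the homothety, the rest of the facet being
    within [h] of it and in the closure of [Om]. *)
Lemma crossing_good x (U : set 'rV[R]_n.+1) (r : R) A B : U `<=` D ->
  (forall y, U y -> `|x - y| <= r * h) -> r + 1 <= R1 ->
  (forall y z, U y -> `|y - z| <= h -> closure Om z ->
    D (y + (rho / 4) *: (z - y))) ->
  crossing U A B -> good x A B.
Proof.
move=> UD Ur rR UB /and4P[Am Bm AB /asboolP[y [Iy Uy]]].
have near C : C \in cells m -> region C y -> near_cell x (R1 * h) C.
  move=> Cm Cy; apply/asboolP => z Cz.
  rewrite -(subrKA y) (le_trans (ler_normD _ _))//.
  have := Ur _ Uy; have := size Cm Cy Cz.
  have : (r + 1) * h <= R1 * h by rewrite ler_wpM2r// ltW.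
  lra.
have act C : C \in cells m -> region C y -> C \in active m D.
  by move=> Cm Cy; rewrite inE Cm; apply/asboolP; exists y; split => //; exact: UD.
have Ay := regionIl Iy; have By := regionIr Iy.
rewrite /good_link act// act// AB near// near//=; apply/orP; right.
apply/asboolP; exists y => // z Iz; apply: UB => //.
  by apply: (size Am) => //; exact: regionIl Iz.
by rewrite (tri_cover tri); exists A => //; exact: regionIl Iz.
Qed.

Lemma connect_good x (U : set 'rV[R]_n.+1) (r : R) A B : open U -> convex U ->
  U `<=` D -> (forall y, U y -> `|x - y| <= r * h) -> r + 1 <= R1 ->
  (forall y z, U y -> `|y - z| <= h -> closure Om z ->
    D (y + (rho / 4) *: (z - y))) ->
  A \in cells m -> B \in cells m -> region A `&` U !=set0 ->
  region B `&` U !=set0 -> connect (good x) A B.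
Proof.
move=> oU cU UD Ur rR UB Am Bm AU BU.
have sub : subrel (crossing U) (connect (good x)).
  by move=> C C' CC'; apply: connect1; exact: (crossing_good UD Ur rR UB CC').
apply: (connect_sub sub); apply: (connect_crossing tri cell_contains_ball) => //.
by move=> y /UD/DOm; exact: subset_closure.
Qed.

Lemma linked_far x A B : A \in active m D -> B \in active m D ->
  region A x -> region B x -> (forall z, G z -> 3 * h <= `|x - z|) ->
  connect (good x) A B.
Proof.
move=> AA BA Ax Bx far.
have Am := active_cell AA; have Bm := active_cell BA.
have [a Aa Da] := active_point AA; have [b Bb Db] := active_point BA.
(* [W] is convex, avoids [G] and contains a point of [D], hence lies in [D]. *)
pose W : set 'rV[R]_n.+1 := Om `&` [set y | `|x - y| < 3 * h].
have WD : W `<=` D.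
  move=> y Wy; apply: (segment_same_side oD oD' DD' Da) => t t01.
  have Wa : W a.
    split; first exact: DOm.
    by rewrite /=; have := size Am Ax Aa; move: (h0); lra.
  have cW : convex W by apply: convexI => //; exact: convex_normball.
  have [Ot xt] := cW _ _ Wa Wy t t01.
  have [[]|] := Omcover Ot; [by left|move=> /far|by right].
  by rewrite leNgt => /negP; case.
have th1 : 0 <= rho / 4 < 1 by case/andP: rho01 => ? ?; apply/andP; split; lra.
(* The chain crosses the smaller ball, so that the homothetic copies, which move points by at most
   [h], remain in [W]. *)
pose U : set 'rV[R]_n.+1 := Om `&` [set y | `|x - y| < 2 * h].
apply: (@connect_good x U 2) => //.
- by apply: openI => //; exact: open_normball.
- by apply: convexI => //; exact: convex_normball.
- by move=> y [Oy xy]; apply: WD; split => //=; move: xy (h0) => /=; lra.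
- by move=> y [_ /ltW].
- by have := macro_radius_ge3; have := macro_radius_lt_tube; have := R1t; lra.
- move=> y z [Oy /= xy] yz clz; apply: WD; split; first exact: star.
  rewrite /= opprD addrA (le_lt_trans (ler_normB _ _))// normrZ ger0_norm.
    rewrite distrC in yz; case/andP: rho01 => r1 r2.
    have : rho / 4 * `|z - y| <= 1 * h by rewrite ler_pM//; lra.
    lra.
  by case/andP: th1.
- by exists a; split => //; split; [exact: DOm|have := size Am Ax Aa; move: (h0) => /=; lra].
- by exists b; split => //; split; [exact: DOm|have := size Bm Bx Bb; move: (h0) => /=; lra].
Qed.

Lemma macro_dist M A x : M \in MM -> A \in M -> region A x ->
  forall B y, B \in M -> region B y -> `|x - y| <= macro_radius * h.
Proof.
move=> MMM AM Ax B y BM By.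
have Mm C : C \in M -> C \in cells m by move=> /(MM_active MMM)/active_cell.
have [TM [TMM _ conn]] := MM_large MMM.
have far C a b : C \in M -> region TM a -> region C b -> `|a - b| <= N.+1%:R * h.
  move=> CM Ta Cb; have [p [pp pC pM pN]] := conn _ CM.
  rewrite -pC in Cb; have pm : {subset p <= cells m} by move=> E /pM/Mm.
  apply: (le_trans (face_path_dist (ltW h0) size pp (Mm _ TMM) pm Ta Cb)).
  by rewrite ler_wpM2r ?(ltW h0)// ler_nat.
have [t Tt _] := active_point (MM_active MMM TMM).
have H2 := far _ _ _ AM Tt Ax; have H3 := far _ _ _ BM Tt By.
rewrite -(subrKA t) (le_trans (ler_normD _ _))// distrC /macro_radius mulrDl.
by move: (h0); lra.
Qed.

Lemma macro_connect x M A TM : M \in MM -> A \in M -> region A x -> TM \in M ->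
  (exists p, [/\ path (@face_adj R n.+1 m) TM p, last TM p = A & {subset p <= M}]) ->
  connect (good x) TM A.
Proof.
move=> MMM AM Ax TMM [p [pp <- pM]].
have near C : C \in M -> near_cell x (R1 * h) C.
  move=> CM; apply/asboolP => y Cy.
  apply: (le_trans (macro_dist MMM AM Ax CM Cy)).
  by rewrite ler_wpM2r ?(ltW h0)//; have := macro_radius_lt_tube; have := R1t; lra.
elim: p TM TMM pp pM => [|C p IH] T TM /=; first by rewrite connect0.
move=> /andP[TC Cp] pM.
have CM : C \in M by apply: pM; rewrite mem_head.
apply: (connect_trans (y := C)); last first.
  by apply: IH => // E Ep; apply: pM; rewrite inE Ep orbT.
apply: connect1; rewrite /good_link (MM_active MMM TM) (MM_active MMM CM) TC.
rewrite near// near//=; apply/orP; left; apply/existsP; exists M.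
by rewrite MMM TM CM.
Qed.

Section near_interface.
Variables (x0 x : 'rV[R]_n.+1) (j : 'I_n.+1) (s : R).
Hypotheses (x0x : `|x0 - x| < 3 * h) (s1 : `|s| = 1).
Hypothesis coneD : forall y z, D y -> `|x0 - y| < e0 -> `|x0 - z| < e0 ->
  cone j s L (z - y) -> D z.

(** Only half of the ball around [a] is thickened by the cone; the other half is kept as margin. *)
Definition cone_tube (a : 'rV[R]_n.+1) : set 'rV[R]_n.+1 :=
  [set y | exists2 w : 'rV[R]_n.+1, `|w| < rho * h / 2 & cone j s L (y - (a + w))] `&`
  [set y | `|x - y| < tube_radius * h].

Lemma open_cone_tube a : open (cone_tube a).
Proof.
apply: openI; last exact: open_normball.
apply: open_by_balls => y [w wr wc]; exists (rho * h / 2 - `|w|).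
  by rewrite subr_gt0.
move=> z yz; exists (w + (z - y)).
  rewrite (le_lt_trans (ler_normD _ _))// distrC; lra.
by rewrite (_ : z - (a + (w + (z - y))) = y - (a + w))//; apply/rowP => i;
  rewrite !mxE; ring.
Qed.

Lemma convex_cone_tube a : convex (cone_tube a).
Proof.
apply: convexI; last exact: convex_normball.
move=> y z [w wr wc] [u ur uc] t t01; exists (w + t *: (u - w)).
  have := @convex_normball R n.+1 0 (rho * h / 2) w u.
  by rewrite /= !sub0r !normrN => /(_ wr ur t t01); rewrite sub0r normrN.
have -> : y + t *: (z - y) - (a + (w + t *: (u - w))) =
    (y - (a + w)) + t *: ((z - (a + u)) - (y - (a + w))).
  by apply/rowP => i; rewrite !mxE; ring.
exact: convex_cone.
Qed.

(** The displacement [z - y] is absorbed by the starting point in the ball around [a], the cone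
    vector being unchanged. *)
Lemma cone_tube_ball (a y z : 'rV[R]_n.+1) : (forall y : 'rV[R]_n.+1, `|a - y| < rho * h -> D y) ->
  `|x - a| <= macro_radius * h -> cone_tube a y -> `|y - z| < rho * h / 2 -> D z.
Proof.
move=> aD xa [[w wr wc] xy] yz; case/andP: rho01 => r1 r2.
have rh : rho * h <= h by rewrite ler_piMl// ltW.
have rh0 : 0 < rho * h by rewrite mulr_gt0.
have wz : `|w + (z - y)| < rho * h.
  by rewrite (le_lt_trans (ler_normD _ _))// distrC; lra.
have := he0; rewrite mulrDl => he.
have mt : (macro_radius + 1) * h <= tube_radius * h by rewrite ler_wpM2r ?(ltW h0)// macro_radius_lt_tube.
apply: (coneD (y := a + (w + (z - y)))).
- by apply: aD; rewrite opprD addNKr normrN.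
- rewrite opprD addrA (le_lt_trans (ler_normB _ _))//.
  have : `|x0 - a| <= `|x0 - x| + `|x - a|.
    by rewrite -(subrKA x) (le_trans (ler_normD _ _)).
  by move: (h0) (x0x); lra.
- have H1 : `|x0 - z| <= `|x0 - y| + `|y - z|.
    by rewrite -(subrKA y) (le_trans (ler_normD _ _)).
  have H2 : `|x0 - y| <= `|x0 - x| + `|x - y|.
    by rewrite -(subrKA x) (le_trans (ler_normD _ _)).
  by move: xy (h0) (x0x) => /=; lra.
- by rewrite (_ : z - (a + (w + (z - y))) = y - (a + w))//; apply/rowP => i;
    rewrite !mxE; ring.
Qed.

(** It depends on [x], [j] and [s] but not on [a], hence is common to the tubes of both macro
    elements. At height [(1 + L) * macro_radius * h], a loss of [macro_radius * h] still leaves [L]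
    times the largest lateral distance. *)
Definition cone_top : 'rV[R]_n.+1 :=
  x + (s * ((1 + L) * macro_radius * h)) *: delta_mx 0 j.

Lemma cone_tube_top (a : 'rV[R]_n.+1) : `|x - a| <= macro_radius * h -> cone_tube a cone_top.
Proof.
move=> xa; case/andP: rho01 => r1 r2.
have Rm0 : 0 <= macro_radius by rewrite (le_trans _ macro_radius_ge3).
have t0 : 0 <= (1 + L) * macro_radius * h by rewrite !mulr_ge0 ?addr_ge0// ltW.
split.
  exists 0; first by rewrite normr0 divr_gt0// mulr_gt0.
  rewrite addr0.
  have xi i : `|x 0 i - a 0 i| <= macro_radius * h.
    by rewrite -coordB (le_trans (coord_le_norm _ _)).
  have ss : s * s = 1 by rewrite -expr2 -real_normK ?num_real// s1 expr1n.
  have H1 : L * (macro_radius * h) <= s * (cone_top - a) 0 j.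
    rewrite !mxE !eqxx /= mulr1.
    have := normr_sg_mul (x 0 j - a 0 j) s1; have := xi j => H2 H3.
    rewrite (_ : s * _ = s * s * ((1 + L) * macro_radius * h) + s * (x 0 j - a 0 j)); last by ring.
    by rewrite ss; lra.
  split; first by apply: le_trans H1; rewrite !mulr_ge0// ltW.
  move=> k; apply: le_trans H1; rewrite ler_wpM2l//.
  by rewrite !mxE [lift j k == j]eq_sym eq_liftF andbF mulr0 addr0.
rewrite /= opprD addNKr normrN.
have H : (1 + L) * macro_radius * h < tube_radius * h by rewrite ltr_pM2r// /tube_radius ltrDl.
apply: norm_lt_coord => [|k]; first exact: le_lt_trans H.
rewrite !mxE eqxx/= normrM normrM s1 mul1r (ger0_norm t0).
case: eqP => _; rewrite ?normr1 ?normr0 ?mulr0 ?mulr1//.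
exact: le_lt_trans H.
Qed.

Lemma cone_tube_apex (a : 'rV[R]_n.+1) : `|x - a| <= macro_radius * h -> cone_tube a a.
Proof.
move=> xa; case/andP: rho01 => r1 r2; split.
  exists 0; first by rewrite normr0 divr_gt0// mulr_gt0.
  by rewrite addr0 subrr; split=> [|k]; rewrite !mxE mulr0// normr0 mulr0.
rewrite /=; apply: (le_lt_trans xa); rewrite ltr_pM2r//.
by have := macro_radius_lt_tube; lra.
Qed.

Lemma connect_cone_tube (a : 'rV[R]_n.+1) A B : (forall y : 'rV[R]_n.+1, `|a - y| < rho * h -> D y) ->
  `|x - a| <= macro_radius * h -> A \in cells m -> B \in cells m ->
  region A `&` cone_tube a !=set0 -> region B `&` cone_tube a !=set0 ->
  connect (good x) A B.
Proof.
move=> aD xa Am Bm AU BU; case/andP: rho01 => r1 r2.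
have rh0 : 0 < rho * h by rewrite mulr_gt0.
apply: (@connect_good x (cone_tube a) tube_radius) => //.
- exact: open_cone_tube.
- exact: convex_cone_tube.
- by move=> y ay; apply: (cone_tube_ball aD xa ay); rewrite subrr normr0 divr_gt0.
- by move=> y [_ /ltW].
- move=> y z ay yz _; apply: (cone_tube_ball aD xa ay).
  rewrite opprD addNKr normrN normrZ ger0_norm ?divr_ge0 ?(ltW r1)// distrC.
  have := ler_wpM2l (ltW r1) yz; lra.
Qed.

End near_interface.

(** The chain goes from [A] to the large element of its macro element, up its tube to the cell
    containing the top, down the other tube, and back to [B]. Both tubes use the cone at [x0], hence
    the same axis. *)
Lemma linked_near x x0 A B : A \in active m D -> B \in active m D ->
  region A x -> region B x -> G x0 -> `|x0 - x| < 3 * h -> connect (good x) A B.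
Proof.
move=> AA BA Ax Bx Gx0 x0x.
have cD := coneG Gx0; have [j [s [s1 coneD]]] := cD.
have branch C : C \in active m D -> region C x -> exists TM a,
    [/\ TM \in cells m, connect (good x) TM C, region TM a,
        forall y, `|a - y| < rho * h -> D y & `|x - a| <= macro_radius * h].
  move=> CA Cx; have [M MMM CM] := MM_cover CA.
  have [TM [TMM vol conn]] := MM_large MMM.
  have TMA := MM_active MMM TMM; have TMm := active_cell TMA.
  have [c Tc _] := active_point TMA.
  have xc := macro_dist MMM CM Cx TMM Tc.
  have [||||||a [Ta Da] aD] := @deep (region TM `&` D) x0 c e0 h cD.
  - by move=> y [].
  - have -> : tset (region TM `&` D) = tset (region TM) `&` tset D by [].
    apply: measurableI; last exact: measurable_tset_open.
    by apply: measurable_tset_closed; exact: closed_hull.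
  - by [].
  - by move=> y [Ty _]; exact: (size TMm).
  - have : `|x0 - c| <= `|x0 - x| + `|x - c|.
      by rewrite -(subrKA x) (le_trans (ler_normD _ _)).
    have := he0; have : (macro_radius + 1) * h <= tube_radius * h.
      by rewrite ler_wpM2r ?(ltW h0)// macro_radius_lt_tube.
    by move: (h0) (x0x); lra.
  - by [].
  exists TM, a; split => //; last exact: macro_dist MMM CM Cx _ _ TMM Ta.
  apply: (macro_connect MMM CM Cx TMM).
  by have [p [pp pC pM _]] := conn _ CM; exists p.
have [TA [a [TAm TAc TAa aD xa]]] := branch _ AA Ax.
have [TB [b [TBm TBc TBb bD xb]]] := branch _ BA Bx.
have top_a := cone_tube_top j s1 xa.
have top_b := cone_tube_top j s1 xb.
pose z := cone_top x j s.
have [C Cm Cz] : exists2 C, C \in cells m & region C z.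
  have : closure Om z.
    apply/subset_closure/DOm/(cone_tube_ball x0x coneD aD xa top_a).
    by case/andP: rho01 => r1 _; rewrite subrr normr0 divr_gt0// mulr_gt0.
  by rewrite (tri_cover tri).
apply: (connect_trans (y := TA)); first by rewrite connect_good_sym.
apply: (connect_trans (y := C)).
  apply: (connect_cone_tube x0x coneD aD xa) => //; last by exists z.
  by exists a; split => //; exact: cone_tube_apex.
apply: connect_trans TBc.
apply: (connect_cone_tube x0x coneD bD xb) => //; first by exists z.
by exists b; split => //; exact: cone_tube_apex.
Qed.

Lemma adjacent_cells_linked A B : A \in active m D -> B \in active m D ->
  @face_adj R n.+1 m A B -> exists x, connect (good x) A B.
Proof.
move=> AA BA AB; have [x ABx] := face_adj_region AB; exists x.
have Ax := regionIl ABx; have Bx := regionIr ABx.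
have [[x0 [Gx0 x0x]]|far] := pselect (exists x0, G x0 /\ `|x0 - x| < 3 * h).
  exact: linked_near Gx0 x0x.
apply: linked_far => // z Gz; rewrite leNgt; apply/negP => xz; apply: far.
by exists z; rewrite distrC.
Qed.

End linking.

(** * Uniform estimate *)

Section interface_geometry.
Context (R : realType) (n : nat) (Om Om0 Om1 Om2 : set 'rV[R]_n.+1) (delta0 : R).
Hypothesis geo : interface_geometry Om Om0 Om1 Om2 delta0.

Lemma interface_local_cone (D D' : set 'rV[R]_n.+1) x0 :
  open D -> open D' -> D `&` D' = set0 -> Om0 `&` D = set0 -> Om0 `&` D' = set0 ->
  Om `<=` D `|` Om0 `|` D' -> (forall x, Om0 x -> closure D' x) -> Om0 x0 ->
  exists e L : R, [/\ 0 < e, 0 <= L & cone_property D x0 e L].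
Proof.
move=> oD oD' DD' GD GD' cover clD' Gx0.
have [_ /(_ _ Gx0)[U [j [g [oU Ux0 sg graph]]]]] := ig_interface geo.
have d0 := ig_delta0 geo.
(* The chart is cut down so that it lies in the tubular neighborhood, hence in [Om]; [n.+1] compares
   the norms. *)
pose V := U `&` [set x | `|x0 - x| < delta0 / n.+1%:R].
apply: (@graph_cone_property R n D D' Om0 V x0 j g) => //.
- by apply: openI => //; exact: open_normball.
- by split => //=; rewrite subrr normr0 divr_gt0// ltr0n.
- move=> x [_ /= x0x]; apply/cover/(ig_tube geo); exists x0 => //.
  apply: (le_lt_trans (enorm_le_norm _)).
  by rewrite distrC mulrC -ltr_pdivlMr// ltr0n.
- by move=> x [Ux _]; exact: graph.
- exact: clD'.
Qed.

Lemma interface_cone (Omi : set 'rV[R]_n.+1) : Omi = Om1 \/ Omi = Om2 ->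
  exists Omj : set 'rV[R]_n.+1, exists2 e : R, 0 < e &
    [/\ open Omi, open Omj, Omi `&` Omj = set0 & Omi `<=` Om] /\
    (Om `<=` Omi `|` Om0 `|` Omj /\ forall x, Om0 x -> cone_property Omi x e e^-1).
Proof.
have [_ o1 _] := ig_dom1 geo; have [_ o2 _] := ig_dom2 geo.
have [cpt _] := ig_interface geo.
have cl1 x : Om0 x -> closure Om1 x.
  by move=> Gx; have : boundary Om1 x by [rewrite (ig_bd1 geo); right]; case.
have cl2 x : Om0 x -> closure Om2 x by rewrite -(ig_bd2 geo) => -[].
have cov1 : Om `<=` Om1 `|` Om0 `|` Om2 by rewrite -(ig_cover geo).
have cov2 : Om `<=` Om2 `|` Om0 `|` Om1.
  by move=> x /cov1[[]|]; [right|left; right|left; left].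
have d12 := ig_disj12 geo; have d21 := d12; rewrite setIC in d21.
move=> [->|->].
  have [e e0 ce] := compact_cone_property cpt
    (fun x => interface_local_cone o1 o2 d12 (ig_disj01 geo) (ig_disj02 geo) cov1 cl2).
  exists Om2, e => //; split=> //; split=> // x Ox.
  by rewrite (ig_cover geo); left; left.
have [e e0 ce] := compact_cone_property cpt
  (fun x => interface_local_cone o2 o1 d21 (ig_disj02 geo) (ig_disj01 geo) cov2 cl1).
exists Om1, e => //; split=> //; split=> // x Ox.
by rewrite (ig_cover geo); right.
Qed.

Lemma polytope_star (p : open_convex_polytope Om) : [/\ open Om, convex Om &
  forall y z (t : R), Om y -> closure Om z -> 0 <= t < 1 -> Om (y + t *: (z - y))].
Proof.
case: p => _ [N [p OmE]]; rewrite OmE; split.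
- exact: open_interior.
- exact/convex_interior/convex_hull.
- move=> y z t Oy clz t01; apply: convex_interior_star => //; first exact: convex_hull.
  have := closure_subset (@interior_subset _ (hull p finset.setT)) clz.
  by rewrite -(closure_id _).1//; exact: closed_hull.
Qed.

End interface_geometry.

Section uniform_estimate.
Context (R : realType) (n : nat).
Hypothesis n12 : n = 1%N \/ n = 2%N.

Lemma quasiuniform_le (m : mesh R n.+1) Om kappa kappa' h : triangulation m Om ->
  kappa <= kappa' -> quasiuniform m kappa h -> quasiuniform m kappa' h.
Proof.
move=> tri kk qu T Tm; have /andP[-> hk] := qu T Tm; apply: (le_trans hk).
rewrite ler_wpM2r//; have [cT _] := tri_simplex tri Tm.
have /card_gt0P[j jT] : (0 < #|T|)%N by rewrite cT.
have := enorm_le_diam (hull_vertex (@node _ _ m) jT) (hull_vertex _ jT).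
by apply: le_trans; exact: enorm_ge0.
Qed.

Lemma shape_regular_le (m : mesh R n.+1) sigma sigma' : sigma <= sigma' ->
  shape_regular m sigma -> shape_regular m sigma'.
Proof.
move=> ss sr T Tm; have [c cT] := sr T Tm; exists c => x xc; apply: cT.
by apply: le_trans xc; rewrite ler_wpM2r// enorm_ge0.
Qed.

Lemma large_intersection_volume (m : mesh R n.+1) D kappa gamma h T :
  0 < h -> 0 < gamma -> 1 <= kappa -> h <= kappa * diam_cell T ->
  @large_intersection R n.+1 m D gamma T ->
  gamma / kappa ^+ n.+1 * h ^+ n.+1 <= volume (region T `&` D).
Proof.
move=> h0 g0 k1 hk gT.
have k0 : 0 < kappa by rewrite (lt_le_trans ltr01).
have diam0 : 0 < diam_cell T by rewrite -(pmulr_rgt0 _ k0) (lt_le_trans h0).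
move: gT; rewrite /large_intersection ler_pdivlMr ?exprn_gt0//.
apply: le_trans; rewrite -mulrA ler_wpM2l ?(ltW g0)//.
rewrite -exprVn -(exprMn n.+1 kappa^-1 h) lerXn2r ?nnegrE ?mulr_ge0 ?invr_ge0 ?(ltW k0) ?(ltW h0)//.
  exact: ltW.
by rewrite ler_pdivrMl.
Qed.

(** The threshold and the constant are fixed before the mesh, the macro elements and [v]; everything
    below is computed from the geometry, [kappa], [sigma], [gamma] and [N]. *)
Lemma uniform_stab_le (Om G D D' : set 'rV[R]_n.+1) (e0 kappa sigma gamma : R)
    (N : nat) : open_convex_polytope Om -> open D -> open D' -> D `&` D' = set0 ->
  D `<=` Om -> Om `<=` D `|` G `|` D' -> 0 < e0 ->
  (forall x, G x -> cone_property D x e0 e0^-1) -> 0 < gamma ->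
  exists2 hbar : R, 0 < hbar & exists C : R, forall (h : R) (m : mesh R n.+1)
      (MM : {set {set {set 'I_(nv m)}}}) (v : dgfun m),
    0 < h <= hbar -> triangulation m Om -> quasiuniform m kappa h ->
    shape_regular m sigma -> macro_partition m D gamma N MM ->
    stab h (int_faces (active m D)) v <=
    C * (grad_norm2 D v + h^-1 * jump_norm2 (int_faces (active m D)) D v +
         \sum_(M in MM) stab h (int_faces M) v).
Proof.
move=> pOm oD oD' DD' DOm cover e00 ce g0.
have [oOm cOm star] := polytope_star pOm.
(* Enlarging the constants to at least 1 only weakens the mesh conditions and makes the constants
   positive. *)
pose k1 := Num.max 1 kappa; pose s1 := Num.max 1 sigma.
have k11 : 1 <= k1 by rewrite le_max lexx.
have s11 : 1 <= s1 by rewrite le_max lexx.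
have k10 : 0 < k1 by rewrite (lt_le_trans ltr01).
have s10 : 0 < s1 by rewrite (lt_le_trans ltr01).
pose r0 := (k1 * s1 * n.+1%:R)^-1.
have r00 : 0 < r0 by rewrite invr_gt0 !mulr_gt0// ltr0n.
(* The large intersection is measured against the diameter of the cell; the power of [k1] converts
   it to [h]. *)
pose gam := gamma / k1 ^+ n.+1.
have gam0 : 0 < gam by rewrite divr_gt0// exprn_gt0.
have L0 : 0 <= e0^-1 by rewrite invr_ge0 ltW.
have n0 : (0 < n)%N by case: n12 => ->.
have [rho rho01 deep] := deep_point n0 gam0 L0.
pose t := tube_radius (e0^-1) N.
have t1 : 1 <= t by have := macro_radius_lt_tube N L0; have := macro_radius_ge3 R N; rewrite /t; lra.
have th01 : 0 < rho / 4 <= 1 by case/andP: rho01 => ? ?; apply/andP; split; lra.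
have R20 : 0 <= 2 * macro_reach (t + 1) N + 2.
  by rewrite addr_ge0// mulr_ge0// /macro_reach addr_ge0 ?mulr_ge0//; lra.
have [K KP] := @card_near_cells_le R n _ _ R20 r00.
(* This gives [(t + 5) * h < e0]: within distance [3 * h] of the interface, the tubes and their
   margins stay in the ball where the cone property holds. *)
exists (e0 / (t + 6)); first by rewrite divr_gt0//; lra.
exists (face_const n r0 gam (rho / 4) (t + 1) N K * (K * K)%:R).
move=> h m MM v /andP[h0 hbar] tri qu sr [part macro].
have {}qu : quasiuniform m k1 h by apply: quasiuniform_le tri _ qu; rewrite le_max lexx orbT.
have {}sr : shape_regular m s1 by apply: shape_regular_le sr; rewrite le_max lexx orbT.
have size := quasiuniform_size qu.
have fat := shape_regular_fat k11 s11 qu sr.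
have coverMM : finset.cover MM = active m D by case/and3P: part => /eqP.
have MM_active M : M \in MM -> {subset M <= active m D}.
  by move=> MMM T TM; rewrite -coverMM; apply/finset.bigcupP; exists M.
have MM_cover T : T \in active m D -> exists2 M, M \in MM & T \in M.
  by rewrite -coverMM => /finset.bigcupP[M MMM TM]; exists M.
have MM_large M : M \in MM -> exists TM : {set 'I_(nv m)},
    [/\ TM \in M, gam * h ^+ n.+1 <= volume (region TM `&` D) &
      forall T, T \in M -> exists p : seq {set 'I_(nv m)},
        [/\ path (@face_adj R n.+1 m) TM p, last TM p = T, {subset p <= M} &
            (seq.size p <= N)%N]].
  move=> MMM; have [_ [TM [TMM large conn]]] := macro _ MMM.
  exists TM; split => //; apply: large_intersection_volume => //.
  by have /andP[] := qu TM (active_cell (MM_active _ MMM _ TMM)).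
rewrite -sum_energy//.
apply: (stab_le_energy v n12 tri h0 size r00 fat oD gam0 th01 _ MM_active MM_cover
  MM_large).
- lra.
- by move=> x S; exact: (KP m Om h tri h0 size fat x S).
- move=> A B AA BA AB.
  apply: (adjacent_cells_linked oOm cOm star oD oD' DD' DOm cover ce L0 rho01 _ tri h0 size r00
    fat MM_active MM_cover MM_large) => //.
  + by move=> E x0 c e k; exact: deep.
  + have t6 : 0 < t + 6 by lra.
    by move: hbar; rewrite ler_pdivlMr//; rewrite -/t; lra.
Qed.

End uniform_estimate.

Theorem lemma3p4 (R : realType) (d : nat) (hd : d = 2%N \/ d = 3%N)
    (Om Om0 Om1 Om2 : set 'rV[R]_d) (delta0 : R)
    (geo : interface_geometry Om Om0 Om1 Om2 delta0)
    (Omi : set 'rV[R]_d) (hOmi : Omi = Om1 \/ Omi = Om2)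
    (kappa sigma gamma : R) (gamma_gt0 : 0 < gamma) (N : nat) :
  exists2 hbar : R, 0 < hbar &
  forall h0 : R, 0 < h0 <= hbar ->
  forall (Th : R -> mesh R d)
    (Mh : forall h : R, {set {set {set 'I_(nv (Th h))}}}),
  (forall h : R, 0 < h <= h0 ->
    [/\ triangulation (Th h) Om, quasiuniform (Th h) kappa h,
        shape_regular (Th h) sigma &
        macro_partition (Th h) Omi gamma N (Mh h)]) ->
  exists C : R, forall h : R, 0 < h <= h0 ->
  forall v : dgfun (Th h), Wh (Th h) Om Omi v ->
    stab h (int_faces (active (Th h) Omi)) v <=
    C * (grad_norm2 Omi v
         + h^-1 * jump_norm2 (int_faces (active (Th h) Omi)) Omi v
         + \sum_(M in Mh h) stab h (int_faces M) v).
Proof.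
have [n dE n12] : exists2 n, d = n.+1 & n = 1%N \/ n = 2%N.
  by case: hd => ->; [exists 1%N => //; left | exists 2%N => //; right].
subst d.
have [Omj [e e0 [[oD oD' DD' DOm] [cover ce]]]] := interface_cone geo hOmi.
have [hbar hbar0 [C CP]] := uniform_stab_le n12 kappa sigma N (ig_polytope geo) oD
  oD' DD' DOm cover e0 ce gamma_gt0.
exists hbar => // h0 /andP[h00 h0b] Th Mh hyp; exists C => h hh v _.
have [tri qu sr macro] := hyp h hh.
apply: CP => //; case/andP: hh => -> /= hh0; exact: le_trans h0b.
Qed.
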